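(* Let $a>0$, $T>0$ and let $f\in C^2(\mathbb{R};\mathbb{R})$ be strictly convex. For $i=1,2$ let $u_0^i,w_0^i\in L^1(\mathbb{R})\cap BV(\mathbb{R})$ with $|u_0^i(x)-w_0^i(x)|\le a$ for a.e. $x$, and let $(u_i,w_i)$ be an entropy weak solution (as defined in the context) of the Cauchy problem $$\partial_t u+\partial_t w+\partial_x f(u)=0,\quad w=\mathcal F(u,w_0^i)\ \text{ in }\mathbb{R}\times[0,T[,\qquad u(\cdot,0)=u_0^i,\ w(\cdot,0)=w_0^i ,$$ where $\mathcal F$ is the Play hysteresis operator of amplitude $a$. Then for almost every $t\in[0,T[$ $$\int_{-\infty}^{+\infty}\big(|u_1-u_2|(x,t)+|w_1-w_2|(x,t)\big)\,dx\le\int_{-\infty}^{+\infty}\big(|u_0^1-u_0^2|+|w_0^1-w_0^2|\big)\,dx .$$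
   Context: Let $\mathcal L=\{(u,w)\in\mathbb{R}^2: |u-w|\le a\}$. A couple $u,w\in C^0([0,T[;L^1_{loc}(\mathbb{R};\mathbb{R}))$ is an entropy weak solution of the Cauchy problem with initial data $(u_0,w_0)$ (the hysteresis relation $w=\mathcal F(u,w_0)$ being encoded in (ii)-(iii)) if: (i) for every $\phi\in C^1_c(\mathbb{R}\times[0,T[;\mathbb{R}^+)$ and every $(k,\hat k)\in\mathcal L$, $$\int_0^T\!\!\int_{\mathbb{R}}\Big[(|u-k|+|w-\hat k|)\partial_t\phi+\operatorname{sign}(u-k)(f(u)-f(k))\partial_x\phi\Big]dx\,dt+\int_{\mathbb{R}}(|u_0(x)-k|+|w_0(x)-\hat k|)\phi(x,0)\,dx\ge0;$$ (ii) $|u(x,t)-w(x,t)|\le a$ for a.e. $(x,t)\in\mathbb{R}\times[0,T[$; (iii) $u(\cdot,t),w(\cdot,t)\in L^2(\mathbb{R})$ for a.e. $t$, the distributional derivative $\partial_t w$ is a (signed) measure on $\mathbb{R}\times[0,T[$, with total variation measure $|\partial_t w|$, and for a.e. $t\in]0,T[$ $$\tfrac12\int_{\mathbb{R}}(u(x,t)^2-u_0(x)^2)dx+\tfrac12\int_{\mathbb{R}}(w(x,t)^2-w_0(x)^2)dx\le -a\,|\partial_t w|(\mathbb{R}\times]0,t[).$$ *)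

(* Defs.v *)
From HB Require Import structures.
From mathcomp Require Import all_boot all_order all_algebra.
From mathcomp Require Import all_classical all_reals all_analysis.

Set Implicit Arguments.
Unset Strict Implicit.
Unset Printing Implicit Defensive.

Import Order.TTheory GRing.Theory Num.Theory.
Import numFieldNormedType.Exports.

Local Open Scope classical_set_scope.
Local Open Scope ring_scope.

Notation leb := (@lebesgue_measure _).
Notation leb2 := (product_measure1 leb leb).

Section regularity.
Context {R : realType} {V : normedModType R}.

Definition iter_derive (vs : seq V) (g : V -> R) : V -> R :=
  foldr (fun v h => 'D_v h) g vs.

(* All the iterated directional derivatives of order < k are differentiable and
   those of order <= k are continuous. *)
Definition is_Ck (k : nat) (g : V -> R) : Prop :=
  forall vs : seq V,
    ((size vs < k)%N -> forall x, differentiable (iter_derive vs g) x) /\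
    ((size vs <= k)%N -> continuous (iter_derive vs g)).

Definition is_Coo (g : V -> R) : Prop := forall k, is_Ck k g.

Definition compactly_supported_in (D : set V) (g : V -> R) : Prop :=
  let S := closure [set x | g x != 0] in compact S /\ S `<=` D.

End regularity.

Definition strictly_convex {R : realType} (f : R -> R) : Prop :=
  forall x y s : R, x != y -> 0 < s < 1 ->
    f (s * x + (1 - s) * y) < s * f x + (1 - s) * f y.

Definition charge_integral d (X : measurableType d) (R : realType)
    (nu : {charge set X -> \bar R}) (P N : set X)
    (nuPN : hahn_decomposition nu P N) (g : X -> R) : \bar R :=
  (\int[jordan_pos nuPN]_x (g x)%:E - \int[jordan_neg nuPN]_x (g x)%:E)%E.

Section spaces.
Context {R : realType}.

Definition slab (I : interval R) : set (R * R) := [set z | z.2 \in I].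

(* The distributional derivative of g is a finite signed measure. *)
Definition is_BV (g : R -> R) : Prop :=
  locally_integrable setT g /\
  exists (nu : {charge set (measurableTypeR R) -> \bar R}) P N
      (nuPN : hahn_decomposition nu P N),
    forall phi : R -> R, is_Coo phi -> compactly_supported_in setT phi ->
      (\int[leb]_x (g x * (phi^`())%classic x)%:E
        = - charge_integral nuPN phi)%E.

(* [0, T[ -> L^1_loc(R), continuous.  The elements of L^1_loc(R) are classes of
   functions modulo null sets; v is a jointly Borel representative, which always
   exists. *)
Definition C0_L1loc (T : R) (v : R * R -> R) : Prop :=
  [/\ measurable_fun (slab `[0, T[) v,
      forall t, t \in `[0, T[ -> locally_integrable setT (fun x => v (x, t)) &
      forall t (K : set R), t \in `[0, T[ -> compact K ->
        (\int[leb]_(x in K) `|v (x, s) - v (x, t)|%:E)%E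
          @[s --> within `[0, T[ (nbhs t)] --> 0%E].

End spaces.

Section entropy_weak_solution.
Context {R : realType}.
Variables (a T : R) (f u0 w0 : R -> R) (u w : R * R -> R).

Definition strip_L : set (R * R) := [set k | `|k.1 - k.2| <= a].

(* Test functions in C^1_c(R x [0, T[; R^+) are the restrictions to t >= 0 of
   the following ones: their support may meet t = 0, and the sign condition only
   concerns t >= 0. *)
Definition entropy_test (phi : R * R -> R) : Prop :=
  [/\ is_Ck 1 phi, compactly_supported_in (slab `]-oo, T[) phi &
      forall x t, 0 <= t -> 0 <= phi (x, t)].

Definition entropy_integrand (k : R * R) (phi : R * R -> R) (z : R * R) : R :=
  (`|u z - k.1| + `|w z - k.2|) * 'D_(0, 1) phi z
  + Num.sg (u z - k.1) * (f (u z) - f k.1) * 'D_(1, 0) phi z.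

(* The integrability condition says that the space-time integral makes sense:
   f(u) is not integrable in general for u in L^1_loc, and the library integral
   has a default value on non-integrable functions. *)
Definition entropy_inequality : Prop :=
  forall (phi : R * R -> R) (k : R * R), entropy_test phi -> strip_L k ->
    leb2.-integrable (slab `[0, T[) (EFin \o entropy_integrand k phi) /\
    (0 <= \int[leb2]_(z in slab `[0, T[%R) (entropy_integrand k phi z)%:E
          + \int[leb]_x ((`|u0 x - k.1| + `|w0 x - k.2|) * phi (x, 0))%:E)%E.

(* nu is the distribution d_t w on the open set R x ]0, T[ (what nu does outside
   of it is irrelevant).  Charges are finite; this loses no generality, since for
   u0, w0 in L^2 the energy inequality below bounds |d_t w|(R x ]0, t[) uniformly
   in t. *)
Definition is_distr_dt
    (nu : {charge set (measurableTypeR R * measurableTypeR R)%type -> \bar R})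
    P N (nuPN : hahn_decomposition nu P N) : Prop :=
  forall phi : R * R -> R, is_Coo phi ->
    compactly_supported_in (slab `]0, T[) phi ->
    (\int[leb2]_(z in slab `[0, T[%R) (w z * 'D_(0, 1) phi z)%:E
       = - charge_integral nuPN phi)%E.

Definition energy_inequality : Prop :=
  {ae leb, forall t, t \in `[0, T[ ->
     (fun x => u (x, t)) \in Lfun leb 2%:E /\
     (fun x => w (x, t)) \in Lfun leb 2%:E} /\
  exists (nu : {charge set (measurableTypeR R * measurableTypeR R)%type -> \bar R})
      P N (nuPN : hahn_decomposition nu P N),
    is_distr_dt nuPN /\
    {ae leb, forall t, t \in `]0, T[ ->
      (2^-1%:E * \int[leb]_x (u (x, t) ^+ 2 - u0 x ^+ 2)%:E
       + 2^-1%:E * \int[leb]_x (w (x, t) ^+ 2 - w0 x ^+ 2)%:E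
       <= - (a%:E * charge_variation nuPN (slab `]0, t[%R)))%E}.

Definition entropy_weak_solution : Prop :=
  [/\ C0_L1loc T u /\ C0_L1loc T w,
      entropy_inequality,
      {ae leb2, forall z, slab `[0, T[ z -> `|u z - w z| <= a} &
      energy_inequality].

End entropy_weak_solution.

(* Main.v *)
(** Write [eta = |u1 - u2| + |w1 - w2|] and [q = sign (u1 - u2) (f u1 - f u2)].
    Doubling the variables (each solution tested with the values of the other as
    the constants of [strip_L]) gives Kato's inequality [eta_t + q_x <= 0].  The
    functions [f (u_i)] are locally integrable but not locally bounded: the oscillation
    of the flux under mollification is controlled by that of
    [sign b (f b - f 0 - f'(0) b)], which is nondecreasing in [b] as [f] is convex.  The initial trace comes
    from testing with rational constants on the line [t = 0].

    There is no finite speed of propagation, so Kato's inequality is integrated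
    over [[y, z] x [0, tau]], and the flux through the vertical sides has to vanish
    for suitable [y -> -oo], [z -> +oo].  Since [d_t w_i] is a finite measure, the
    total variation of [t |-> w_i (x, t)] is an integrable function of [x], hence at
    most 1 off a set of finite measure.  Off a set of finite measure [w_i], hence
    [u_i] by the strip condition, is therefore bounded and [|q| <= L eta].  There
    [E x = \int_0^tau eta (x, t) dt] is bounded, which first shows that [eta (., t)]
    is integrable uniformly in [t]; then [E] is integrable, hence small off a set of
    finite measure, and so is the flux. *)
Require Import Defs.
From HB Require Import structures.
From mathcomp Require Import all_boot all_order all_algebra.
From mathcomp Require Import all_classical all_reals all_analysis.
From mathcomp Require Import measurable_realfun.
From mathcomp Require Import ring lra.

Import Order.TTheory GRing.Theory Num.Theory.
Import numFieldNormedType.Exports.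

Local Open Scope classical_set_scope.
Local Open Scope ring_scope.

Set Implicit Arguments.
Unset Strict Implicit.
Unset Printing Implicit Defensive.

(** * Smooth cut-offs and mollifiers *)

(** The doubling is legal because almost every value of a solution lies in [strip_L], so it is an
    admissible constant for the other one. Since no bound on the solutions is at hand, even the
    local integrability of [f (u z)] has to be extracted from the integrability clause of the
    entropy inequality, by test functions whose x-derivative stays away from 0 on a box where their
    t-derivative vanishes. Convexity enters when a constant k of the Kruzkov flux is moved to k'. If
    the other value x lies between k and k', the change involves the oscillation of f on the whole
    interval, not just f k - f k'. Removing the tangent at 0 and reflecting the decreasing branch
    gives a monotone function of k whose increments control that oscillation for all x at once. All
    kernels are one-sided, supported in [0, h]. Mollified tests then move forward in time only and
    stay away from t = 0, and the limits h -> 0+ match continuity of the slices from the right,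
    which holds at t = 0 too. The bound on the variation of w is known for each t off a null set of
    x depending on t; it is turned into a statement on the plane before being read along vertical
    lines. *)

Section smooth_functions.
Context {R : realType}.
Implicit Types (f g : R -> R) (x y h : R).

(** The powers x^-n in front of exp(-1/x) are carried along because they are what differentiation
    produces: the family is closed under derivatives up to linear combinations, which makes the
    smoothness of [flat_exp 0] an induction. *)
Definition flat_exp (n : nat) (x : R) : R :=
  if 0 < x then x^-1 ^+ n * expR (- x^-1) else 0.

Lemma flat_exp_le0 n x : x <= 0 -> flat_exp n x = 0.
Proof. by move=> x0; rewrite /flat_exp ltNge x0. Qed.

Lemma flat_exp_ge0 n x : 0 <= flat_exp n x.
Proof.
rewrite /flat_exp; case: ifPn => // x0.
by rewrite mulr_ge0 ?expR_ge0// exprn_ge0// invr_ge0 ltW.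
Qed.

Lemma flat_exp_gt0 n x : 0 < x -> 0 < flat_exp n x.
Proof.
by move=> x0; rewrite /flat_exp x0 mulr_gt0 ?expR_gt0// exprn_gt0// invr_gt0.
Qed.

(** From exp(y) >= y^(n+2) / (n+2)! at y = 1/x. The exponent n + 2 leaves a factor x^2: one x is
    used by the difference quotient at 0, the other makes this quotient tend to 0. *)
Lemma flat_exp_bound n x : flat_exp n x <= (n.+2)`!%:R * x ^+ 2.
Proof.
rewrite /flat_exp; case: ifPn => x0; last by rewrite mulr_ge0// sqr_ge0.
have y0 : 0 < x^-1 by rewrite invr_gt0.
rewrite expRN ler_pdivrMr ?expR_gt0//.
apply: (@le_trans _ _ ((n.+2)`!%:R * x ^+ 2 * (x^-1 ^+ n.+2 / (n.+2)`!%:R))).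
  rewrite le_eqVlt; apply/orP; left; apply/eqP.
  have F0 : (n.+2)`!%:R != 0 :> R by rewrite pnatr_eq0 -lt0n fact_gt0.
  rewrite -[in x^-1 ^+ n.+2]addn2 exprD; move: ((n.+2)`!%:R) F0 (x^-1 ^+ n) => F F0 p.
  by field; rewrite F0 gt_eqF.
rewrite ler_wpM2l//; first by rewrite mulr_ge0// sqr_ge0.
by apply: le_trans (expR_ge1Dxn n.+1 (ltW y0)); rewrite lerDr.
Qed.

Lemma is_derive_flat_exp n x :
  is_derive x 1 (flat_exp n) (flat_exp n.+2 x - n%:R * flat_exp n.+1 x).
Proof.
have [x0|x0|->] := ltgtP x 0.
- rewrite !flat_exp_le0 ?(ltW x0)// mulr0 subr0.
  apply: (near_eq_is_derive (f := cst 0)).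
  near=> y; rewrite /= flat_exp_le0//; apply: ltW.
  by near: y; exact: lt_nbhsl.
- apply: (near_eq_is_derive (f := fun y => y^-1 ^+ n * expR (- y^-1))).
    near=> y; rewrite /flat_exp ifT//.
    by near: y; exact: lt_nbhsr.
  have dV : is_derive x (1 : R) (fun y : R => y^-1) (- x ^- 2).
    have := @is_deriveV R id x 1 1 (lt0r_neq0 x0) (is_derive_id _ _).
    by rewrite /= scaler1.
  have dN : is_derive x (1 : R) (fun y : R => - y^-1) (x ^- 2).
    by rewrite -[x ^- 2]opprK; exact: is_deriveN.
  have dE := @is_derive1_comp R expR (fun y => - y^-1) x _ _ (is_derive_expR _) dN.
  have dX := @is_deriveX R R (fun y => y^-1) n x 1 _ dV.
  have dM := is_deriveM dX dE.
  have -> : (fun y : R => y^-1 ^+ n * expR (- y^-1)) =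
      (fun y : R => y^-1) ^+ n * (expR \o (fun y => - y^-1)).
    by apply/funext => y; rewrite !fctE.
  apply: (is_derive_eq dM).
  rewrite /flat_exp x0 !fctE /= -!exprVn /GRing.scale/=.
  case: n {dX dM} => [|n] /=; first by rewrite expr0 !mul0r !mul1r; ring.
  by rewrite !exprS; ring.
- rewrite !flat_exp_le0// mulr0 subr0.
  apply/is_derive1_caratheodory.
  exists (fun z => flat_exp n z / z); split.
  + move=> z; rewrite (@flat_exp_le0 _ 0)// !subr0.
    have [->|z0] := eqVneq z 0; first by rewrite flat_exp_le0// mulr0.
    by rewrite divfK.
  + rewrite /prop_for/= /continuous_at (@flat_exp_le0 _ 0)// mul0r.
    apply/cvgr0Pnorm_le => e e0; near=> z.
    apply: (@le_trans _ _ ((n.+2)`!%:R * `|z|)).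
      have [->|z0] := eqVneq z 0; first by rewrite invr0 mulr0 !normr0 mulr0.
      rewrite normrM normfV ler_pdivrMr ?normr_gt0// -mulrA -expr2 real_normK ?num_real//.
      by rewrite ger0_norm ?flat_exp_ge0// flat_exp_bound.
    rewrite -ler_pdivlMl ?ltr0n ?fact_gt0//.
    near: z; apply: cvgr0_norm_le; first exact: cvg_id.
    by rewrite mulr_gt0// invr_gt0 ltr0n fact_gt0.
  + by rewrite flat_exp_le0// mul0r.
Unshelve. all: by end_near. Qed.

(** A syntactic certificate of smoothness: every constructor has a derivative inside the class, so
    derivatives of all orders come from one structural induction. *)
Inductive smooth : (R -> R) -> Prop :=
| smooth_flat_exp n : smooth (flat_exp n)
| smooth_cst c : smooth (fun=> c)
| smooth_affine c d f : smooth f -> smooth (fun x => f (c * x + d))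
| smoothD f g : smooth f -> smooth g -> smooth (fun x => f x + g x)
| smoothM f g : smooth f -> smooth g -> smooth (fun x => f x * g x)
| smoothV f : smooth f -> (forall x, f x != 0) -> smooth (fun x => (f x)^-1).

Lemma smooth_derivative f : smooth f ->
  exists2 f', smooth f' & forall x, is_derive x 1 f (f' x).
Proof.
elim=> {f} [n|c|c d f sf [f' sf' df]|f g sf [f' sf' df] sg [g' sg' dg]
  |f g sf [f' sf' df] sg [g' sg' dg]|f sf [f' sf' df] f0].
- exists (fun x => flat_exp n.+2 x + (- n%:R) * flat_exp n.+1 x).
    by apply: smoothD; [|apply: smoothM];
      [exact: smooth_flat_exp|exact: smooth_cst|exact: smooth_flat_exp].
  by move=> x; rewrite mulNr; exact: is_derive_flat_exp.
- by exists (fun=> 0); [exact: smooth_cst|move=> x; exact: is_derive_cst].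
- exists (fun x => f' (c * x + d) * c).
    by apply: smoothM; [exact: smooth_affine|exact: smooth_cst].
  move=> x; apply: (@is_derive1_comp R f (fun y => c * y + d)) => //.
  have h := is_deriveD (is_deriveZ c (is_derive_id x (1 : R))) (is_derive_cst d x (1 : R)).
  by apply: (is_derive_eq h); rewrite /GRing.scale/= mulr1 addr0.
- exists (fun x => f' x + g' x); first exact: smoothD.
  by move=> x; exact: is_deriveD.
- exists (fun x => f x * g' x + g x * f' x).
    by apply: smoothD; exact: smoothM.
  by move=> x; exact: is_deriveM.
- exists (fun x => (-1) * ((f x)^-1 * (f x)^-1) * f' x).
    apply: smoothM => //; apply: smoothM; first exact: smooth_cst.
    by apply: smoothM; exact: smoothV.
  move=> x; apply: (is_derive_eq (is_deriveV (f0 x) (df x))).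
  by rewrite /GRing.scale/= expr2 invfM mulN1r.
Qed.

Lemma smooth_continuous f : smooth f -> continuous f.
Proof.
move=> /smooth_derivative[f' _ df] x.
by apply: differentiable_continuous; apply/derivable1_diffP; exact: ex_derive.
Qed.

Lemma measurable_smooth f : smooth f -> measurable_fun setT f.
Proof. by move=> /smooth_continuous; exact: continuous_measurable_fun. Qed.

Lemma smoothB (f g : R -> R) : smooth f -> smooth g -> smooth (fun x => f x - g x).
Proof.
move=> sf sg; have -> : (fun x => f x - g x) = fun x => f x + (-1) * g x.
  by apply/funext => x; rewrite mulN1r.
by apply: smoothD => //; apply: smoothM => //; exact: smooth_cst.
Qed.

(** Sums are included because a directional derivative of a tensor product is a sum of two tensor
    products. *)
Inductive smooth2 : (R * R -> R) -> Prop :=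
| smooth2_prod f g : smooth f -> smooth g -> smooth2 (fun z => f z.1 * g z.2)
| smooth2D (f g : R * R -> R) : smooth2 f -> smooth2 g -> smooth2 (fun z => f z + g z).

Lemma is_diff_fst (z : R * R) : is_diff z (@fst R R) fst.
Proof.
have c : continuous (@fst R R) by move=> x; exact: cvg_fst.
have d : differentiable (@fst R R) z.
  exact: (@linear_differentiable _ _ _
    (@fst R^o R^o : {linear (R^o * R^o)%type -> R^o})).
apply: DiffDef => //.
exact: (@diff_lin _ _ _ (@fst R^o R^o : {linear (R^o * R^o)%type -> R^o}) z c).
Qed.

Lemma is_diff_snd (z : R * R) : is_diff z (@snd R R) snd.
Proof.
have c : continuous (@snd R R) by move=> x; exact: cvg_snd.
have d : differentiable (@snd R R) z.
  exact: (@linear_differentiable _ _ _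
    (@snd R^o R^o : {linear (R^o * R^o)%type -> R^o})).
apply: DiffDef => //.
exact: (@diff_lin _ _ _ (@snd R^o R^o : {linear (R^o * R^o)%type -> R^o}) z c).
Qed.

Lemma is_diff_tensor (f g : R -> R) (f' g' : R -> R) (z : R * R) :
  (forall x, is_derive x 1 f (f' x)) -> (forall x, is_derive x 1 g (g' x)) ->
  is_diff z (fun z => f z.1 * g z.2)
    (fun v => v.1 * f' z.1 * g z.2 + f z.1 * (v.2 * g' z.2)).
Proof.
move=> df dg.
have df1 : is_diff z (f \o fst) (fun v => v.1 * f' z.1).
  have ifs : is_diff z (@fst R R) fst := is_diff_fst z.
  have iff : is_diff (z.1) f (fun v => v * f' z.1).
    have d : differentiable f (z.1) by apply/derivable1_diffP; exact: ex_derive.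
    apply: DiffDef => //; apply/funext => v.
    by rewrite diff1E// /GRing.scale/= derive1E derive_val.
  exact: (is_diff_comp ifs iff).
have dg1 : is_diff z (g \o snd) (fun v => v.2 * g' z.2).
  have ifs : is_diff z (@snd R R) snd := is_diff_snd z.
  have iff : is_diff (z.2) g (fun v => v * g' z.2).
    have d : differentiable g (z.2) by apply/derivable1_diffP; exact: ex_derive.
    apply: DiffDef => //; apply/funext => v.
    by rewrite diff1E// /GRing.scale/= derive1E derive_val.
  exact: (is_diff_comp ifs iff).
have h := is_diffM df1 dg1.
apply: (is_diff_eq h); apply/funext => v.
rewrite /= !fctE /=.
change (f z.1 * (v.2 * g' z.2) + g z.2 * (v.1 * f' z.1) =
  v.1 * f' z.1 * g z.2 + f z.1 * (v.2 * g' z.2)).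
by rewrite addrC mulrC.
Qed.

Lemma derive_tensor (f g : R -> R) (f' g' : R -> R) (z v : R * R) :
  (forall x, is_derive x 1 f (f' x)) -> (forall x, is_derive x 1 g (g' x)) ->
  'D_v (fun z => f z.1 * g z.2) z = v.1 * f' z.1 * g z.2 + f z.1 * (v.2 * g' z.2).
Proof.
move=> df dg; have h := is_diff_tensor z df dg.
rewrite deriveE; last exact: ex_diff.
by rewrite diff_val.
Qed.

Lemma smooth2_derive (f : R * R -> R) : smooth2 f ->
  (forall z, differentiable f z) /\ forall v, smooth2 ('D_v f).
Proof.
elim=> {f} [f g sf sg|f g _ [df sf] _ [dg sg]].
- have [f' sf' df] := smooth_derivative sf.
  have [g' sg' dg] := smooth_derivative sg.
  split=> [z|v]; first by have h := is_diff_tensor z df dg; exact: ex_diff.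
  have -> : 'D_v (fun z : R * R => f z.1 * g z.2) =
      (fun z => v.1 * f' z.1 * g z.2 + f z.1 * (v.2 * g' z.2)).
    by apply/funext => z; exact: derive_tensor.
  apply: smooth2D.
    by apply: (smooth2_prod (f := fun x => v.1 * f' x)) => //; apply: smoothM => //; exact: smooth_cst.
  by apply: (smooth2_prod (g := fun x => v.2 * g' x)) => //; apply: smoothM => //; exact: smooth_cst.
- split=> [z|v]; first exact: differentiableD.
  have -> : 'D_v (fun z : R * R => f z + g z) = (fun z => 'D_v f z + 'D_v g z).
    by apply/funext => z; rewrite deriveD//; exact: diff_derivable.
  exact: smooth2D.
Qed.

Lemma smooth2_Coo (f : R * R -> R) : smooth2 f -> is_Coo f.
Proof.
move=> sf k vs.
have : smooth2 (iter_derive vs f).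
  by elim: vs => //= v vs /smooth2_derive[].
move=> /smooth2_derive[df _]; split => // _ z.
exact: differentiable_continuous.
Qed.

Lemma tensor_Coo f g : smooth f -> smooth g -> is_Coo (fun z : R * R => f z.1 * g z.2).
Proof. by move=> sf sg; apply: smooth2_Coo; exact: smooth2_prod. Qed.

(** The condition lives on an open set and leaves the endpoints free, so it passes to the
    derivative. *)
Definition vanishes_outside (a b : R) f := forall x, x < a \/ b < x -> f x = 0.

Lemma vanishes_outsideW (a b a' b' : R) f : a' <= a -> b <= b' ->
  vanishes_outside a b f -> vanishes_outside a' b' f.
Proof.
move=> aa bb fab x xab; apply: fab; case: xab => xab.
  by left; exact: lt_le_trans aa.
by right; exact: le_lt_trans xab.
Qed.

Lemma vanishes_outside_derive a b f f' : vanishes_outside a b f ->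
  (forall x, is_derive x 1 f (f' x)) -> vanishes_outside a b f'.
Proof.
move=> fab df x xab.
have : is_derive x 1 f 0.
  apply: (near_eq_is_derive (f := cst 0)).
  case: xab => [xa|bx]; near=> y; rewrite /= fab//; [left|right].
    by near: y; exact: lt_nbhsl.
  by near: y; exact: lt_nbhsr.
by move=> d0; rewrite -(@derive_val _ _ _ _ _ _ _ (df x)) (@derive_val _ _ _ _ _ _ _ d0).
Unshelve. all: by end_near. Qed.

Lemma tensor_compact_support (a b c d : R) f g (I : interval R) :
  vanishes_outside a b f -> vanishes_outside c d g ->
  (forall t, c <= t <= d -> t \in I) ->
  compactly_supported_in (slab I) (fun z : R * R => f z.1 * g z.2).
Proof.
move=> fab gcd cdI; rewrite /compactly_supported_in /=.
pose B : set (R * R) := `[a, b]%classic `*` `[c, d]%classic.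
have cB : compact B by apply: compact_setX; exact: segment_compact.
have clB : closed B by apply: compact_closed => //; exact: norm_hausdorff.
have SB : closure [set x : R * R | f x.1 * g x.2 != 0] `<=` B.
  rewrite closureE => z; apply; split => // -[x t] /=.
  rewrite mulf_eq0 negb_or => /andP[fx gt].
  split => /=; rewrite in_itv/=.
    apply/andP; split; rewrite leNgt; apply/negP => h; move/negP: fx; apply; apply/eqP; apply: fab.
      by left.
    by right.
  apply/andP; split; rewrite leNgt; apply/negP => h; move/negP: gt; apply; apply/eqP; apply: gcd.
    by left.
  by right.
split; first by apply: subclosed_compact cB SB; exact: closed_closure.
move=> z /SB[_ /=]; rewrite in_itv/= => /cdI.
by rewrite /slab.
Qed.

Definition smooth_step (x : R) : R := flat_exp 0 x / (flat_exp 0 x + flat_exp 0 (1 - x)).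

Let step_den_gt0 x : 0 < flat_exp 0 x + flat_exp 0 (1 - x).
Proof.
have [x0|x0] := ltP 0 x; first by rewrite ltr_wpDr ?flat_exp_ge0 ?flat_exp_gt0.
rewrite ltr_wpDl ?flat_exp_ge0 ?flat_exp_gt0// subr_gt0.
by rewrite (le_lt_trans x0).
Qed.

Lemma smooth_smooth_step : smooth smooth_step.
Proof.
have s1 : smooth (fun x => flat_exp 0 (1 - x)).
  have -> : (fun x => flat_exp 0 (1 - x)) = (fun x => flat_exp 0 ((-1) * x + 1)).
    by apply/funext => x; rewrite mulN1r addrC.
  by apply: smooth_affine; exact: smooth_flat_exp.
apply: smoothM; first exact: smooth_flat_exp.
apply: (@smoothV (fun x => flat_exp 0 x + flat_exp 0 (1 - x))).
  by apply: smoothD => //; exact: smooth_flat_exp.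
by move=> x; rewrite gt_eqF.
Qed.

Lemma smooth_step_le0 x : x <= 0 -> smooth_step x = 0.
Proof. by move=> x0; rewrite /smooth_step flat_exp_le0// mul0r. Qed.

Lemma smooth_step_ge1 x : 1 <= x -> smooth_step x = 1.
Proof.
move=> x1; rewrite /smooth_step (@flat_exp_le0 _ (1 - x)) ?subr_le0// addr0.
by rewrite divff// gt_eqF// flat_exp_gt0// (lt_le_trans _ x1).
Qed.

(** The derivative of [smooth_step] by the quotient rule, [flat_exp 2] being the derivative of
    [flat_exp 0]. As the slope of a transition from 0 to 1 it is a mollifier of mass one supported
    in [0, 1]. *)
Definition bump x : R :=
  (flat_exp 2 x * flat_exp 0 (1 - x) + flat_exp 0 x * flat_exp 2 (1 - x)) /
  (flat_exp 0 x + flat_exp 0 (1 - x)) ^+ 2.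

Lemma is_derive_smooth_step x : is_derive x 1 smooth_step (bump x).
Proof.
have d0 y : is_derive y (1 : R) (flat_exp 0) (flat_exp 2 y).
  by apply: (is_derive_eq (is_derive_flat_exp 0 y)); rewrite mul0r subr0.
have d1 : is_derive x (1 : R) (fun y => flat_exp 0 (1 - y)) (- flat_exp 2 (1 - x)).
  have h : is_derive x (1 : R) (fun y : R => 1 - y) (-1).
    have h := is_deriveB (is_derive_cst (1 : R) x (1 : R)) (is_derive_id x (1 : R)).
    by apply: (is_derive_eq h); rewrite sub0r.
  by apply: (is_derive_eq (is_derive1_comp (d0 _) h)); rewrite mulrN1.
have dd := is_deriveD (d0 x) d1.
have dV := @is_deriveV R (flat_exp 0 + (fun y => flat_exp 0 (1 - y)))
  x _ _ (lt0r_neq0 (step_den_gt0 x)) dd.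
apply: (is_derive_eq (is_deriveM (d0 x) dV)).
rewrite /GRing.scale/= /bump !fctE.
have := lt0r_neq0 (step_den_gt0 x).
set e := flat_exp 0 x; set e' := flat_exp 0 (1 - x) => e0.
by field.
Qed.

Lemma smooth_bump : smooth bump.
Proof.
have [f' sf' df] := smooth_derivative smooth_smooth_step.
have -> // : bump = f'.
apply/funext => x.
by rewrite -(@derive_val _ _ _ _ _ _ _ (df x)) (@derive_val _ _ _ _ _ _ _ (is_derive_smooth_step x)).
Qed.

Lemma bump_ge0 x : 0 <= bump x.
Proof.
by rewrite divr_ge0 ?sqr_ge0// addr_ge0// mulr_ge0// flat_exp_ge0.
Qed.

Lemma bump_gt0 x : 0 < x < 1 -> 0 < bump x.
Proof.
move=> /andP[x0 x1]; rewrite divr_gt0 ?exprn_gt0// addr_gt0// mulr_gt0// flat_exp_gt0//;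
  by rewrite subr_gt0.
Qed.

Lemma bump_out : vanishes_outside 0 1 bump.
Proof.
move=> x [x0|x1]; rewrite /bump.
  by rewrite !(@flat_exp_le0 _ x) ?(ltW x0)// !mul0r addr0 mul0r.
by rewrite !(@flat_exp_le0 _ (1 - x)) ?subr_le0 ?(ltW x1)// !mulr0 addr0 mul0r.
Qed.

Lemma bump_bounded : exists2 B, 0 < B & forall x, bump x <= B.
Proof.
have [|c _ cmax] := @EVT_max R bump 0 1 ler01.
  by apply: continuous_subspaceT; exact: smooth_continuous smooth_bump.
exists (bump c + 1); first by rewrite ltr_wpDl ?bump_ge0.
move=> x; have [/andP[x0 x1]|] := boolP (0 <= x <= 1).
  by rewrite (le_trans (cmax x _)) ?in_itv/= ?x0// lerDl.
rewrite negb_and -!ltNge => h.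
by rewrite bump_out ?addr_ge0 ?bump_ge0//; case/orP: h; [left|right].
Qed.

Lemma smooth_step_nd x y : x <= y -> smooth_step x <= smooth_step y.
Proof.
move=> xy.
have [||c _ h] := @MVT_segment R smooth_step bump x y xy.
- by move=> z _; exact: is_derive_smooth_step.
- by apply: continuous_subspaceT; exact: smooth_continuous smooth_smooth_step.
by rewrite -subr_ge0 h mulr_ge0 ?bump_ge0// subr_ge0.
Qed.

Lemma smooth_step_ge0 x : 0 <= smooth_step x.
Proof. by rewrite divr_ge0 ?addr_ge0 ?flat_exp_ge0. Qed.

Lemma smooth_step_le1 x : smooth_step x <= 1.
Proof.
have [x1|/ltW x1] := leP 1 x; first by rewrite smooth_step_ge1.
by rewrite -(smooth_step_ge1 (lexx 1)) smooth_step_nd.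
Qed.

(* [step h y] rises from 0 at [y] to 1 at [y + h]; its derivative at [x] is
   [kern h (x - y)]. *)
Definition step h y x : R := locked (smooth_step ((x - y) / h)).
Definition kern h x : R := locked (h^-1 * bump (x / h)).

Let stepE h y x : step h y x = smooth_step ((x - y) / h).
Proof. by rewrite /step -lock. Qed.

Lemma kernE h x : kern h x = h^-1 * bump (x / h).
Proof. by rewrite /kern -lock. Qed.

Lemma is_derive_step h y x : is_derive x 1 (step h y) (kern h (x - y)).
Proof.
have h1 : is_derive x (1 : R) (fun z : R => (z - y) / h) h^-1.
  have d := is_deriveB (is_derive_id x (1 : R)) (is_derive_cst y x (1 : R)).
  have := is_deriveM d (is_derive_cst h^-1 x (1 : R)).
  by move=> d'; apply: (is_derive_eq d'); rewrite /GRing.scale/= mulr0 add0r subr0 mulr1.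
have -> : step h y = fun x => smooth_step ((x - y) / h).
  by apply/funext => z; rewrite stepE.
by apply: (is_derive_eq (is_derive1_comp (is_derive_smooth_step _) h1)); rewrite mulrC kernE.
Qed.

Lemma smooth_stepfun h y : smooth (step h y).
Proof.
have -> : step h y = fun x => smooth_step (h^-1 * x + (- y / h)).
  by apply/funext => x; rewrite stepE mulrDl mulrC.
exact: smooth_affine smooth_smooth_step.
Qed.

Lemma smooth_kern h y : smooth (fun x => kern h (x - y)).
Proof.
have -> : (fun x => kern h (x - y)) = fun x => h^-1 * bump (h^-1 * x + (- y / h)).
  by apply/funext => x; rewrite kernE mulrDl [_ * h^-1 in LHS]mulrC.
by apply: smoothM; [exact: smooth_cst|exact: smooth_affine smooth_bump].
Qed.

Lemma kern_ge0 h x : 0 < h -> 0 <= kern h x.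
Proof. by move=> h0; rewrite kernE mulr_ge0 ?bump_ge0// invr_ge0 ltW. Qed.

Lemma kern_out h : 0 < h -> vanishes_outside 0 h (kern h).
Proof.
move=> h0 x xh; rewrite kernE bump_out ?mulr0//.
by case: xh => xh; [left; rewrite pmulr_llt0 ?invr_gt0|right; rewrite ltr_pdivlMr// mul1r].
Qed.

Lemma kern_shift_out h x : 0 < h -> vanishes_outside x (x + h) (fun y => kern h (y - x)).
Proof. by move=> h0 y xy; apply: (kern_out h0); rewrite subr_lt0 ltrBrDl. Qed.

Lemma kern_gt0 h x : 0 < x < h -> 0 < kern h x.
Proof.
move=> /andP[x0 xh]; have h0 := lt_trans x0 xh.
by rewrite kernE mulr_gt0 ?invr_gt0// bump_gt0// divr_gt0//= ltr_pdivrMr// mul1r.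
Qed.

Lemma step_ge0 h y x : 0 <= step h y x. Proof. by rewrite stepE smooth_step_ge0. Qed.

Lemma step_le1 h y x : step h y x <= 1. Proof. by rewrite stepE smooth_step_le1. Qed.

Lemma step_l h y x : 0 < h -> x <= y -> step h y x = 0.
Proof. by move=> h0 xy; rewrite stepE smooth_step_le0// pmulr_lle0 ?invr_gt0// subr_le0. Qed.

Lemma step_r h y x : 0 < h -> y + h <= x -> step h y x = 1.
Proof. by move=> h0 xy; rewrite stepE smooth_step_ge1// ler_pdivlMr// mul1r lerBrDl. Qed.

End smooth_functions.

Section kernel_integrals.
Context {R : realType}.
Implicit Types (x y h : R).

Lemma kern_bounded : exists2 B : R, 0 < B & forall h x, 0 < h -> kern h x <= B / h.
Proof.
have [B B0 bB] := @bump_bounded R; exists B => // h x h0.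
by rewrite kernE mulrC ler_pM2r ?invr_gt0.
Qed.

Lemma continuous_kern h : continuous (@kern R h).
Proof.
have -> : kern h = fun x : R => kern h (x - 0) by apply/funext => x; rewrite subr0.
exact: smooth_continuous (smooth_kern h 0).
Qed.

Lemma measurable_kern h : measurable_fun [set: R] (kern h).
Proof. exact: continuous_measurable_fun (@continuous_kern h). Qed.

Lemma kernM_ge0 h x y : 0 < h -> 0 <= y -> 0 <= kern h x * y.
Proof. by move=> h0 y0; rewrite mulr_ge0 ?kern_ge0. Qed.

Lemma kern2_ge0 h x y : 0 < h -> 0 <= kern h x * kern h y.
Proof. by move=> h0; rewrite mulr_ge0 ?kern_ge0. Qed.

End kernel_integrals.

Ltac meas1 :=
  match goal with
  | |- measurable_fun _ (fun=> _) => exact: measurable_cst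
  | |- measurable_fun _ fst => exact: measurable_fst
  | |- measurable_fun _ snd => exact: measurable_snd
  | |- measurable_fun _ (fun x => x) => exact: measurable_id
  | |- measurable_fun _ (EFin \o _) => apply/measurable_EFinP
  | |- measurable_fun _ (fun x => (_)%:E) => apply/measurable_EFinP
  | |- measurable_fun _ (fun x => (_ * _)%E) => apply: emeasurable_funM
  | |- measurable_fun _ (fun x => (_ + _)%R) => first
      [apply: measurable_funB | apply: emeasurable_funB
      |apply: measurable_funD | apply: emeasurable_funD]
  | |- measurable_fun _ (fun x => (- _)%R) => apply: measurable_funN
  | |- measurable_fun _ (fun x => (_ * _)%R) => apply: measurable_funM
  | |- measurable_fun _ (fun x => `| _ |%R) => apply: (measurableT_comp (@normr_measurable _ setT))
  | |- measurable_fun _ (fun x => `| _ |%E) => apply: (measurableT_comp (@abse_measurable _ setT))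
  | |- measurable_fun _ (fun x => kern ?h _) => apply: (measurableT_comp (measurable_kern h))
  | |- measurable_fun _ (fun x => (_).1) => apply: (measurableT_comp measurable_fst)
  | |- measurable_fun _ (fun x => (_).2) => apply: (measurableT_comp measurable_snd)
  | |- measurable_fun _ (fun x => (_, _)) => apply: measurable_fun_pair
  | H : measurable_fun _ ?f |- measurable_fun _ ?f => exact: H
  | H : measurable_fun setT ?f |- measurable_fun _ ?f => exact: (measurable_funTS H)
  | H : measurable_fun setT ?f |- measurable_fun _ (fun x => ?f _) => apply: (measurableT_comp H)
  end.
Ltac meas := repeat meas1.

(** * Integration complements, sign and integrability on product spaces *)

Section integral_complements.
Context d (T : measurableType d) (R : realType).
Variable mu : {measure set T -> \bar R}.
Local Open Scope ereal_scope.

Lemma integral_support (D : set T) (f : T -> \bar R) :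
  (forall x, ~ D x -> f x = 0) -> \int[mu]_x f x = \int[mu]_(x in D) f x.
Proof.
move=> f0; rewrite [RHS]integral_mkcond; apply: eq_integral => x _.
by rewrite patchE; case: ifPn => // /negP xD; apply: f0 => Dx; apply: xD; rewrite inE.
Qed.

Lemma aeS (P Q : T -> Prop) : (forall x, P x -> Q x) ->
  {ae mu, forall x, P x} -> {ae mu, forall x, Q x}.
Proof. by move=> PQ; apply: filterS. Qed.

Lemma aeI (P Q : T -> Prop) : {ae mu, forall x, P x} ->
  {ae mu, forall x, Q x} -> {ae mu, forall x, P x /\ Q x}.
Proof. by move=> aP aQ; exact: filterI. Qed.

Lemma ge0_integral_le (f g : T -> \bar R) : measurable_fun setT f -> measurable_fun setT g ->
  (forall x, 0 <= f x) -> (forall x, f x <= g x) -> \int[mu]_x f x <= \int[mu]_x g x.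
Proof. by move=> mf mg f0 fg; exact: ge0_le_integral. Qed.

End integral_complements.

Lemma measurable_integral_snd d1 d2 (T1 : measurableType d1) (T2 : measurableType d2)
    (R : realType) (m2 : {sigma_finite_measure set T2 -> \bar R}) (f : T1 -> T2 -> \bar R) :
  measurable_fun setT (fun p => f p.1 p.2) -> (forall x y, 0 <= f x y)%E ->
  measurable_fun setT (fun x => \int[m2]_y f x y)%E.
Proof.
by move=> mf f0; exact: (@measurable_fun_fubini_tonelli_F _ _ _ _ _ m2 (fun p => f p.1 p.2)).
Qed.

Lemma ae_ge0_integral d (T : measurableType d) (R : realType) (mu : {measure set T -> \bar R})
    (g : T -> \bar R) :
  measurable_fun setT g -> {ae mu, forall x, (0 <= g x)%E} -> (0 <= \int[mu]_x g x)%E.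
Proof.
move=> mg g0; rewrite integralE.
have -> : (\int[mu]_x g^\- x = 0)%E.
  rewrite -(integral0 mu setT); apply: ae_eq_integral => //; first exact: measurable_funeneg.
  by apply: aeS g0 => x gx _; rewrite /= unlock /funeneg; apply/max_idPr; rewrite leeNl oppe0.
by rewrite sube0 integral_ge0.
Qed.

Section integrals_on_products.
Context d1 d2 (T1 : measurableType d1) (T2 : measurableType d2) (R : realType).
Local Open Scope ereal_scope.
Variables (m1 : {sigma_finite_measure set T1 -> \bar R})
  (m2 : {sigma_finite_measure set T2 -> \bar R}).

Lemma integrable_tensor_prod (A : T1 -> R) (B : T2 -> R) : m1.-integrable setT (EFin \o A) ->
  m2.-integrable setT (EFin \o B) ->
  (product_measure1 m1 m2).-integrable setT (fun z => (A z.1 * B z.2)%:E).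
Proof.
move=> /integrableP[/measurable_EFinP mA iA] /integrableP[/measurable_EFinP mB iB].
have mA' : measurable_fun [set: T1] A := mA; have mB' : measurable_fun [set: T2] B := mB.
clear mA mB; apply/integrable12ltyP; first by meas.
under eq_integral => x _.
  under eq_integral do rewrite /= normrM EFinM.
  rewrite ge0_integralZl_EFin//; last by meas.
  over.
rewrite ge0_integralZr//; [|by meas|exact: integral_ge0].
by rewrite lte_mul_pinfty// ?integral_ge0// ge0_fin_numE// integral_ge0.
Qed.

(** Meant for the doubling: an entropy inequality valid for almost every frozen point [y] is
    integrated over that point. *)
Lemma prod_integral_ge0_fst (F : T1 * T2 -> \bar R) : (product_measure1 m1 m2).-integrable setT F ->
  {ae m2, forall y, 0 <= \int[m1]_x F (x, y)} -> 0 <= \int[product_measure1 m1 m2]_z F z.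
Proof.
move=> iF F0; rewrite -integral21_prod_meas1//; apply: ae_ge0_integral => //.
exact: (measurable_fubini_G iF).
Qed.

Lemma prod_integral_ge0_snd (F : T1 * T2 -> \bar R) : (product_measure1 m1 m2).-integrable setT F ->
  {ae m1, forall x, 0 <= \int[m2]_y F (x, y)} -> 0 <= \int[product_measure1 m1 m2]_z F z.
Proof.
move=> iF F0; rewrite -integral12_prod_meas1//; apply: ae_ge0_integral => //.
exact: (measurable_fubini_F iF).
Qed.

(** The majorant of [Phi] is a sum of functions of one variable each. Multiplied by the indicator of
    [D1] times that of [D2], both of finite measure, each summand is a tensor product of integrable
    functions. *)
Lemma integrable_doubled (D1 : set T1) (D2 : set T2) (G1 : T1 -> R) (G2 : T2 -> R)
    (H Phi : T1 * T2 -> R) (C : R) :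
  measurable D1 -> measurable D2 ->
  m1.-integrable D1 (cst 1) -> m2.-integrable D2 (cst 1) ->
  m1.-integrable D1 (EFin \o G1) -> m2.-integrable D2 (EFin \o G2) ->
  measurable_fun setT H -> measurable_fun setT Phi ->
  (forall z, `|H z| <= C)%R -> (forall z, ~ (D1 z.1 /\ D2 z.2) -> H z = 0%R) ->
  (forall z, `|Phi z| <= G1 z.1 + G2 z.2)%R ->
  (product_measure1 m1 m2).-integrable setT (fun z => (H z * Phi z)%:E).
Proof.
move=> mD1 mD2 i1 i2 iG1 iG2 mH mPhi HC H0 PhiG.
have j1 : m1.-integrable setT (EFin \o (\1_D1 : T1 -> R)).
  have := (integrable_mkcond (cst 1) mD1).1 i1; apply: eq_integrable => // x _.
  by rewrite patchE /= indicE; case: (x \in D1).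
have j2 : m2.-integrable setT (EFin \o (\1_D2 : T2 -> R)).
  have := (integrable_mkcond (cst 1) mD2).1 i2; apply: eq_integrable => // x _.
  by rewrite patchE /= indicE; case: (x \in D2).
have jG1 : m1.-integrable setT (EFin \o (fun x => G1 x * \1_D1 x)%R).
  have := (integrable_mkcond _ mD1).1 iG1; apply: eq_integrable => // x _.
  by rewrite /= patchE indicE; case: ifP; rewrite (mulr1, mulr0).
have jG2 : m2.-integrable setT (EFin \o (fun x => G2 x * \1_D2 x)%R).
  have := (integrable_mkcond _ mD2).1 iG2; apply: eq_integrable => // x _.
  by rewrite /= patchE indicE; case: ifP; rewrite (mulr1, mulr0).
have iD := integrableD measurableT (integrable_tensor_prod jG1 j2) (integrable_tensor_prod j1 jG2).
apply: (le_integrable measurableT _ _ (integrableZl measurableT C iD)).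
  by meas.
move=> [x y] _; rewrite /= lee_fin !indicE.
have C0 : (0 <= C)%R by exact: le_trans (HC (x, y)).
have [xD|xD] := boolP (x \in D1); last first.
  by rewrite H0 ?mul0r ?normr0//= => -[/mem_set xD1 _]; move: xD; rewrite xD1.
have [yD|yD] := boolP (y \in D2); last first.
  by rewrite H0 ?mul0r ?normr0//= => -[_ /mem_set yD1]; move: yD; rewrite yD1.
rewrite /= !mulr1 mul1r !normrM ler_pM// ?(le_trans (HC _)) ?ler_norm//.
by rewrite (le_trans (PhiG _))//= ler_norm.
Qed.

End integrals_on_products.

(** * Mollification *)

Section mollification.
Context {R : realType}.
Implicit Types (x y h s t : R) (G : R -> R).

Lemma integral_kernl h y : 0 < h -> (\int[leb]_x (kern h (x - y))%:E = 1)%E.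
Proof.
move=> h0; have yh : y < y + h by rewrite ltrDl.
rewrite (@integral_support _ _ _ leb `[y, y + h]%classic); last first.
  move=> x /= /negP; rewrite in_itv/= negb_and -!ltNge => xyh.
  by congr EFin; apply: (kern_shift_out h0); case/orP: xyh; [left|right].
rewrite (@continuous_FTC2 _ _ (step h y))//.
- by rewrite step_r// step_l// sube0.
- by apply: continuous_subspaceT; exact: smooth_continuous (smooth_kern h y).
- have c := smooth_continuous (smooth_stepfun h y).
  split; first by move=> x _; exact: (@ex_derive _ _ _ _ _ _ _ (is_derive_step h y x)).
    by apply: cvg_at_right_filter; exact: c.
  by apply: cvg_at_left_filter; exact: c.
- move=> x _; rewrite derive1E.
  exact: (@derive_val _ _ _ _ _ _ _ (is_derive_step h y x)).
Qed.

(** The kernel is not even, so integration in the subtracted variable is a computation of its own,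
    with antiderivative [- step h 0 (x - y)]. *)
Lemma integral_kernr h x : 0 < h -> (\int[leb]_y (kern h (x - y))%:E = 1)%E.
Proof.
move=> h0; have yh : x - h < x by rewrite gtrBl.
have dF y : is_derive y (1 : R) (fun y => - step h 0 (x - y)) (kern h (x - y)).
  have d1 : is_derive y (1 : R) (fun y : R => x - y) (-1).
    have := is_deriveB (is_derive_cst x y (1 : R)) (is_derive_id y (1 : R)).
    by move=> h1; apply: (is_derive_eq h1); rewrite sub0r.
  have h1 := is_deriveN (is_derive1_comp (is_derive_step h 0 _) d1).
  by apply: (is_derive_eq h1); rewrite mulrN1 opprK subr0.
have c (F F' : R -> R) : (forall y, is_derive y 1 F (F' y)) -> continuous F.
  move=> d y; apply: differentiable_continuous; apply/derivable1_diffP.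
  exact: ex_derive.
rewrite (@integral_support _ _ _ leb `[x - h, x]%classic); last first.
  move=> y /= /negP; rewrite in_itv/= negb_and -!ltNge => xyh.
  congr EFin; apply: (kern_out h0); rewrite subr_lt0.
  by case/orP: xyh => xyh; [right; rewrite ltrBrDl -ltrBrDr|left].
rewrite (@continuous_FTC2 _ _ (fun y => - step h 0 (x - y)))//.
- rewrite subrr step_l// (_ : x - (x - h) = h); last by ring.
  by rewrite step_r ?add0r// oppr0 -EFinB sub0r opprK.
- apply: continuous_subspaceT => z.
  apply: (@continuous_comp _ _ _ (fun y => x - y) (kern h)); last exact: continuous_kern.
  apply: (c _ (fun=> -1)) => y.
  have := is_deriveB (is_derive_cst x y (1 : R)) (is_derive_id y (1 : R)).
  by move=> h1; apply: (is_derive_eq h1); rewrite sub0r.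
- split; first by move=> y _; exact: (@ex_derive _ _ _ _ _ _ _ (dF y)).
    by apply: cvg_at_right_filter; exact: (c _ _ dF).
  by apply: cvg_at_left_filter; exact: (c _ _ dF).
- move=> y _; rewrite derive1E.
  exact: (@derive_val _ _ _ _ _ _ _ (dF y)).
Qed.

Lemma harmonic_at_right : @harmonic R @ \oo --> 0^'+.
Proof.
move=> P [e e0 eP]; have /cvgrPdist_lt/(_ e e0) h := @cvg_harmonic R.
by apply: filterS h => n hn; apply: eP => //=; rewrite invr_gt0 ltr0n.
Qed.

Lemma integrable_kern h y : 0 < h -> leb.-integrable [set: R] (fun x => (kern h (x - y))%:E).
Proof.
move=> h0; have mk := @measurable_kern R h.
apply/integrableP; split; first by meas.
under eq_integral do rewrite gee0_abs ?lee_fin ?kern_ge0//.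
by rewrite integral_kernl// ltry.
Qed.

Lemma integrable_mul_supp d (T : measurableType d) (mu : {measure set T -> \bar R})
    (D : set T) (k g : T -> R) (C : R) :
  measurable D -> measurable_fun setT k -> measurable_fun setT g ->
  (forall x : T, `|k x| <= C) -> (forall x : T, ~ D x -> k x = 0) ->
  mu.-integrable D (EFin \o g) -> mu.-integrable setT (fun x : T => (k x * g x)%:E).
Proof.
move=> mD mk mg kC k0 ig.
have -> : (fun x : T => (k x * g x)%:E) = (EFin \o (fun x : T => k x * g x)) \_ D.
  apply/funext => x; rewrite patchE; case: ifPn => // /negP xD.
  by rewrite k0 ?mul0r// => Dx; apply: xD; rewrite inE.
apply: (integrable_mkcond _ mD).1.
apply: (@le_integrable _ _ _ _ _ mD _ (fun x : T => C%:E * (g x)%:E)%E).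
- by apply: measurable_funTS; meas.
- move=> x _; rewrite /= !lee_fin !normrM ler_wpM2r//.
  by rewrite (le_trans (kC x))// ler_norm.
- exact: integrableZl.
Qed.

(** Because the kernel has mass one, [G s] is a kernel average of a constant and goes under the
    integral sign. *)
Lemma mollify_dist h s G : 0 < h -> measurable_fun setT G ->
  leb.-integrable setT (fun t => (kern h (t - s) * G t)%:E) ->
  (`|\int[leb]_t (kern h (t - s) * G t)%:E - (G s)%:E| <=
   \int[leb]_t (kern h (t - s) * `|G t - G s|)%:E)%E.
Proof.
move=> h0 mG iG; have mk := @measurable_kern R h.
have ik := integrable_kern s h0.
have -> : ((G s)%:E = \int[leb]_t (kern h (t - s) * G s)%:E)%E.
  under eq_integral do rewrite mulrC EFinM.
  by rewrite integralZl// integral_kernl// mule1.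
rewrite -integralB_EFin//; last first.
  rewrite (_ : _ \o _ = fun t => ((G s)%:E * (kern h (t - s))%:E)%E); last first.
    by apply/funext => t /=; rewrite mulrC EFinM.
  exact: integrableZl.
apply: le_trans (le_abse_integral _ _ _) _ => //; first by meas.
rewrite le_eqVlt; apply/orP; left; apply/eqP; apply: eq_integral => t _ /=.
by rewrite -mulrBr normrM ger0_norm ?kern_ge0.
Qed.

Lemma cvge0Zl (T : Type) (F : set_system T) {FF : Filter F} (c : R) (f : T -> \bar R) :
  f @ F --> 0%E -> (c%:E * f x)%E @[x --> F] --> 0%E.
Proof. by move=> f0; rewrite -(mule0 c%:E); exact: cvgeZl. Qed.

Definition mollifies G s :=
  (\int[leb]_t (kern h (t - s) * `|G t - G s|)%:E)%E @[h --> 0^'+] --> 0%E.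

(** The kernel is at most B / h, that is 4 B divided by the length of the ball of radius 2 h, and
    this open ball contains the closed support [s, s + h]. So the oscillation is at most 4 B times
    the mean deviation on the ball, which tends to 0 at a Lebesgue point. *)
Lemma lebesgue_pt_mollifies G s : measurable_fun setT G -> lebesgue_pt G s ->
  mollifies G s.
Proof.
move=> mG Gs; have [B B0 kB] := @kern_bounded R.
have c2 : (fun h : R => 2 * h) @ 0^'+ --> 0^'+.
  move=> P [e e0 eP]; exists (e / 2); first by rewrite /= divr_gt0.
  move=> x /=; rewrite sub0r normrN => xe x0; apply: eP => /=; last by rewrite mulr_gt0.
  by rewrite sub0r normrN normrM (ger0_norm (ler0n _ _)) mulrC -ltr_pdivlMr.
have d0 : ((4 * B)%:E * davg G s (2 * h))%E @[h --> 0^'+] --> 0%E.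
  by apply: cvge0Zl; exact: cvg_comp c2 Gs.
apply: (squeeze_cvge _ _ d0); last exact: cvg_cst.
near=> h; have h0 : 0 < h by near: h; exact: nbhs_right_gt.
have mk := @measurable_kern R h.
rewrite integral_ge0/=; last by move=> t _; rewrite lee_fin mulr_ge0 ?kern_ge0.
rewrite /davg /iavg lebesgue_measure_ball ?mulr_ge0 ?(ltW h0)//.
have mball : measurable (ball s (2 * h)) by exact: measurable_ball.
rewrite (@integral_support _ _ _ leb (ball s (2 * h))); last first.
  move=> t /= st; rewrite (kern_out h0) ?mul0r//.
  apply: contrapT => /not_orP[/negP + /negP]; rewrite -!leNgt => ts th.
  apply: st; rewrite /ball/= distrC ger0_norm//.
  by rewrite (le_lt_trans th)// ltr_pMl// ltr1n.
rewrite muleA inver gt_eqF ?mulrn_wgt0 ?mulr_gt0// -EFinM.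
rewrite -ge0_integralZl_EFin//; last 2 first.
- by apply: measurable_funTS => /=; meas.
- by rewrite !mulr_ge0 ?invr_ge0 ?mulrn_wge0 ?mulr_ge0 ?(ltW h0) ?(ltW B0).
apply: ge0_le_integral => //.
- by move=> t _; rewrite lee_fin mulr_ge0 ?kern_ge0.
- by apply: measurable_funTS => /=; meas.
- by apply: measurable_funTS => /=; apply: measurable_funeM; meas.
move=> t _; rewrite -EFinM lee_fin ler_wpM2r// (le_trans (kB _ _ h0))//.
rewrite le_eqVlt; apply/orP; left; apply/eqP.
by field; rewrite gt_eqF.
Unshelve. all: by end_near. Qed.

Lemma ge0_cvge0 (T : Type) (F : set_system T) {FF : Filter F} (f : T -> \bar R) :
  (forall e : R, 0 < e -> \forall x \near F, (0 <= f x <= e%:E)%E) -> f @ F --> 0%E.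
Proof.
move=> fe; apply/fine_cvgP; split.
  by apply: filterS (fe 1 ltr01) => x /andP[f0 f1]; rewrite ge0_fin_numE// (le_lt_trans f1)// ltry.
apply/cvgr0Pnorm_le => e e0; apply: filterS (fe e e0) => x /andP[f0 f1] /=.
have fx : f x \is a fin_num by rewrite ge0_fin_numE// (le_lt_trans f1)// ltry.
by rewrite ger0_norm ?fine_ge0// -lee_fin fineK.
Qed.

Lemma squeeze_cvge0 (T : Type) (F : set_system T) {FF : Filter F} (f g : T -> \bar R) :
  (\forall x \near F, (0 <= f x <= g x)%E) -> g @ F --> 0%E -> f @ F --> 0%E.
Proof. by move=> fg g0; apply: (squeeze_cvge fg) => //; exact: cvg_cst. Qed.

Lemma cvge0D (T : Type) (F : set_system T) {FF : Filter F} (f g : T -> \bar R) :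
  f @ F --> 0%E -> g @ F --> 0%E -> (f x + g x)%E @[x --> F] --> 0%E.
Proof. by move=> f0 g0; rewrite -[X in _ --> X]adde0; exact: cvgeD. Qed.

(** A kernel average of L^1 translation moduli: with p.2 = p.1 + y it is the integral over y of
    [kern h y] times the L^1 norm of g(. + y) - g. *)
Definition kern_osc (g : R -> R) (h : R) :=
  (\int[leb2]_p (kern h (p.2 - p.1) * `|g p.2 - g p.1|)%:E)%E.

Let integral2_kern_fst (D : R -> R) h : 0 < h -> measurable_fun setT D ->
  (forall x, 0 <= D x) ->
  (\int[leb2]_p (kern h (p.2 - p.1) * D p.1)%:E = \int[leb]_x (D x)%:E)%E.
Proof.
move=> h0 mD D0; have mk := @measurable_kern R h.
rewrite fubini_tonelli1; last 2 first.
- by meas.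
- by move=> p; rewrite lee_fin mulr_ge0 ?kern_ge0.
apply: eq_integral => x _; rewrite /fubini_F/=.
under eq_integral do rewrite mulrC EFinM.
rewrite ge0_integralZl_EFin ?integral_kernl ?mule1//.
- by move=> y _; rewrite lee_fin kern_ge0.
- by meas.
Qed.

Let integral2_kern_snd (D : R -> R) h : 0 < h -> measurable_fun setT D ->
  (forall x, 0 <= D x) ->
  (\int[leb2]_p (kern h (p.2 - p.1) * D p.2)%:E = \int[leb]_x (D x)%:E)%E.
Proof.
move=> h0 mD D0; have mk := @measurable_kern R h.
rewrite fubini_tonelli2; last 2 first.
- by meas.
- by move=> p; rewrite lee_fin mulr_ge0 ?kern_ge0.
apply: eq_integral => x _; rewrite /fubini_G/=.
under eq_integral do rewrite mulrC EFinM.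
rewrite ge0_integralZl_EFin ?integral_kernr ?mule1//.
- by move=> y _; rewrite lee_fin kern_ge0.
- by meas.
Qed.

(** The increment of g is routed through [f p.1] and [f p.2]. The two terms comparing g with f see a
    single point each, so the kernel integrates out of both; hence the factor 2. *)
Lemma kern_osc_triangle (g f : R -> R) h : 0 < h -> measurable_fun setT g -> measurable_fun setT f ->
  (kern_osc g h <= 2%:E * \int[leb]_t `|g t - f t|%:E + kern_osc f h)%E.
Proof.
move=> h0 mg mf; have mk := @measurable_kern R h.
have D0 x : 0 <= `|g x - f x| by [].
have mD : measurable_fun setT (fun x => `|g x - f x|) by meas.
rewrite (_ : 2%:E = 1 + 1)%E// ge0_muleDl ?lee_fin// mul1e.
rewrite -{1}(integral2_kern_fst h0 mD D0) -(integral2_kern_snd h0 mD D0) /kern_osc.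
rewrite -ge0_integralD//=; last 4 first.
- by move=> p _; rewrite lee_fin mulr_ge0 ?kern_ge0.
- by meas.
- by move=> p _; rewrite lee_fin mulr_ge0 ?kern_ge0.
- by meas.
rewrite -ge0_integralD//=; last 4 first.
- by move=> p _; rewrite -EFinD lee_fin addr_ge0// mulr_ge0 ?kern_ge0.
- by meas.
- by move=> p _; rewrite lee_fin mulr_ge0 ?kern_ge0.
- by meas.
apply: ge0_integral_le.
- by meas.
- by meas.
- by move=> p; rewrite lee_fin mulr_ge0 ?kern_ge0.
move=> p; rewrite -!EFinD lee_fin -!mulrDr ler_wpM2l ?kern_ge0//.
rewrite (_ : g p.2 - g p.1 = (f p.1 - g p.1) + (g p.2 - f p.2) + (f p.2 - f p.1)); last by ring.
rewrite (le_trans (ler_normD _ _))// lerD2r (le_trans (ler_normD _ _))// lerD2r.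
by rewrite distrC.
Qed.

Lemma kern_osc_le (g : R -> R) h : 0 < h -> measurable_fun setT g ->
  (kern_osc g h <= 2%:E * \int[leb]_t `|g t|%:E)%E.
Proof.
move=> h0 mg; have := @kern_osc_triangle g (cst 0) h h0 mg (@measurable_cst _ _ _ _ _ _).
rewrite {2}/kern_osc; under [X in (_ + X)%E]eq_integral do rewrite subrr normr0 mulr0.
by rewrite integral0 adde0; under eq_integral do rewrite subr0.
Qed.

(** Dominated convergence in the base point t. Almost every t is a Lebesgue point; as
    [harmonic n <= 1], the inner integral is 0 for t outside [[- m - 1, m + 1]], and it is at most 2
    m elsewhere. *)
Lemma kern_osc_bounded (g : R -> R) (m : R) : measurable_fun setT g -> 0 <= m ->
  (forall x, `|g x| <= m) -> (forall x, m < `|x| -> g x = 0) ->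
  kern_osc g (harmonic n) @[n --> \oo] --> 0%E.
Proof.
move=> mg m0 gm gout.
pose D := `[- m - 1, m + 1]%classic : set R.
have mD : measurable D by exact: measurable_itv.
pose F n t := (\int[leb]_s (kern (harmonic n) (s - t) * `|g s - g t|)%:E)%E.
have h0 n : 0 < @harmonic R n by rewrite invr_gt0 ltr0n.
have F0 n t : (0 <= F n t)%E.
  by apply: integral_ge0 => s _; rewrite lee_fin mulr_ge0 ?kern_ge0.
have Fle n t : (F n t <= ((2 * m) * \1_D t)%:E)%E.
  rewrite /F indicE; case: (boolP (t \in D)) => /= tD.
    rewrite mulr1; apply: (@le_trans _ _ (\int[leb]_s ((2 * m)%:E * (kern (harmonic n) (s - t))%:E))%E).
      have mk := @measurable_kern R (harmonic n).
      apply: ge0_integral_le.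
      + by meas.
      + by apply: measurable_funeM; meas.
      + by move=> s; rewrite lee_fin mulr_ge0 ?kern_ge0.
      + move=> s; rewrite -EFinM lee_fin mulrC ler_wpM2r ?kern_ge0//.
        rewrite (le_trans (ler_normB _ _))// -[2]/(1 + 1) mulrDl mul1r lerD//.
    have mk := @measurable_kern R (harmonic n).
    rewrite ge0_integralZl_EFin ?integral_kernl ?mule1 ?mulr_ge0//.
    + by move=> y _; rewrite lee_fin kern_ge0.
    + by meas.
  rewrite mulr0 integral0_eq// => s _.
  have [->|] := eqVneq (kern (harmonic n) (s - t)) 0; first by rewrite mul0r.
  move=> /eqP ks.
  have /not_orP[/negP + /negP] : ~ (s - t < 0 \/ harmonic n < s - t) by move/(kern_out (h0 n)).
  rewrite -!leNgt subr_ge0 lerBlDr => ts sth.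
  have h1 : @harmonic R n <= 1 by rewrite invf_le1 ?ler1n ?ltr0n.
  move: tD; rewrite notin_setE /D/= in_itv/= => /negP; rewrite negb_and -!ltNge.
  move=> tm; have [gs gt] : g s = 0 /\ g t = 0.
    case/orP : tm => tm; split; apply: gout; rewrite ltr_normr; apply/orP;
      [right|right|left|left]; move: (h0 n) h1 ts sth tm; move: (harmonic n) => h; lra.
  by rewrite gs gt subrr normr0 mulr0.
rewrite (_ : (fun n => _) = (fun n => \int[leb]_t F n t)%E); last first.
  apply/funext => n; have mk := @measurable_kern R (harmonic n).
  rewrite /kern_osc fubini_tonelli1//.
  - by meas.
  - by move=> p; rewrite lee_fin mulr_ge0 ?kern_ge0.
have mF n : measurable_fun setT (F n).
  have mk := @measurable_kern R (harmonic n).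
  apply: (@measurable_integral_snd _ _ _ _ _ leb
    (fun t s => (kern (harmonic n) (s - t) * `|g s - g t|)%:E)).
  - by meas.
  - by move=> s t; rewrite lee_fin mulr_ge0 ?kern_ge0.
have lg : locally_integrable setT g.
  split => //; first exact: openT.
  move=> K _ cK; apply: (@le_lt_trans _ _ (\int[leb]_(x in K) (cst m%:E) x)%E).
    apply: ge0_le_integral => //; first exact: compact_measurable.
    - by apply: measurable_funTS; meas.
    - by move=> x _; rewrite lee_fin.
  rewrite integral_cst; last exact: compact_measurable.
  by rewrite lte_mul_pinfty//; exact: compact_finite_measure.
have [|||_ _] := @dominated_convergence _ _ _ leb setT measurableT F (cst 0%E)
  (fun t => ((2 * m) * \1_D t)%:E) mF (@measurable_cst _ _ _ _ _ _).
- apply: (aeS (mu := leb)) (lebesgue_differentiation lg) => t gt _.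
  exact: cvg_comp harmonic_at_right (lebesgue_pt_mollifies mg gt).
- rewrite (_ : (fun t => _) = (fun t => (2 * m)%:E * (\1_D t)%:E)%E)//.
  by apply: integrableZl => //; exact: integrable_indic_itv.
- by apply: aeW => t n _; rewrite gee0_abs.
- by rewrite integral0.
Qed.

(** Cutting g at one level m in both argument and value gives bounded functions of bounded support
    that converge to g in L^1, and [kern_osc_triangle] carries the convergence over to g. The share
    e / 4, counted twice, and the share e / 2 add up to e. *)
Lemma kern_L1_cvg (g : R -> R) : measurable_fun setT g -> leb.-integrable setT (EFin \o g) ->
  kern_osc g (harmonic n) @[n --> \oo] --> 0%E.
Proof.
move=> mg ig.
pose tr (m : nat) (x : R) : R := if (`|x| <= m%:R) && (`|g x| <= m%:R) then g x else 0.
have mtr m : measurable_fun setT (tr m).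
  apply: measurable_fun_if => //.
  - apply: measurable_and; apply: measurable_fun_ler; by meas.
  - by apply: measurable_funTS.
have trc : (\int[leb]_x `|g x - tr m x|%:E)%E @[m --> \oo] --> 0%E.
  have [|||||_ _] := @dominated_convergence _ _ _ leb setT measurableT
    (fun m x => `|g x - tr m x|%:E) (cst 0%E) (fun x => `|g x|%:E).
  - by move=> m; have := mtr m; move=> mt; meas.
  - exact: measurable_cst.
  - apply: aeW => x _; apply: cvg_near_cst; near=> m.
    rewrite /tr ifT ?subrr ?normr0//; apply/andP; split; near: m;
      by apply: nbhs_infty_ger.
  - exact: integrable_norm.
  - apply: aeW => x m _; rewrite /= lee_fin normr_id /tr.
    by case: ifPn => _; rewrite ?subr0// subrr normr0.
  - by rewrite integral0.
apply: ge0_cvge0 => e e0.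
have e2 : 0 < e / 4 by rewrite divr_gt0.
have [m lem] : exists m, (\int[leb]_x `|g x - tr m x|%:E <= (e / 4)%:E)%E.
  move/fine_cvgP : trc => [fn /cvgrPdist_le/(_ _ e2) h].
  have [m _ hm] : \forall m \near \oo,
     (\int[leb]_x `|g x - tr m x|%:E)%E \is a fin_num /\
     `|0 - (fine (\int[leb]_x `|g x - tr m x|%:E)%E)| <= e / 4.
    by near=> m; split; near: m.
  exists m; have [] := hm m (leqnn _) => fm; rewrite sub0r normrN => hh.
  by rewrite -(fineK fm) lee_fin (le_trans (ler_norm _)).
have /fine_cvgP[fn /cvgrPdist_le/(_ (e / 2)) h] : kern_osc (tr m) (harmonic n) @[n --> \oo] --> 0%E.
  apply: (@kern_osc_bounded _ m%:R) => //.
  - by move=> x; rewrite /tr; case: ifPn => [/andP[]//|_]; rewrite normr0.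
  - by move=> x xm; rewrite /tr leNgt xm.
near=> n; rewrite integral_ge0/=; last by move=> p _; rewrite lee_fin mulr_ge0// kern_ge0// invr_gt0 ltr0n.
have h0 : 0 < @harmonic R n by rewrite invr_gt0 ltr0n.
apply: le_trans (kern_osc_triangle h0 mg (mtr m)) _.
have -> : e%:E = (2%:E * (e / 4)%:E + (e / 2)%:E)%E.
  by rewrite -EFinM -EFinD; congr EFin; field.
apply: leeD; first by rewrite lee_pmul2l.
have fm : kern_osc (tr m) (harmonic n) \is a fin_num by near: n.
rewrite -(fineK fm) lee_fin (le_trans (ler_norm _))// -normrN -sub0r.
by near: n; apply: h; rewrite divr_gt0.
Unshelve. all: by end_near. Qed.

End mollification.

Lemma harmonic_gt0 (R : realType) n : 0 < @harmonic R n.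
Proof. by rewrite invr_gt0 ltr0n. Qed.

Lemma scaled_harmonic_at_right (R : realType) (c : R) : 0 < c ->
  (fun n => c * harmonic n) @ \oo --> 0^'+.
Proof.
move=> c0 P [e e0 eP]; have e1 : 0 < e / c by rewrite divr_gt0.
have /cvgrPdist_lt/(_ _ e1) hh := @cvg_harmonic R.
apply: filterS hh => n hn; apply: eP => /=; last by rewrite mulr_gt0// harmonic_gt0.
by rewrite sub0r normrN normrM (gtr0_norm c0) mulrC -ltr_pdivlMr//; move: hn; rewrite sub0r normrN.
Qed.

Lemma scaled_harmonic_le (R : realType) (c : R) n : 0 < c -> 0 < c * harmonic n <= c.
Proof.
move=> c0; rewrite mulr_gt0 ?harmonic_gt0//= ler_piMr ?(ltW c0)//.
by rewrite invf_le1 ?ler1n ?ltr0n.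
Qed.

(* The sigma-finite instance on product measures is shadowed by that on products of
   subprobabilities, hence this alias of [plane] with its own instance. *)
Definition plane_measure (R : realType) :
    set (measurableTypeR R * measurableTypeR R) -> \bar R :=
  product_measure1 leb leb.

Section plane_measure.
Context {R : realType}.
Local Open Scope ereal_scope.

HB.instance Definition _ := Measure.on (@plane_measure R).

Let plane_measure_sigma_finite : sigma_finite setT (@plane_measure R).
Proof.
have /sigma_finiteP[F [TF ndF Foo]] := sigma_finiteT (@lebesgue_measure R).
exists (fun n => F n `*` F n).
  rewrite -setXTT TF predeqE => -[x y]; split.
    move=> [/= [n _ Fnx] [k _ Gky]]; exists (maxn n k) => //; split.
    - by move: x Fnx; exact/subsetPset/ndF/leq_maxl.
    - by move: y Gky; exact/subsetPset/ndF/leq_maxr.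
  by move=> [n _ []/= ? ?]; split; exists n.
move=> k; have [? ?] := Foo k.
split; first exact: measurableX.
rewrite [X in X < _](@product_measure1E _ _ _ _ _ leb leb)//.
by rewrite lte_mul_pinfty// ge0_fin_numE.
Qed.

HB.instance Definition _ := Measure_isSigmaFinite.Build _ _ _ (@plane_measure R)
  plane_measure_sigma_finite.

End plane_measure.

Notation plane := (@plane_measure _).

Section plane_fubini.
Context {R : realType}.
Variable f : R * R -> \bar R.
Local Open Scope ereal_scope.

Lemma plane_tonelli1 : measurable_fun setT f -> (forall p, 0 <= f p) ->
  \int[plane]_p f p = \int[leb]_x \int[leb]_y f (x, y).
Proof.
by move=> mf f0; exact: (@fubini_tonelli1 _ _ _ _ R
  leb leb f mf f0).
Qed.

Lemma plane_tonelli2 : measurable_fun setT f -> (forall p, 0 <= f p) ->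
  \int[plane]_p f p = \int[leb]_y \int[leb]_x f (x, y).
Proof.
by move=> mf f0; exact: (@fubini_tonelli2 _ _ _ _ R
  leb leb f mf f0).
Qed.

End plane_fubini.

Notation leb4 := (product_measure1 plane plane).

(** * Mollification in the plane *)

Section mollification2.
Context {R : realType}.
Implicit Types g : R * R -> R.

Let harmonic_pos n : 0 < @harmonic R n := harmonic_gt0 R n.

Let split_snd g h : 0 < h -> measurable_fun setT g ->
  (\int[leb4]_p (kern h (p.2.1 - p.1.1) * kern h (p.2.2 - p.1.2) *
     `|g (p.2.1, p.2.2) - g (p.2.1, p.1.2)|)%:E =
   \int[leb]_y kern_osc (fun t => g (y, t)) h)%E.
Proof.
move=> h0 mg; have mk := @measurable_kern R h.
rewrite fubini_tonelli2; last 2 first.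
- by meas.
- by move=> p; rewrite lee_fin mulr_ge0 ?kern2_ge0 ?kern_ge0.
transitivity (\int[plane]_q \int[leb]_t (kern h (q.2 - t) * `|g q - g (q.1, t)|)%:E)%E.
  apply: eq_integral => -[y s] _; rewrite /fubini_G/=.
  rewrite plane_tonelli2; last 2 first.
  - by meas.
  - by move=> p; rewrite lee_fin mulr_ge0 ?kern2_ge0 ?kern_ge0.
  apply: eq_integral => t _ /=.
  under eq_integral do rewrite -mulrA mulrC EFinM.
  rewrite ge0_integralZl_EFin ?kernM_ge0// ?integral_kernr ?mule1//.
  - by move=> x _; rewrite lee_fin kern_ge0.
  - by meas.
rewrite plane_tonelli1; last 2 first.
- apply: (@measurable_integral_snd _ _ (measurableTypeR R * measurableTypeR R)%type _ _ leb
    (fun q t => (kern h (q.2 - t) * `|g q - g (q.1, t)|)%:E)).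
    by meas.
  by move=> q t; rewrite lee_fin mulr_ge0 ?kern_ge0.
- by move=> q; apply: integral_ge0 => t _; rewrite lee_fin mulr_ge0 ?kern_ge0.
apply: eq_integral => y _; rewrite /kern_osc plane_tonelli2//.
- by meas.
- by move=> p; rewrite lee_fin mulr_ge0 ?kern2_ge0 ?kern_ge0.
Qed.

Let split_fst g h : 0 < h -> measurable_fun setT g ->
  (\int[leb4]_p (kern h (p.2.1 - p.1.1) * kern h (p.2.2 - p.1.2) *
     `|g (p.2.1, p.1.2) - g (p.1.1, p.1.2)|)%:E =
   \int[leb]_t kern_osc (fun x => g (x, t)) h)%E.
Proof.
move=> h0 mg; have mk := @measurable_kern R h.
rewrite fubini_tonelli1; last 2 first.
- by meas.
- by move=> p; rewrite lee_fin mulr_ge0 ?kern2_ge0 ?kern_ge0.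
transitivity (\int[plane]_q \int[leb]_y (kern h (y - q.1) * `|g (y, q.2) - g q|)%:E)%E.
  apply: eq_integral => -[x t] _; rewrite /fubini_F/=.
  rewrite plane_tonelli1; last 2 first.
  - by meas.
  - by move=> p; rewrite lee_fin mulr_ge0 ?kern2_ge0 ?kern_ge0.
  apply: eq_integral => y _ /=.
  under eq_integral do rewrite mulrAC EFinM.
  rewrite ge0_integralZl_EFin ?kernM_ge0// ?integral_kernl ?mule1//.
  - by move=> s _; rewrite lee_fin kern_ge0.
  - by meas.
rewrite plane_tonelli2; last 2 first.
- apply: (@measurable_integral_snd _ _ (measurableTypeR R * measurableTypeR R)%type _ _ leb
    (fun q y => (kern h (y - q.1) * `|g (y, q.2) - g q|)%:E)).
    by meas.
  by move=> q t; rewrite lee_fin mulr_ge0 ?kern_ge0.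
- by move=> q; apply: integral_ge0 => t _; rewrite lee_fin mulr_ge0 ?kern_ge0.
apply: eq_integral => t _; rewrite /kern_osc plane_tonelli1//.
- by meas.
- by move=> p; rewrite lee_fin mulr_ge0 ?kern2_ge0 ?kern_ge0.
Qed.

(** Almost every line carries an integrable restriction, to which [kern_L1_cvg] applies;
    [kern_osc_le] provides the majorant, twice the L^1 norm on the line. *)
Let integral_osc_cvg (g : R -> R -> R) : measurable_fun setT (fun p => g p.1 p.2) ->
  (\int[leb]_y \int[leb]_t `|g y t|%:E < +oo)%E ->
  (\int[leb]_y kern_osc (g y) (harmonic n))%E @[n --> \oo] --> 0%E.
Proof.
move=> mg ig.
have mgy y : measurable_fun setT (g y).
  exact: (measurableT_comp mg (@pair1_measurable _ _ _ _ y)).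
have mI : measurable_fun setT (fun y => \int[leb]_t `|g y t|%:E)%E.
  apply: (@measurable_integral_snd _ _ _ _ _ leb (fun y t => `|g y t|%:E)) => //.
  by meas.
have iI : leb.-integrable setT (fun y => \int[leb]_t `|g y t|%:E)%E.
  apply/integrableP; split => //.
  by under eq_integral do rewrite gee0_abs ?integral_ge0//.
have [||||| _ _] := @dominated_convergence _ _ _ leb setT measurableT
  (fun n y => kern_osc (g y) (harmonic n)) (cst 0%E)
  (fun y => 2%:E * \int[leb]_t `|g y t|%:E)%E; last by rewrite integral0.
- move=> n; have mk := @measurable_kern R (harmonic n).
  apply: (@measurable_integral_snd _ _ _ _ _ (@plane_measure R)
    (fun y p => (kern (harmonic n) (p.2 - p.1) * `|g y p.2 - g y p.1|)%:E)).
    pose G (p : R * R) := g p.1 p.2; have mG : measurable_fun setT G := mg.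
    rewrite (_ : (fun _ => _) = (fun q : R * (R * R) => (kern (harmonic n) (q.2.2 - q.2.1) *
      `|G (q.1, q.2.2) - G (q.1, q.2.1)|)%:E))//.
    by clear mg; meas.
  by move=> y p; rewrite lee_fin mulr_ge0 ?kern_ge0.
- exact: measurable_cst.
- apply: (aeS (mu := leb)) (integrable_ae measurableT iI) => y /(_ I) gy _.
  apply: kern_L1_cvg => //; apply/integrableP; split; first by have := mgy y; move=> m; meas.
  by move: gy; rewrite ge0_fin_numE// integral_ge0.
- exact: integrableZl.
- apply: aeW => y n _; rewrite gee0_abs ?kern_osc_le//.
  by apply: integral_ge0 => p _; rewrite lee_fin mulr_ge0 ?kern_ge0.
Qed.

(** The increment of g from (x, t) to (y, s) is split at the corner (y, t). Each half moves a single
    coordinate, the kernel in the other one has mass one, and a one-dimensional oscillation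
    integrated over parallel lines remains. *)
Lemma kern_L1_cvg2 g : measurable_fun setT g -> leb2.-integrable setT (EFin \o g) ->
  (\int[leb4]_p (kern (harmonic n) (p.2.1 - p.1.1) * kern (harmonic n) (p.2.2 - p.1.2) *
     `|g p.2 - g p.1|)%:E)%E @[n --> \oo] --> 0%E.
Proof.
move=> mg ig.
have c1 := @integral_osc_cvg (fun y t => g (y, t)).
have c2 := @integral_osc_cvg (fun t y => g (y, t)).
have /c1{}c1 : measurable_fun setT (fun p => g (p.1, p.2)) by meas.
have /c2{}c2 : measurable_fun setT (fun p => g (p.2, p.1)) by meas.
have iplane : (\int[plane]_p `|g p|%:E < +oo)%E by move/integrableP : ig => [].
have mabs : measurable_fun setT (fun p => `|g p|%:E) by meas.
have /c1{}c1 : (\int[leb]_y \int[leb]_t `|g (y, t)|%:E < +oo)%E.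
  by rewrite -(plane_tonelli1 mabs).
have /c2{}c2 : (\int[leb]_t \int[leb]_y `|g (y, t)|%:E < +oo)%E.
  by rewrite -(plane_tonelli2 mabs).
have c : (\int[leb]_y kern_osc (fun t => g (y, t)) (harmonic n) +
    \int[leb]_t kern_osc (fun y => g (y, t)) (harmonic n))%E @[n --> \oo] --> 0%E.
  exact: (cvge0D c1 c2).
apply: squeeze_cvge0 c.
near=> n; move: (@harmonic R n) (harmonic_gt0 R n) => h h0; have mk := @measurable_kern R h.
rewrite integral_ge0/=; last by move=> p _; rewrite lee_fin mulr_ge0 ?kern2_ge0 ?kern_ge0.
rewrite -split_snd// -split_fst// -ge0_integralD//; last 4 first.
- by move=> p _; rewrite lee_fin mulr_ge0 ?kern2_ge0 ?kern_ge0.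
- by meas.
- by move=> p _; rewrite lee_fin mulr_ge0 ?kern2_ge0 ?kern_ge0.
- by meas.
apply: ge0_integral_le.
- by meas.
- by meas.
- by move=> p; rewrite lee_fin mulr_ge0 ?kern2_ge0 ?kern_ge0.
move=> [[x t] [y s]] /=; rewrite -EFinD lee_fin -mulrDr ler_wpM2l ?kern2_ge0//.
by rewrite -[X in `|X|](subrKA (g (y, t))) ler_normD.
Unshelve. all: by end_near. Qed.

End mollification2.

(** * Entropy tests and the initial trace *)

(** The Kruzkov entropy flux. Its symmetry in x and k, proved in [kfluxC], lets the two solutions
    exchange roles in the doubling. *)
Definition kflux {R : realType} (f : R -> R) (x k : R) : R := Num.sg (x - k) * (f x - f k).

Section sup_bounds.
Context {R : realType} {X : Type}.
Implicit Types g : X -> R.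

Definition has_sup_bound g := exists C, forall x, `|g x| <= C.

Lemma has_sup_boundM g1 g2 : has_sup_bound g1 -> has_sup_bound g2 ->
  has_sup_bound (fun x => g1 x * g2 x).
Proof. by move=> [C1 b1] [C2 b2]; exists (C1 * C2) => x; rewrite normrM ler_pM. Qed.

Lemma has_sup_boundB g1 g2 : has_sup_bound g1 -> has_sup_bound g2 ->
  has_sup_bound (fun x => g1 x - g2 x).
Proof.
by move=> [C1 b1] [C2 b2]; exists (C1 + C2) => x; rewrite (le_trans (ler_normB _ _))// lerD.
Qed.

End sup_bounds.

Lemma has_sup_bound_comp (R : realType) (X Y : Type) (h : X -> Y) (g : Y -> R) :
  has_sup_bound g -> has_sup_bound (g \o h).
Proof. by move=> [C b]; exists C => x; exact: b. Qed.

Lemma vanishing_sup_bound (R : realType) (b c : R) (g : R -> R) : continuous g ->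
  vanishes_outside b c g -> has_sup_bound g.
Proof.
move=> cg gbc; have [cb|bc] := ltP c b.
  exists 0 => x; rewrite gbc ?normr0//.
  by have [xb|bx] := ltP x b; [left|right; exact: lt_le_trans bx].
have [|d _ dm] := @EVT_max R (fun x => `|g x|) b c bc.
  by apply: continuous_subspaceT => x; apply: continuous_comp (cg x) _; exact: norm_continuous.
exists `|g d| => x; have [xr|] := boolP (b <= x <= c); first by apply: dm; rewrite in_itv.
by rewrite negb_and -!ltNge => /orP xr; rewrite gbc ?normr0.
Qed.

Lemma has_sup_bound_indic (R : realType) (X : Type) (D : set X) : has_sup_bound (\1_D : X -> R).
Proof. by exists 1 => x; rewrite indicE; case: (_ \in _); rewrite ?normr1 ?normr0. Qed.

Lemma vanishes_outside_indic (R : realType) (a b : R) (D : set R) :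
  D `<=` `[a, b] -> vanishes_outside a b (\1_D : R -> R).
Proof.
move=> Dab x xab; rewrite indicE memNset// => /Dab /=; rewrite in_itv/= => /andP[ax xb].
by case: xab; rewrite ltNge ?ax ?xb.
Qed.

Section boxes_and_plateaus.
Context {R : realType}.

Lemma measurable_slab (I : interval R) : measurable (slab I : set (measurableTypeR R * measurableTypeR R)).
Proof.
have -> : slab I = setT `&` snd @^-1` [set` I] by rewrite setTI.
by apply: measurable_snd => //; exact: measurable_itv.
Qed.

Lemma measurable_sg : measurable_fun [set: R] (@Num.sg R).
Proof.
apply: nondecreasing_measurable => // x y xy.
have [x0|x0|x0] := ltgtP x 0; have [y0|y0|y0] := ltgtP y 0;
  rewrite ?(ltr0_sg x0) ?(gtr0_sg x0) ?x0 ?sgr0 ?(ltr0_sg y0) ?(gtr0_sg y0) ?y0 ?sgr0//; lra.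
Qed.

Definition box (r s : R) : set (measurableTypeR R * measurableTypeR R) :=
  `[- r, r]%classic `*` `[0, s]%classic.

Lemma measurable_box r s : measurable (box r s).
Proof. by apply: measurableX; exact: measurable_itv. Qed.

Lemma kern_sup_bound h (y : R) : 0 < h -> has_sup_bound (fun x => kern h (x - y)).
Proof.
move=> h0; have [B B0 kB] := @kern_bounded R.
by exists (B / h) => x; rewrite ger0_norm ?kern_ge0// kB.
Qed.

Lemma integrable_mul_tensor (A B : R -> R) (N : R * R -> R) (a b c d : R) :
  measurable_fun setT A -> measurable_fun setT B -> measurable_fun setT N ->
  has_sup_bound A -> has_sup_bound B -> vanishes_outside a b A -> vanishes_outside c d B ->
  plane.-integrable (`[a, b]%classic `*` `[c, d]%classic) (EFin \o N) ->
  plane.-integrable setT (fun z => (A z.1 * B z.2 * N z)%:E).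
Proof.
move=> mA mB mN [C bA] [C' bB] vA vB iN.
apply: (@integrable_mul_supp _ _ _ plane (`[a, b]%classic `*` `[c, d]%classic) _ _ (C * C')) => //.
- by apply: measurableX; exact: measurable_itv.
- by meas.
- by move=> z; rewrite normrM ler_pM.
- move=> z /not_andP; rewrite /= !in_itv/= => -[/negP|/negP]; rewrite negb_and -!ltNge => zz.
    by rewrite vA ?mul0r//; case/orP : zz; [left|right].
  by rewrite vB ?mulr0//; case/orP : zz; [left|right].
Qed.

Lemma integrable_cst_box (r s c : R) : plane.-integrable (box r s) (fun=> c%:E).
Proof.
apply/integrableP; split; first exact: measurable_cst.
rewrite (integral_cst plane); last exact: measurable_box.
rewrite lte_mul_pinfty//.
rewrite [X in (X < _)%E](@product_measure1E _ _ _ _ _ leb leb)//.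
rewrite lte_mul_pinfty// ?ge0_fin_numE//; apply: compact_finite_measure; exact: segment_compact.
Qed.

Lemma box_slab (T r s : R) : s < T -> box r s `<=` slab `[0, T[.
Proof.
move=> sT z [/= _]; rewrite /slab/= !in_itv/= => /andP[-> /=] zs.
exact: le_lt_trans sT.
Qed.

Lemma step_plateau_ge0 (h1 h2 y1 y2 x : R) : 0 < h1 -> 0 < h2 -> y1 + h1 <= y2 ->
  0 <= step h1 y1 x - step h2 y2 x.
Proof.
move=> h10 h20 y12; rewrite subr_ge0.
have [xy|/ltW xy] := leP x y2; first by rewrite step_l// step_ge0.
by rewrite [leRHS]step_r ?step_le1// (le_trans y12).
Qed.

Lemma smooth_plateau (h1 h2 y1 y2 : R) : smooth (fun x => step h1 y1 x - step h2 y2 x).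
Proof.
have -> : (fun x => step h1 y1 x - step h2 y2 x) = fun x => step h1 y1 x + (-1) * step h2 y2 x.
  by apply/funext => x; rewrite mulN1r.
apply: smoothD; first exact: smooth_stepfun.
by apply: smoothM; [exact: smooth_cst|exact: smooth_stepfun].
Qed.

Lemma is_derive_plateau (h1 h2 y1 y2 x : R) :
  is_derive x 1 (fun x => step h1 y1 x - step h2 y2 x) (kern h1 (x - y1) - kern h2 (x - y2)).
Proof. exact: (is_deriveB (is_derive_step h1 y1 x) (is_derive_step h2 y2 x)). Qed.

Lemma plateau_out (h1 h2 y1 y2 : R) : 0 < h1 -> 0 < h2 -> y1 + h1 <= y2 + h2 ->
  y1 <= y2 -> vanishes_outside y1 (y2 + h2) (fun x => step h1 y1 x - step h2 y2 x).
Proof.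
move=> h10 h20 y12 y12' x [xy|xy].
  by rewrite !step_l ?subrr ?(ltW xy)// (le_trans (ltW xy)).
by rewrite !step_r ?subrr ?(ltW xy)// (le_trans y12 (ltW xy)).
Qed.

(** A kernel used as slope of a test function can thus be divided out on a box, turning
    integrability of the entropy integrand into integrability of its factor. *)
Lemma kern_lower_bound (h b c : R) : 0 < b -> b <= c -> c < h ->
  exists2 e : R, 0 < e & forall x, b <= x <= c -> e <= kern h x.
Proof.
move=> b0 bc ch; have [|z zbc zmin] := @EVT_min R (kern h) b c bc.
  by apply: continuous_subspaceT; exact: continuous_kern.
exists (kern h z); last by move=> x xbc; apply: zmin; rewrite in_itv.
move: zbc; rewrite in_itv/= => /andP[bz zc].
by rewrite kern_gt0// (lt_le_trans b0 bz) (le_lt_trans zc ch).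
Qed.

End boxes_and_plateaus.

#[global] Hint Extern 0 (measurable (box _ _)) => exact: measurable_box : core.

Section entropy_tests.
Context {R : realType}.
Variables (a T : R) (f u0 w0 : R -> R) (u w : R * R -> R).
Hypothesis T0 : 0 < T.
Hypothesis cf : continuous f.
Hypothesis mu : measurable_fun setT u.
Hypothesis mw : measurable_fun setT w.
Hypothesis a0 : 0 < a.
Hypothesis ent : entropy_inequality a T f u0 w0 u w.

Let S : set (R * R) := slab `[0, T[.

(** The entropy integrand for the test function al(x) be(t). The derivatives are separate arguments
    so that explicit kernels can stand for them. *)
Definition entropy_tensor (k : R * R) (al al' be be' : R -> R) (z : R * R) : R :=
  (`|u z - k.1| + `|w z - k.2|) * (al z.1 * be' z.2) +
  kflux f (u z) k.1 * (al' z.1 * be z.2).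

Lemma entropy_tensorP (k : R * R) (al al' be be' : R -> R) (x1 x2 t1 t2 : R) :
  smooth al -> smooth be ->
  (forall x : R, is_derive x 1 al (al' x)) -> (forall t : R, is_derive t 1 be (be' t)) ->
  vanishes_outside x1 x2 al -> vanishes_outside t1 t2 be ->
  (forall x, 0 <= al x) -> (forall t, 0 <= t -> 0 <= be t) -> t2 < T ->
  strip_L a k ->
  plane.-integrable S (EFin \o entropy_tensor k al al' be be') /\
  (0 <= \int[plane]_(z in S) (entropy_tensor k al al' be be' z)%:E +
    \int[leb]_x ((`|u0 x - k.1| + `|w0 x - k.2|) * (al x * be 0))%:E)%E.
Proof.
move=> sal sbe dal dbe val vbe al0 be0 t2T ka.
have [|i1 i2] := ent (phi := fun z => al z.1 * be z.2) _ ka.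
  split.
  - exact: (tensor_Coo sal sbe).
  - by apply: (tensor_compact_support val vbe) => t /andP[_ tt]; rewrite in_itv/= (le_lt_trans tt).
  - by move=> x t t0; rewrite /= mulr_ge0// be0.
have E z : entropy_integrand f u w k (fun z => al z.1 * be z.2) z =
    entropy_tensor k al al' be be' z.
  rewrite /entropy_integrand /entropy_tensor !(derive_tensor _ _ dal dbe)/= /kflux.
  by rewrite !(mul0r, mul1r, mulr0, add0r, addr0).
have Ef : entropy_integrand f u w k (fun z => al z.1 * be z.2) =
   entropy_tensor k al al' be be' by apply/funext.
by move: i1 i2; rewrite Ef.
Qed.

Let strip0 : strip_L a (0, 0).
Proof. by rewrite /strip_L/= subrr normr0 ltW. Qed.

Let measurable_f : measurable_fun setT f.
Proof. exact: continuous_measurable_fun. Qed.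

(** The integrability clause is used with the constant (0, 0). The test function has zero
    x-derivative on the box and a t-derivative at most - e there, so up to sign the integrand
    dominates e times |u| + |w|. *)
Lemma integrable_uw_box r s : 0 < r -> 0 <= s -> s < T ->
  plane.-integrable (box r s) (fun z => (`|u z| + `|w z|)%:E).
Proof.
move=> r0 s0 sT.
(* In time the test falls from 1 at -1 to 0 at d < T. Its slope is - [kern (d + 1) (t + 1)], and for
   t in [0, s] the argument t + 1 stays in [1, s + 1], inside the open support ]0, d + 1[. *)
pose d := (s + T) / 2.
have [d1 d2] : s < d /\ d < T by rewrite /d; split; lra.
have hd : 0 < d + 1 by lra.
have [|||e e0 ek] := @kern_lower_bound R (d + 1) 1 (s + 1); [lra..|].
have [] := @entropy_tensorP (0, 0)
  (fun x => step 1 (- r - 2) x - step 1 (r + 1) x)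
  (fun x => kern 1 (x - (- r - 2)) - kern 1 (x - (r + 1)))
  (fun x => step 1 (- 3) x - step (d + 1) (- 1) x)
  (fun x => kern 1 (x - (- 3)) - kern (d + 1) (x - (- 1)))
  (- r - 2) (r + 1 + 1) (- 3) (- 1 + (d + 1)).
- exact: smooth_plateau.
- exact: smooth_plateau.
- by move=> x; exact: is_derive_plateau.
- by move=> x; exact: is_derive_plateau.
- by apply: plateau_out => //; lra.
- by apply: plateau_out => //; lra.
- by move=> x; apply: step_plateau_ge0 => //; lra.
- by move=> x _; apply: step_plateau_ge0 => //; lra.
- lra.
- exact: strip0.
move=> iI _.
have {}iI := integrableS (measurable_slab _) (measurable_box r s) (@box_slab R T r s sT) iI.
apply: (@le_integrable _ _ _ _ _ (measurable_box r s) _ (fun z => e^-1%:E *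
  (entropy_tensor (0, 0) (fun x => step 1 (- r - 2) x - step 1 (r + 1) x)
  (fun x => kern 1 (x - (- r - 2)) - kern 1 (x - (r + 1)))
  (fun x => step 1 (- 3) x - step (d + 1) (- 1) x)
  (fun x => kern 1 (x - (- 3)) - kern (d + 1) (x - (- 1))) z)%:E)%E).
- by apply: measurable_funTS; meas.
- move=> [x t] /= []/=; rewrite !in_itv/= => /andP[rx xr] /andP[t0 ts].
  rewrite /entropy_tensor/= !subr0.
  rewrite [kern 1 (x - (- r - 2))](kern_out ltr01); last by right; lra.
  rewrite [kern 1 (x - (r + 1))](kern_out ltr01); last by left; lra.
  rewrite [kern 1 (t - (- 3))](kern_out ltr01); last by right; lra.
  rewrite [step 1 (- r - 2) x]step_r//; last lra.
  rewrite [step 1 (r + 1) x]step_l//; last lra.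
  rewrite subrr mul0r mulr0 addr0 subr0 mul1r sub0r mulrN.
  rewrite lee_fin !normrM normrN !normrM (ger0_norm (_ : 0 <= e^-1)) ?invr_ge0 ?(ltW e0)//.
  rewrite ler_pdivlMl// mulrC ler_wpM2l//.
  by rewrite ger0_norm ?kern_ge0// ek// opprK; apply/andP; split; lra.
- exact: integrableZl.
Qed.

(** The roles of space and time are exchanged: on the box the time factor is constantly 1 and the
    space factor has slope at least e. What is left of the integrand is the flux against the
    constant 0, of absolute value |f u - f 0|, times that slope. *)
Lemma integrable_fu_box r s : 0 < r -> 0 <= s -> s < T ->
  plane.-integrable (box r s) (fun z => (f (u z))%:E).
Proof.
move=> r0 s0 sT.
(* The time factor falls on [s + h, s + 2 h], after the box and before T. The space factor rises
   over [- r - 1, r + 1], whence the width 2 r + 2, and falls beyond. *)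
pose h := (T - s) / 3.
have h0 : 0 < h by rewrite /h; lra.
have hT : s + h + h < T by rewrite /h; lra.
have hr : 0 < 2 * r + 2 by lra.
have [|||e e0 ek] := @kern_lower_bound R (2 * r + 2) 1 (2 * r + 1); [lra..|].
pose al x : R := step (2 * r + 2) (- r - 1) x - step 1 (r + 2) x.
pose al' x : R := kern (2 * r + 2) (x - (- r - 1)) - kern 1 (x - (r + 2)).
pose be t : R := step 1 (- 3) t - step h (s + h) t.
pose be' t : R := kern 1 (t - (- 3)) - kern h (t - (s + h)).
have [] := @entropy_tensorP (0, 0) al al' be be'
  (- r - 1) (r + 2 + 1) (- 3) (s + h + h).
- exact: smooth_plateau.
- exact: smooth_plateau.
- by move=> x; exact: is_derive_plateau.
- by move=> x; exact: is_derive_plateau.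
- by apply: plateau_out => //; lra.
- by apply: plateau_out => //; lra.
- by move=> x; apply: step_plateau_ge0 => //; lra.
- by move=> x _; apply: step_plateau_ge0 => //; lra.
- by [].
- exact: strip0.
move=> iI _.
have {}iI := integrableS (measurable_slab _) (measurable_box r s) (@box_slab R T r s sT) iI.
have ic := integrable_cst_box r s `|f 0|.
apply: (@le_integrable _ _ _ _ _ (measurable_box r s) _ (fun z => `|f 0|%:E + e^-1%:E *
  `|entropy_tensor (0, 0) al al' be be' z|%:E)%E).
- by apply: measurable_funTS; meas.
- move=> [x t] /= []/=; rewrite !in_itv/= => /andP[rx xr] /andP[t0 ts].
  rewrite /entropy_tensor/= !subr0.
  have -> : be' t = 0.
    rewrite /be' [kern 1 _](kern_out ltr01); last by right; lra.
    by rewrite (kern_out h0) ?subrr//; left; lra.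
  have -> : be t = 1.
    by rewrite /be step_r//; [rewrite step_l ?subr0//; lra|lra].
  have -> : al' x = kern (2 * r + 2) (x - (- r - 1)).
    by rewrite /al' [kern 1 _](kern_out ltr01) ?subr0//; left; lra.
  rewrite !mulr0 add0r mulr1 lee_fin.
  rewrite [leRHS]ger0_norm; last by rewrite addr_ge0// mulr_ge0// invr_ge0 ltW.
  have -> : f (u (x, t)) = f 0 + (f (u (x, t)) - f 0) by ring.
  rewrite (le_trans (ler_normD _ _))// lerD2l ler_pdivlMl// normrM mulrC.
  have [->|ux] := eqVneq (u (x, t)) 0; first by rewrite subrr normr0 mul0r mulr_ge0.
  rewrite /kflux subr0 normrM normr_sg ux mul1r ler_wpM2l//.
  by rewrite ger0_norm ?kern_ge0// ek//; apply/andP; split; lra.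
- apply: integrableD => //; apply: integrableZl => //.
  exact: integrable_norm.
Qed.

End entropy_tests.

(** * Time slices as limits of kernel averages *)

Section slices.
Context {R : realType}.
Implicit Types (N v : R * R -> R) (al : R -> R).

Lemma dist_cvge (X : Type) (F : set_system X) {FF : Filter F} (G : X -> \bar R) (M : \bar R) :
  M \is a fin_num -> (`|G x - M|)%E @[x --> F] --> 0%E -> G @ F --> M.
Proof.
move=> fM G0; move/fine_cvgP: (G0) => [Gf Gd].
have Gfin : \forall x \near F, G x \is a fin_num.
  apply: filterS Gf => x; rewrite abse_fin_num; rewrite -(fineK fM).
  by case: (G x).
rewrite -(fineK fM); apply/fine_cvgP; split => //.
apply/cvgrPdist_le => e e0.
move/cvgr0Pnorm_le/(_ e e0): Gd => Gd.
apply: filterS2 Gfin Gd => x xf /=.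
rewrite -{1}(fineK fM) -{1}(fineK xf) -EFinB /= normr_id => le.
by rewrite distrC.
Qed.

Lemma plane_fubini1 (F : R * R -> \bar R) : plane.-integrable setT F ->
  (\int[plane]_p F p = \int[leb]_x \int[leb]_y F (x, y))%E.
Proof.
by move=> iF; rewrite -(@integral12_prod_meas1 _ _ _ _ R leb leb).
Qed.

(** One-sided because [kern h (t - s)] sees only times in [s, s + h]; the time s = 0 is then treated
    like any other. *)
Definition slice_right_cont N (s : R) := forall r : R,
  (\int[leb]_(x in `[(- r)%R, r]) `|N (x, t) - N (x, s)|%:E)%E @[t --> s^'+] --> 0%E.

Lemma measurable_slice1 v (t : R) : measurable_fun setT v -> measurable_fun setT (fun x => v (x, t)).
Proof. by move=> mv; exact: (measurableT_comp mv (@pair2_measurable _ _ _ _ t)). Qed.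

Lemma measurable_slice2 v (x : R) : measurable_fun setT v -> measurable_fun setT (fun t => v (x, t)).
Proof. by move=> mv; exact: (measurableT_comp mv (@pair1_measurable _ _ _ _ x)). Qed.

Lemma C0_slice_right_cont (T : R) v s : C0_L1loc T v -> s \in `[0, T[ -> slice_right_cont v s.
Proof.
move=> [_ _ cv] sT r; have := cv s `[- r, r]%classic sT (@segment_compact _ _ _).
apply: cvg_trans; apply: cvg_app => A /= [e e0 eA].
move: sT; rewrite in_itv/= => /andP[s0 sT].
have m0 : 0 < Num.min e (T - s) by rewrite lt_min e0 subr_gt0.
exists (Num.min e (T - s)) => // t /=; rewrite lt_min => /andP[te tT] st.
apply: eA => //=; rewrite in_itv/= (le_trans s0 (ltW st))/=.
by move: tT; rewrite ltr0_norm ?subr_lt0// opprB ltrD2r.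
Qed.

Lemma slice_right_cont_le2 N v1 v2 s : measurable_fun setT N -> measurable_fun setT v1 ->
  measurable_fun setT v2 ->
  (forall x t, `|N (x, t) - N (x, s)| <=
    `|v1 (x, t) - v1 (x, s)| + `|v2 (x, t) - v2 (x, s)|) ->
  slice_right_cont v1 s -> slice_right_cont v2 s -> slice_right_cont N s.
Proof.
move=> mN mv1 mv2 Nv c1 c2 r; have {}c1 := c1 r; have {}c2 := c2 r.
have c : (\int[leb]_(x in `[(- r)%R, r]) `|v1 (x, t) - v1 (x, s)|%:E +
   \int[leb]_(x in `[(- r)%R, r]) `|v2 (x, t) - v2 (x, s)|%:E)%E @[t --> s^'+] --> 0%E.
  exact: (cvge0D c1 c2).
apply: squeeze_cvge0 c; near=> t.
have m1 := measurable_slice1 t mv1; have m1' := measurable_slice1 s mv1.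
have m2 := measurable_slice1 t mv2; have m2' := measurable_slice1 s mv2.
have mn := measurable_slice1 t mN; have mn' := measurable_slice1 s mN.
rewrite integral_ge0//= -ge0_integralD//; last 2 first.
- by apply: measurable_funTS; meas.
- by apply: measurable_funTS; meas.
apply: ge0_le_integral => //.
- by apply: measurable_funTS; meas.
- by apply: measurable_funTS; meas.
- by move=> x _; rewrite -EFinD lee_fin.
Unshelve. all: by end_near. Qed.

(** Replacing [N z] by its value on the slice s costs at most C times the kernel average over t of
    the L^1 distance on [- r, r] between the slices t and s. After the replacement the time kernel
    integrates to 1. *)
Lemma kern_slice_cvg N al (r s d C : R) : measurable_fun setT N -> measurable_fun setT al ->
  (forall x, `|al x| <= C) -> vanishes_outside (- r) r al -> 0 < d ->
  plane.-integrable (`[- r, r]%classic `*` `[s, s + d]%classic) (EFin \o N) ->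
  leb.-integrable `[- r, r]%classic (fun x => (N (x, s))%:E) ->
  slice_right_cont N s ->
  (\int[plane]_z (N z * (al z.1 * kern h (z.2 - s)))%:E)%E @[h --> 0^'+] -->
  (\int[leb]_x (N (x, s) * al x)%:E)%E.
Proof.
move=> mN mal alC alr d0 iN iNs cN.
have C0 : 0 <= C by exact: le_trans (alC 0).
have mNs := measurable_slice1 s mN.
have iM : leb.-integrable setT (fun x => (al x * N (x, s))%:E).
  apply: (@integrable_mul_supp _ _ _ leb `[- r, r]%classic al _ C) => //.
  move=> x /= xr; apply: alr; move/negP: xr; rewrite in_itv/= negb_and -!ltNge.
  by case/orP; [left|right].
apply: dist_cvge.
  by apply: integrable_fin_num => //; under eq_fun do rewrite mulrC.
have [B B0 kB] := @kern_bounded R.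
apply: ge0_cvge0 => e e0.
(* The added 1 covers the case C = 0. *)
have e'0 : 0 < e / (C + 1) by rewrite divr_gt0// ltr_wpDl.
move/fine_cvgP : (cN r) => [cNf /cvgr0Pnorm_le/(_ _ e'0) cNe].
have [dl /= dl0 ddl] : \forall t \near s^'+,
    (\int[leb]_(x in `[(- r)%R, r]) `|N (x, t) - N (x, s)|%:E <= (e / (C + 1))%:E)%E.
  apply: filterS2 cNf cNe => t tf /= te.
  by rewrite -(fineK tf) lee_fin (le_trans (ler_norm _)).
near=> h; rewrite abse_ge0/=.
have h0 : 0 < h by near: h; exact: nbhs_right_gt.
have hd : h < d by near: h; exact: nbhs_right_lt.
have hdl : h < dl by near: h; exact: nbhs_right_lt.
have mk := @measurable_kern R h.
have kout t : ~ (s < t <= s + h) -> t <> s -> kern h (t - s) = 0.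
  move=> st ts; apply: (kern_out h0); move/negP : st; rewrite negb_and -leNgt -ltNge.
  case/orP => st; last by right; rewrite ltrBrDl.
  by left; rewrite subr_lt0 lt_neqAle st andbT; apply/eqP.
have i1 : plane.-integrable setT (fun z => ((al z.1 * kern h (z.2 - s)) * N z)%:E).
  apply: (@integrable_mul_tensor _ al (fun u => kern h (u - s)) N (- r) r s (s + d)) => //.
  - by meas.
  - by exists C.
  - exact: kern_sup_bound.
  - apply: vanishes_outsideW (kern_shift_out h0) => //; by rewrite lerD2l ltW.
have ik : leb.-integrable setT (EFin \o (fun t => kern h (t - s))) := integrable_kern s h0.
have i2 : plane.-integrable setT (fun z => ((al z.1 * N (z.1, s)) * kern h (z.2 - s))%:E).
  exact: (@integrable_tensor_prod _ _ _ _ R leb leb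
    (fun x => al x * N (x, s)) (fun t => kern h (t - s)) iM ik).
have -> : (\int[leb]_x (N (x, s) * al x)%:E =
    \int[plane]_z ((al z.1 * N (z.1, s)) * kern h (z.2 - s))%:E)%E.
  rewrite (plane_fubini1 i2); apply: eq_integral => x _ /=.
  under [RHS]eq_integral do rewrite EFinM.
  by rewrite integralZl// integral_kernl// mule1 mulrC.
under [X in (X - _)%E]eq_integral do rewrite mulrC.
rewrite -integralB_EFin//.
have mNs1 : measurable_fun setT (fun z : R * R => N (z.1, s)) by meas.
apply: le_trans (le_abse_integral _ _ _) _ => //; first by meas.
rewrite (_ : \int[_]_(_ in _) _ = \int[plane]_z
    (kern h (z.2 - s) * (`|al z.1| * `|N z - N (z.1, s)|))%:E)%E; last first.
  apply: eq_integral => z _; rewrite -EFinB abse_EFin; congr EFin.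
  rewrite (_ : _ - _ = kern h (z.2 - s) * (al z.1 * (N z - N (z.1, s)))); last by ring.
  by rewrite !normrM (ger0_norm (kern_ge0 _ h0)).
rewrite plane_tonelli2/=; last 2 first.
- by meas.
- by move=> z; rewrite lee_fin kernM_ge0// mulr_ge0.
apply: (@le_trans _ _ (\int[leb]_t (e%:E * (kern h (t - s))%:E))%E); last first.
  rewrite ge0_integralZl_EFin// ?integral_kernl// ?mule1// ?(ltW e0)//.
  - by move=> t _; rewrite lee_fin kern_ge0.
  - by meas.
apply: ge0_integral_le.
- apply: (@measurable_integral_snd _ _ (measurableTypeR R) _ _ leb
    (fun t x => (kern h (t - s) * (`|al x| * `|N (x, t) - N (x, s)|))%:E)).
    by meas.
  by move=> t x; rewrite lee_fin kernM_ge0// mulr_ge0.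
- by apply: measurable_funeM; meas.
- by move=> t; apply: integral_ge0 => x _; rewrite lee_fin kernM_ge0// mulr_ge0.
move=> t; have mNt := measurable_slice1 t mN.
have [->|ts] := eqVneq t s.
  by rewrite integral0_eq ?mule_ge0// ?lee_fin ?kern_ge0 ?(ltW e0)// => x _; rewrite (subrr (N (x, s))) normr0 !mulr0.
have [|/negP tsh] := boolP (s < t <= s + h); last first.
  have kt : kern h (t - s) = 0 by apply: kout tsh _; exact/eqP.
  by rewrite kt mule0 integral0_eq// => x _; rewrite mul0r.
move=> /andP[st tsh].
under eq_integral do rewrite EFinM.
rewrite ge0_integralZl_EFin ?kern_ge0//; last by meas.
rewrite muleC; apply: lee_wpmul2r; first by rewrite lee_fin kern_ge0.
rewrite (@integral_support _ _ _ leb `[- r, r]%classic); last first.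
  move=> x /= /negP; rewrite in_itv/= negb_and -!ltNge => xr.
  by rewrite alr ?normr0 ?mul0r//; case/orP : xr; [left|right].
apply: (@le_trans _ _ (\int[leb]_(x in `[(- r)%R, r]) (C%:E * `|N (x, t) - N (x, s)|%:E))%E).
  apply: ge0_le_integral => //.
  - by apply: measurable_funTS; meas.
  - by apply: measurable_funTS; meas.
  - by move=> x _; rewrite -EFinM lee_fin ler_wpM2r.
rewrite ge0_integralZl_EFin//; last by apply: measurable_funTS; meas.
apply: (@le_trans _ _ (C%:E * (e / (C + 1))%:E)%E).
  apply: lee_wpmul2l => //; apply: ddl => //=.
  rewrite ltr0_norm ?subr_lt0// opprB ltrBlDl (le_lt_trans tsh)// ltrD2l.
  exact: hdl.
rewrite -EFinM lee_fin mulrCA ler_piMr ?(ltW e0)//.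
by rewrite ler_pdivrMr ?ltr_wpDl// mul1r lerDl.
Unshelve. all: by end_near. Qed.

Lemma integrable_slice_mul v al (r t C : R) : measurable_fun setT v -> measurable_fun setT al ->
  (forall x, `|al x| <= C) -> vanishes_outside (- r) r al ->
  leb.-integrable `[- r, r]%classic (fun x => (v (x, t))%:E) ->
  leb.-integrable setT (fun x => (v (x, t) * al x)%:E).
Proof.
move=> mv mal alC val it; under eq_fun do rewrite mulrC.
have mt := measurable_slice1 t mv.
apply: (@integrable_mul_supp _ _ _ leb `[- r, r]%classic _ _ C) => //.
move=> x /negP; rewrite /= in_itv/= negb_and -!ltNge => xr.
by apply: val; apply/orP.
Qed.

Lemma slice_integral_cvg (v : R * R -> R) (al : R -> R) (r C s : R) (sn : nat -> R) :
  measurable_fun setT v -> measurable_fun setT al -> (forall x, `|al x| <= C) ->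
  vanishes_outside (- r) r al -> sn @ \oo --> s^'+ ->
  (forall n, leb.-integrable `[- r, r]%classic (fun x => (v (x, sn n))%:E)) ->
  leb.-integrable `[- r, r]%classic (fun x => (v (x, s))%:E) -> slice_right_cont v s ->
  (\int[leb]_x (v (x, sn n) * al x)%:E)%E @[n --> \oo] --> (\int[leb]_x (v (x, s) * al x)%:E)%E.
Proof.
move=> mv mal alC val snc isn is_ vs.
apply: dist_cvge; first by apply: integrable_fin_num => //; exact: integrable_slice_mul alC val is_.
have sr : (\int[leb]_(x in `[(- r)%R, r]) `|v (x, sn n) - v (x, s)|%:E)%E
    @[n --> \oo] --> 0%E by exact: cvg_comp snc (vs r).
have Csr : (C%:E * \int[leb]_(x in `[(- r)%R, r]) `|v (x, sn n) - v (x, s)|%:E)%E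
    @[n --> \oo] --> 0%E by exact: cvge0Zl sr.
apply: (squeeze_cvge0 _ Csr); apply: nearW => n; rewrite abse_ge0/=.
have m1 := measurable_slice1 (sn n) mv; have m2 := measurable_slice1 s mv.
rewrite -integralB_EFin//; last 2 first.
- exact: integrable_slice_mul alC val (isn n).
- exact: integrable_slice_mul alC val is_.
apply: le_trans (le_abse_integral _ _ _) _ => //; first by meas.
rewrite (@integral_support _ _ _ leb `[- r, r]%classic); last first.
  move=> x /negP; rewrite /= in_itv/= negb_and -!ltNge => xr.
  by rewrite val ?mulr0 ?subrr ?normr0//; apply/orP.
rewrite -ge0_integralZl_EFin//; last 2 first.
- by apply: measurable_funTS; meas.
- exact: le_trans (alC 0).
apply: ge0_le_integral => //.
- by apply: measurable_funTS; meas.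
- by apply: measurable_funTS; meas.
- by move=> x _; rewrite -EFinB abse_EFin -EFinM lee_fin -mulrBl normrM mulrC ler_wpM2r.
Qed.

Lemma integrable_mul_time_kern N al (r s t h C : R) : 0 < h -> 0 <= t -> t + h <= s ->
  measurable_fun setT N -> measurable_fun setT al -> (forall x, `|al x| <= C) ->
  vanishes_outside (- r) r al -> plane.-integrable (box r s) (EFin \o N) ->
  plane.-integrable setT (fun z => (N z * (al z.1 * kern h (z.2 - t)))%:E).
Proof.
move=> h0 t0 ths mN mal alC val iN; have mk := @measurable_kern R h.
under eq_fun do rewrite mulrC.
apply: (@integrable_mul_tensor _ al (fun u => kern h (u - t)) N (- r) r 0 s) => //.
- by meas.
- by exists C.
- exact: kern_sup_bound.
- exact: vanishes_outsideW (kern_shift_out h0).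
Qed.

Lemma kern_slice_seq_cvg N al (r s t c C : R) : 0 < c -> 0 <= t -> t + c <= s ->
  measurable_fun setT N -> measurable_fun setT al -> (forall x, `|al x| <= C) ->
  vanishes_outside (- r) r al -> plane.-integrable (box r s) (EFin \o N) ->
  leb.-integrable `[- r, r]%classic (fun x => (N (x, t))%:E) -> slice_right_cont N t ->
  (\int[plane]_z (N z * (al z.1 * kern (c * harmonic n) (z.2 - t)))%:E)%E @[n --> \oo] -->
  (\int[leb]_x (N (x, t) * al x)%:E)%E.
Proof.
move=> c0 t0 tcs mN mal alC val iN iNt cN.
have it : plane.-integrable (`[- r, r]%classic `*` `[t, t + c]%classic) (EFin \o N).
  apply: integrableS iN => //; first by apply: measurableX; exact: measurable_itv.
  move=> z [/= z1]; rewrite !in_itv/= => /andP[z2 z3]; rewrite /box/= !in_itv/=; split=> //.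
  by rewrite (le_trans t0)//= (le_trans z3).
have cc := kern_slice_cvg mN mal alC val c0 it iNt cN.
exact: cvg_comp (scaled_harmonic_at_right c0) cc.
Qed.

Lemma kern_support h (y : R) : 0 < h ->
  exists2 r : R, 0 < r & vanishes_outside (- r) r (fun x => kern h (x - y)).
Proof.
move=> h0; exists (`|y| + h); first by rewrite ltr_wpDl.
have y1 := ler_norm y; have y2 : - `|y| <= y by rewrite lerNl -normrN ler_norm.
apply: vanishes_outsideW (kern_shift_out h0); last by rewrite lerD2r.
by rewrite (le_trans _ y2)// lerN2 lerDl ltW.
Qed.

(** Kernels of width at most c issued from s are spent by tau, and those issued from tau before T,
    so both can be slopes of one test function. *)
Lemma time_window (s tau T : R) : s < tau -> tau < T ->
  exists c, [/\ 0 < c, s + c <= tau & tau + c < T].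
Proof.
move=> stau tauT; exists (Num.min ((T - tau) / 2) (tau - s)); split.
- by rewrite lt_min divr_gt0//= ?subr_gt0 ?tauT.
- by rewrite -lerBrDl ge_min lexx orbT.
- rewrite -ltrBrDl gt_min ltr_pdivrMr// ltr_pMr ?subr_gt0// ltr1n.
  by [].
Qed.

End slices.

Section limit_complements.
Context {R : realType}.

Lemma le_cvge (X : topologicalType) (F : set_system X) {FF : ProperFilter F} (g1 g2 : X -> \bar R) (l1 l2 : \bar R) :
  g1 @ F --> l1 -> g2 @ F --> l2 -> (\forall x \near F, (g1 x <= g2 x)%E) -> (l1 <= l2)%E.
Proof.
move=> c1 c2 le.
have <- := cvg_lim (@ereal_hausdorff R) c1; have <- := cvg_lim (@ereal_hausdorff R) c2.
apply: lee_lim => //; [exact: cvgP c1|exact: cvgP c2].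
Qed.

Lemma cvg_seq_eD (A B : nat -> \bar R) (lA lB : \bar R) : lA \is a fin_num ->
  A n @[n --> \oo] --> lA -> B n @[n --> \oo] --> lB ->
  (A n + B n)%E @[n --> \oo] --> (lA + lB)%E.
Proof. by move=> fA cA cB; apply: cvgeD => //; exact: fin_num_adde_defr. Qed.

Lemma cvg_seq_eB (A B : nat -> \bar R) (lA lB : \bar R) : lA \is a fin_num ->
  A n @[n --> \oo] --> lA -> B n @[n --> \oo] --> lB ->
  (A n - B n)%E @[n --> \oo] --> (lA - lB)%E.
Proof. by move=> fA cA cB; apply: cvg_seq_eD => //; exact: cvgeN. Qed.

Lemma cvg_seq_abse (A : nat -> \bar R) (l : \bar R) : A n @[n --> \oo] --> l ->
  `|A n|%E @[n --> \oo] --> `|l|%E.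
Proof. exact: cvg_abse. Qed.

Lemma integral_subsupport d (Y : measurableType d) (mu : {measure set Y -> \bar R})
    (D S : set Y) (F : Y -> \bar R) : D `<=` S -> (forall y, S y -> ~ D y -> F y = 0%E) ->
  (\int[mu]_(y in S) F y = \int[mu]_(y in D) F y)%E.
Proof.
move=> DS F0; rewrite integral_mkcond [RHS]integral_mkcond; apply: eq_integral => y _.
rewrite !patchE; case: ifPn => Sy; case: ifPn => Dy //.
  by rewrite F0//; [move: Sy; rewrite inE|move=> /mem_set; exact/negP].
by move: Sy; rewrite notin_setE => nS; move: Dy; rewrite inE => /DS.
Qed.

Lemma locally_integrable_cst (c : R) : locally_integrable setT (cst c).
Proof.
split => //; first exact: openT.
move=> K _ cK; rewrite /= (integral_cst leb); last exact: compact_measurable.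
by rewrite lte_mul_pinfty//; exact: compact_finite_measure.
Qed.

Lemma locally_integrable_norm (G : R -> R) : locally_integrable setT G ->
  locally_integrable setT (fun x => `|G x|).
Proof.
move=> [mG oT iG]; split => //; first by meas.
by move=> K KT cK; under eq_integral do rewrite normr_id; exact: iG.
Qed.

Lemma locally_integrable_dist2 (v1 v2 : R -> R) (k1 k2 : R) :
  locally_integrable setT v1 -> locally_integrable setT v2 ->
  locally_integrable setT (fun x => `|v1 x - k1| + `|v2 x - k2|).
Proof.
move=> i1 i2.
apply: (@locally_integrableD R setT (fun x => `|v1 x - k1|) (fun x => `|v2 x - k2|));
  apply: locally_integrable_norm.
- exact: (locally_integrableB i1 (locally_integrable_cst k1)).
- exact: (locally_integrableB i2 (locally_integrable_cst k2)).
Qed.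

Lemma locally_integrable_itv (G : R -> R) (x y : R) : locally_integrable setT G ->
  leb.-integrable `[x, y]%classic (EFin \o G).
Proof.
move=> [mG _ iG]; apply/integrableP; split.
  by apply/measurable_EFinP; exact: measurable_funTS.
by apply: iG => //; exact: segment_compact.
Qed.

Lemma kern_lebesgue_cvg (G : R -> R) s : locally_integrable setT G -> lebesgue_pt G s ->
  (\int[leb]_t (kern h (t - s) * G t)%:E)%E @[h --> 0^'+] --> (G s)%:E.
Proof.
move=> lG Gs; have mG : measurable_fun setT G by case: lG.
have [B B0 kB] := @kern_bounded R.
apply: dist_cvge => //; apply: squeeze_cvge0 (lebesgue_pt_mollifies mG Gs); near=> h.
have h0 : 0 < h by near: h; exact: nbhs_right_gt.
have mk := @measurable_kern R h.
rewrite abse_ge0/= mollify_dist//.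
apply: (@integrable_mul_supp _ _ _ leb `[s, s + h]%classic _ _ (B / h)) => //.
- by meas.
- by move=> t; rewrite ger0_norm ?kern_ge0// kB.
- move=> t /= /negP; rewrite in_itv/= negb_and -!ltNge => st.
  by apply: (kern_shift_out h0); case/orP : st; [left|right].
- exact: locally_integrable_itv.
Unshelve. all: by end_near. Qed.

(** At a common Lebesgue point both kernel averages converge to the values as h tends to 0. *)
Lemma ae_kern_le (G1 G2 : R -> R) : locally_integrable setT G1 -> locally_integrable setT G2 ->
  (forall h s, 0 < h -> (\int[leb]_t (kern h (t - s) * G1 t)%:E <=
    \int[leb]_t (kern h (t - s) * G2 t)%:E)%E) ->
  {ae leb, forall s, G1 s <= G2 s}.
Proof.
move=> l1 l2 le12.
apply: (aeS (mu := leb) (P := fun s => lebesgue_pt G1 s /\ lebesgue_pt G2 s)).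
  move=> s [s1 s2]; rewrite -lee_fin.
  apply: (le_cvge (kern_lebesgue_cvg l1 s1) (kern_lebesgue_cvg l2 s2)).
  by near=> h; apply: le12; near: h; exact: nbhs_right_gt.
by apply: (aeI (mu := leb)); exact: lebesgue_differentiation.
Unshelve. all: by end_near. Qed.

Lemma plane_line0 (t : R) : plane [set z : R * R | z.2 = t] = 0%E.
Proof.
have -> : [set z : R * R | z.2 = t] = setT `*` [set t] by apply/seteqP; split => z //= [].
rewrite [LHS](@product_measure1E _ _ _ _ _ leb leb)//.
by rewrite [X in (_ * X)%E]lebesgue_measure_set1 mule0.
Qed.

End limit_complements.

(** * Identification of the values at time 0 *)

Section initial_trace.
Context {R : realType}.
Variables (a T : R) (f u0 w0 : R -> R) (u w : R * R -> R).
Hypothesis T0 : 0 < T.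
Hypothesis cf : continuous f.
Hypothesis mu : measurable_fun setT u.
Hypothesis mw : measurable_fun setT w.
Hypothesis a0 : 0 < a.
Hypothesis ent : entropy_inequality a T f u0 w0 u w.
Hypothesis cu : C0_L1loc T u.
Hypothesis cw : C0_L1loc T w.
Hypothesis lu0 : locally_integrable setT u0.
Hypothesis lw0 : locally_integrable setT w0.

Let mf : measurable_fun setT f.
Proof. exact: continuous_measurable_fun. Qed.

Lemma measurable_kflux d (Y : measurableType d) (v k : Y -> R) : measurable_fun setT v ->
  measurable_fun setT k -> measurable_fun setT (fun y => kflux f (v y) (k y)).
Proof.
move=> mv mk; have msg := @measurable_sg R; rewrite /kflux.
apply: measurable_funM.
  by apply: (measurableT_comp msg); meas.
by meas.
Qed.

Lemma kflux_le (x k : R) : `|kflux f x k| <= `|f x - f k|.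
Proof. by rewrite /kflux normrM normr_sg ler_piMl//; case: eqP. Qed.

Lemma integrable_kflux_box (k r s : R) : 0 < r -> 0 <= s -> s < T ->
  plane.-integrable (box r s) (fun z => (kflux f (u z) k)%:E).
Proof.
move=> r0 s0 sT.
have mkf : measurable_fun setT (fun z => kflux f (u z) k).
  by apply: measurable_kflux => //; exact: measurable_cst.
apply: (@le_integrable _ _ _ _ _ (measurable_box r s) _ (fun z => (`|f (u z)|)%:E + (`|f k|)%:E)%E).
- by apply: measurable_funTS; meas.
- move=> z _; rewrite /= lee_fin [leRHS]ger0_norm ?addr_ge0//.
  by rewrite (le_trans (kflux_le _ _))// ler_normB.
- apply: integrableD => //.
    exact: integrable_norm (integrable_fu_box cf mu a0 ent r0 s0 sT).
  exact: integrable_cst_box.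
Qed.

Lemma integrable_dist_box (k : R * R) (r s : R) : 0 < r -> 0 <= s -> s < T ->
  plane.-integrable (box r s) (fun z => (`|u z - k.1| + `|w z - k.2|)%:E).
Proof.
move=> r0 s0 sT.
apply: (@le_integrable _ _ _ _ _ (measurable_box r s) _
  (fun z => (`|u z| + `|w z|)%:E + (`|k.1| + `|k.2|)%:E)%E).
- by apply: measurable_funTS; meas.
- move=> z _; rewrite /= lee_fin ger0_norm ?addr_ge0// [leRHS]ger0_norm ?addr_ge0 ?addr_ge0//.
  by rewrite addrACA lerD// ler_normB.
- apply: integrableD => //; last exact: integrable_cst_box.
  exact: (integrable_uw_box mu mw a0 ent r0 s0 sT).
Qed.

Let t0T : 0 \in `[0, T[.
Proof. by rewrite in_itv/= lexx T0. Qed.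

(** The time factor of the test drops from 1 to 0 within a vanishing delay after t = 0. Its slope
    concentrates on the slice 0 and yields the left side; the flux term disappears in the limit
    because the time factor tends to 0 off the null line t = 0. *)
Lemma trace_le (k : R * R) (al al' : R -> R) (r : R) : 0 < r ->
  smooth al -> (forall x : R, is_derive x 1 al (al' x)) -> smooth al' ->
  vanishes_outside (- r) r al -> (forall x, 0 <= al x) -> strip_L a k ->
  (\int[leb]_x ((`|u (x, 0) - k.1| + `|w (x, 0) - k.2|) * al x)%:E <=
   \int[leb]_x ((`|u0 x - k.1| + `|w0 x - k.2|) * al x)%:E)%E.
Proof.
move=> r0 sal dal sal' alr al0 ka.
have mal := measurable_smooth sal.
have mal' := measurable_smooth sal'.
pose s := T / 2; have [s0 sT] : 0 < s /\ s < T by move: T0; rewrite /s; split; lra.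
have [C alC] := vanishing_sup_bound (smooth_continuous sal) alr.
have [C' alC'] := vanishing_sup_bound (smooth_continuous sal') (vanishes_outside_derive alr dal).
pose N z := `|u z - k.1| + `|w z - k.2|.
have mN : measurable_fun setT N by rewrite /N; meas.
have cN : slice_right_cont N 0.
  apply: (slice_right_cont_le2 mN mu mw); last 2 first.
  - exact: C0_slice_right_cont cu t0T.
  - exact: C0_slice_right_cont cw t0T.
  move=> x t; rewrite /N opprD addrACA (le_trans (ler_normD _ _))// lerD//.
    by rewrite (le_trans (ler_dist_dist _ _))// opprB addrA subrK.
  by rewrite (le_trans (ler_dist_dist _ _))// opprB addrA subrK.
have lN : locally_integrable setT (fun x => N (x, 0)).
  by apply: locally_integrable_dist2; [case: cu => _ + _|case: cw => _ + _]; apply.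
have iN : plane.-integrable (box r s) (EFin \o N) := integrable_dist_box k r0 (ltW s0) sT.
pose hs n : R := s * harmonic n.
have hs0 n : 0 < hs n by case/andP : (scaled_harmonic_le n s0).
have hss n : hs n <= s by case/andP : (scaled_harmonic_le n s0).
have hsc : hs @ \oo --> 0^'+ := scaled_harmonic_at_right s0.
have s00 : 0 + s <= s by rewrite add0r.
have cAn := kern_slice_seq_cvg s0 (lexx 0) s00 mN mal alC alr iN (locally_integrable_itv _ _ lN) cN.
(* The first step equals 1 from -2 on and only bounds the support from below; hence [be n 0 = 1]
   and, for t >= 0, the slope is - [kern (hs n) t]. *)
pose be n t : R := step 1 (- 3) t - step (hs n) 0 t.
pose be' n t : R := kern 1 (t - (- 3)) - kern (hs n) (t - 0).
pose K z : R := kflux f (u z) k.1 * al' z.1.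
have mK : measurable_fun setT K.
  apply: measurable_funM; last by meas.
  by apply: measurable_kflux => //; exact: measurable_cst.
have iK : plane.-integrable (box r s) (EFin \o K).
  apply: (@le_integrable _ _ _ _ _ (measurable_box r s) _ (fun z => C'%:E * (kflux f (u z) k.1)%:E)%E).
  - by apply: measurable_funTS; meas.
  - move=> z _; rewrite /= lee_fin /K !normrM mulrC ler_wpM2r// (le_trans (alC' _))//.
    exact: ler_norm.
  - by apply: integrableZl => //; exact: integrable_kflux_box (ltW s0) sT.
have mbe n : measurable_fun setT (be n).
  apply: continuous_measurable_fun; apply: smooth_continuous; exact: smooth_plateau.
have cB : (\int[plane]_(z in box r s) (K z * be n z.2)%:E)%E @[n --> \oo] --> 0%E.
  have [|||||_ _] := @dominated_convergence _ _ _ plane _ (measurable_box r s)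
    (fun n z => (K z * be n z.2)%:E) (cst 0%E) (fun z => `|K z|%:E); last by rewrite integral0.
  - by move=> n; have := mbe n; move=> mb; apply: measurable_funTS; meas.
  - exact: measurable_cst.
  - exists [set z | z.2 = 0]; split.
    + have -> : [set z : R * R | z.2 = 0] = setT `*` [set 0] by apply/seteqP; split => z //= [].
      by apply: measurableX => //; exact: measurable_set1.
    + exact: plane_line0.
    + move=> [x t] /= /not_implyP[[/= _]]; rewrite in_itv/= => /andP[t0 ts].
      apply: contra_notP => tn0.
      have {tn0}t0 : 0 < t by rewrite lt_neqAle t0 andbT eq_sym; exact/eqP.
      have ht : \forall n \near \oo, hs n < t := hsc _ (nbhs_right_lt t0).
      apply: cvg_near_cst; apply: filterS ht => n /ltW hnt.
      by rewrite /be !step_r ?subrr ?mulr0 ?add0r//; lra.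
  - exact: integrable_norm.
  - apply: aeW => z n zb; rewrite abse_EFin lee_fin normrM ler_piMr//.
    rewrite ger0_norm; last by apply: step_plateau_ge0 => //; lra.
    by rewrite lerBlDr (le_trans (step_le1 _ _ _))// lerDl step_ge0.
pose J := (\int[leb]_x ((`|u0 x - k.1| + `|w0 x - k.2|) * al x)%:E)%E.
have cBn : (\int[plane]_(z in box r s) (K z * be n z.2)%:E + J)%E @[n --> \oo] --> J.
  rewrite -[X in _ --> X]add0e; apply: cvgeD => //.
  exact: cvg_cst.
apply: (le_cvge cAn cBn); apply: nearW => n /=.
have [] := entropy_tensorP ent (k := k) (be := be n) (be' := be' n) sal
  (smooth_plateau _ _ _ _) dal (is_derive_plateau _ _ _ _) alr
  (plateau_out ltr01 (hs0 n) _ _) al0 _ _ ka.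
- by move: (hs0 n); lra.
- lra.
- by move=> t _; apply: step_plateau_ge0 => //; lra.
- by rewrite add0r (le_lt_trans (hss n)).
set S := slab _; move=> iE.
have -> : (\int[leb]_x ((`|u0 x - k.1| + `|w0 x - k.2|) * (al x * be n 0))%:E = J)%E.
  by apply: eq_integral => x _; rewrite /be step_r ?step_l ?subr0 ?mulr1//; lra.
have iAT : plane.-integrable setT (fun z => (N z * (al z.1 * kern (hs n) (z.2 - 0)))%:E).
  by apply: (integrable_mul_time_kern (hs0 n) (lexx 0) _ mN mal alC alr iN); rewrite add0r.
have iA : plane.-integrable S (fun z => (N z * (al z.1 * kern (hs n) (z.2 - 0)))%:E).
  by apply: (integrableS measurableT) iAT => //; exact: measurable_slab.
have Ez z : S z -> entropy_tensor f u w k al al' (be n) (be' n) z =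
    K z * be n z.2 - N z * (al z.1 * kern (hs n) (z.2 - 0)).
  rewrite /S /slab/= in_itv/= => /andP[z0 zT].
  rewrite /entropy_tensor /be' [kern 1 _](kern_out ltr01); last by right; lra.
  by rewrite /K /N sub0r; ring.
have iB : plane.-integrable S (fun z => (K z * be n z.2)%:E).
  have := integrableD (measurable_slab _) iE iA; apply: eq_integrable; first exact: measurable_slab.
  move=> z; rewrite inE => /Ez zE.
  by rewrite /= -EFinD zE subrK.
have -> : (\int[plane]_(z in S) (entropy_tensor f u w k al al' (be n) (be' n) z)%:E =
   \int[plane]_(z in S) (K z * be n z.2)%:E -
   \int[plane]_(z in S) (N z * (al z.1 * kern (hs n) (z.2 - 0)))%:E)%E.
  rewrite -integralB_EFin//; last exact: measurable_slab.
  by apply: eq_integral => z; rewrite inE => /Ez ->; rewrite EFinB.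
have -> : (\int[plane]_(z in S) (N z * (al z.1 * kern (hs n) (z.2 - 0)))%:E =
  \int[plane]_z (N z * (al z.1 * kern (hs n) (z.2 - 0)))%:E)%E.
  rewrite (@integral_support _ _ _ plane S)// => z; rewrite /S /slab/= in_itv/= => /negP.
  rewrite negb_and -leNgt -ltNge => zT; rewrite (kern_out (hs0 n)) ?mulr0// subr0.
  case/orP : zT => zz; first by left.
  by right; rewrite (le_lt_trans (hss n))// (lt_le_trans sT).
have -> : (\int[plane]_(z in S) (K z * be n z.2)%:E =
  \int[plane]_(z in box r s) (K z * be n z.2)%:E)%E.
  apply: integral_subsupport; first exact: box_slab.
  move=> [x t]; rewrite /S /slab /box/= in_itv/= => /andP[t0 tT] /not_andP.
  rewrite /= !in_itv/= t0/= => -[/negP|/negP]; rewrite ?negb_and -!ltNge => xt.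
    rewrite /K /= (vanishes_outside_derive alr dal) ?mulr0 ?mul0r//.
    by case/orP : xt; [left|right].
  rewrite /be !step_r ?subrr ?mulr0//; first by move: (hss n); lra.
  by move: T0; lra.
set B := (\int[plane]_(z in box r s) _)%E; set A := (\int[plane]_z _)%E.
rewrite -/J addeAC sube_ge0//; apply/orP; left.
exact: integrable_fin_num.
Unshelve. all: by end_near. Qed.

(** By [trace_le], for each admissible constant the slice at 0 is, at almost every x, no farther
    from it than (u0, w0) is. Letting the constant approach (u0 x, w0 x) forces equality. *)
Lemma initial_trace : {ae leb, forall x, `|u0 x - w0 x| <= a} ->
  {ae leb, forall x, u (x, 0) = u0 x /\ w (x, 0) = w0 x}.
Proof.
move=> u0w0.
have lu : locally_integrable setT (fun x => u (x, 0)) by case: cu => _ + _; apply.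
have lw : locally_integrable setT (fun x => w (x, 0)) by case: cw => _ + _; apply.
have step1 (k : R * R) : strip_L a k ->
    {ae leb, forall x, `|u (x, 0) - k.1| + `|w (x, 0) - k.2| <= `|u0 x - k.1| + `|w0 x - k.2|}.
  move=> ka; apply: ae_kern_le; try exact: locally_integrable_dist2.
  move=> h s h0; under eq_integral do rewrite mulrC; under [leRHS]eq_integral do rewrite mulrC.
  have [k' sk' dk'] := smooth_derivative (smooth_kern h s).
  apply: (@trace_le k _ k' (`|s| + h + 1)) => //.
  - by rewrite ltr_wpDl// addr_ge0// ltW.
  - exact: smooth_kern.
  - move=> x xs; apply: (kern_out h0); have := ler_norm s; have := ler_norm (- s).
    by rewrite normrN => h1 h2; case: xs => xs; [left|right]; lra.
  - by move=> x; exact: kern_ge0.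
(* Each constant costs a null set; enumerating the rational pairs keeps their union null. *)
pose P (n : nat) x := if unpickle n is Some pq then
  strip_L a (ratr pq.1, ratr pq.2) ->
  `|u (x, 0) - ratr pq.1| + `|w (x, 0) - ratr pq.2| <= `|u0 x - ratr pq.1| + `|w0 x - ratr pq.2|
  else True.
have : {ae leb, forall x, (forall n, P n x) /\ `|u0 x - w0 x| <= a}.
  apply: (aeI (mu := leb)) => //.
  apply: (ae_foralln (mu := leb)) => n; rewrite /P.
  case: (unpickle n) => [[p q]|]; last exact: aeW.
  have [sp|nsp] := pselect (strip_L a (ratr p, ratr q)).
    by apply: (aeS (mu := leb)) (step1 _ sp) => x /=.
  by apply: aeW => x.
apply: (aeS (mu := leb)) => x [Px xa].
have key e : 0 < e -> e <= a / 2 -> `|u (x, 0) - u0 x| + `|w (x, 0) - w0 x| <= 4 * e.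
  move=> e0 ea.
  (* The approximations must stay in the strip, so both numbers are moved towards each other: the
     larger from below, the smaller from above. Should they cross, their distance is at most 2 e,
     hence at most a. Two triangle inequalities and the trace inequality then add up to 4 e. *)
  have [p [q [pe qe pqa]]] : exists p q : rat, [/\ `|u0 x - ratr p| <= e,
      `|w0 x - ratr q| <= e & `|ratr p - ratr q| <= a :> R].
    have [uw|wu] := leP (w0 x) (u0 x).
      have [|p] := @rat_in_itvoo R (u0 x - e) (u0 x); first by rewrite gtrBl.
      have [|q] := @rat_in_itvoo R (w0 x) (w0 x + e); first by rewrite ltrDl.
      rewrite !in_itv/= => /andP[q1 q2] /andP[p1 p2]; exists p, q.
      move: xa; rewrite !ler_norml => /andP[xa1 xa2].
      by split; apply/andP; split; lra.
    have [|p] := @rat_in_itvoo R (u0 x) (u0 x + e); first by rewrite ltrDl.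
    have [|q] := @rat_in_itvoo R (w0 x - e) (w0 x); first by rewrite gtrBl.
    rewrite !in_itv/= => /andP[q1 q2] /andP[p1 p2]; exists p, q.
    move: xa; rewrite !ler_norml => /andP[xa1 xa2].
    by split; apply/andP; split; lra.
  have := Px (pickle (p, q)); rewrite /P pickleK => /(_ pqa) /= le.
  have h1 : `|u (x, 0) - u0 x| <= `|u (x, 0) - ratr p| + `|u0 x - ratr p|.
    by rewrite [`|u0 x - _|]distrC -{1}(subrKA (ratr p)) ler_normD.
  have h2 : `|w (x, 0) - w0 x| <= `|w (x, 0) - ratr q| + `|w0 x - ratr q|.
    by rewrite [`|w0 x - _|]distrC -{1}(subrKA (ratr q)) ler_normD.
  move: (h1) (h2) (le) (pe) (qe); lra.
have n0 : `|u (x, 0) - u0 x| + `|w (x, 0) - w0 x| <= 0.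
  apply/ler_addgt0Pr => e e0; rewrite add0r.
  have m0 : 0 < Num.min (e / 4) (a / 2) by rewrite lt_min !divr_gt0.
  apply: (le_trans (key _ m0 _)); first by rewrite ge_min lexx orbT.
  by rewrite mulrC -ler_pdivlMr// ge_min lexx.
have [n1 n2] : `|u (x, 0) - u0 x| = 0 /\ `|w (x, 0) - w0 x| = 0.
  have := normr_ge0 (u (x, 0) - u0 x); have := normr_ge0 (w (x, 0) - w0 x).
  by move: n0; split; lra.
by split; apply/eqP; rewrite -subr_eq0 -normr_eq0 ?n1 ?n2.
Qed.

End initial_trace.

(** * Doubling of variables *)

Section convex_flux.
Context {R : realType}.
Variable f : R -> R.
Hypothesis convf : strictly_convex f.
Variable l : R.
Hypothesis df0 : is_derive (0 : R) 1 f l.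

(** The height of the graph above its tangent at 0. Removing the tangent makes a convex function
    nonincreasing before 0 and nondecreasing after it. *)
Let g (b : R) : R := f b - f 0 - l * b.

Lemma kfluxC x k : kflux f x k = kflux f k x.
Proof. by rewrite /kflux -opprB sgrN mulNr -mulrN opprB. Qed.

Let convf0 (s y : R) : 0 <= s <= 1 -> f (s * y) <= s * f y + (1 - s) * f 0.
Proof.
move=> /andP[]; rewrite le_eqVlt => /predU1P[<- _|s0]; first by rewrite !mul0r subr0 mul1r add0r.
rewrite le_eqVlt => /predU1P[->|s1]; first by rewrite !mul1r subrr mul0r addr0.
have [->|y0] := eqVneq y 0; first by rewrite mulr0 -mulrDl addrC subrK mul1r.
by have := @convf y 0 s y0; rewrite mulr0 addr0 s0 s1 => /(_ isT)/ltW.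
Qed.

(** The quotients (f (s y) - f 0) / s are at most f y - f 0 by convexity, and they tend to l y as s
    decreases to 0. *)
Let g_ge0 y : 0 <= g y.
Proof.
have [->|y0] := eqVneq y 0; first by rewrite /g mulr0 subr0 subrr.
have d : (fun s : R => s^-1 *: (f (s *: y + 0) - f 0)) @ 0^' --> (y * l : R).
  have df : derivable f 0 y by apply: diff_derivable; apply/derivable1_diffP; exact: ex_derive.
  have -> : y * l = 'D_y f 0.
    rewrite deriveE; last by apply/derivable1_diffP; exact: ex_derive.
    rewrite diff1E; last by apply/derivable1_diffP; exact: ex_derive.
    by rewrite derive1E derive_val.
  exact: df.
have d' : (fun s : R => s^-1 *: (f (s *: y + 0) - f 0)) @ 0^'+ --> (y * l : R).
  apply: cvg_trans d; apply: cvg_app; apply: within_subset => x /= x0.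
  by rewrite gt_eqF.
rewrite /g subr_ge0 mulrC -(cvg_lim (@Rhausdorff R) d').
apply: limr_le; first exact: cvgP d'.
near=> s; have s0 : 0 < s by near: s; exact: nbhs_right_gt.
have s1 : s <= 1 by near: s; exact: nbhs_right_le.
rewrite addr0 /GRing.scale/= ler_pdivrMl//.
have := @convf0 s y; rewrite (ltW s0) s1 => /(_ isT).
by rewrite mulrBl mul1r mulrBr; lra.
Unshelve. all: by end_near. Qed.

Let g0 : g 0 = 0.
Proof. by rewrite /g mulr0 subr0 subrr. Qed.

Let g_mono s y : 0 <= s <= 1 -> g (s * y) <= g y.
Proof.
move=> s01; have /andP[s0 s1] := s01.
have : g (s * y) <= s * g y.
  by rewrite /g; have := convf0 y s01; lra.
by move/le_trans; apply; rewrite ler_piMl// g_ge0.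
Qed.

(** With the decreasing branch reflected, an increment of this function is the total variation of
    [g] between the two points. *)
Definition flux_var (b : R) : R := Num.sg b * g b.

Let flux_varE b : flux_var b = if 0 <= b then g b else - g b.
Proof.
rewrite /flux_var; case: ltrgt0P => b0.
- by rewrite gtr0_sg// mul1r.
- by rewrite ltr0_sg// mulN1r.
- by rewrite b0 g0 mulr0.
Qed.

Let g_nd b b' : 0 <= b -> b <= b' -> g b <= g b'.
Proof.
move=> b0; rewrite le_eqVlt => /predU1P[->//|bb'].
have b'0 : 0 < b' by exact: le_lt_trans bb'.
rewrite -[b](divfK (lt0r_neq0 b'0)); apply: g_mono.
by rewrite divr_ge0 ?(ltW b'0)//= ler_pdivrMr// mul1r ltW.
Qed.

Let g_ni b b' : b' <= 0 -> b <= b' -> g b' <= g b.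
Proof.
move=> b0; rewrite le_eqVlt => /predU1P[->//|bb'].
have b'0 : b < 0 by exact: lt_le_trans b0.
rewrite -[b'](divfK (ltr0_neq0 b'0)); apply: g_mono.
by rewrite mulr_le0 ?invr_le0 ?(ltW b'0)//= ler_ndivrMr// mul1r ltW.
Qed.

Lemma flux_var_nd b b' : b <= b' -> flux_var b <= flux_var b'.
Proof.
move=> bb'; rewrite !flux_varE; case: ifPn => b0; case: ifPn => b'0.
- exact: g_nd.
- by move: b'0; rewrite (le_trans b0).
- by rewrite (le_trans _ (g_ge0 _))// oppr_le0 g_ge0.
- by rewrite lerN2; apply: g_ni => //; move: b'0; rewrite -ltNge => /ltW.
Qed.

Let g_dist b b' : `|g b - g b'| <= `|flux_var b - flux_var b'|.
Proof.
have subadd : `|g b - g b'| <= `|g b + g b'|.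
  have := g_ge0 b; have := g_ge0 b'; move=> g1 g2.
  by rewrite (ger0_norm (addr_ge0 g2 g1)) ler_norml; apply/andP; split; lra.
rewrite !flux_varE; case: ifPn => b0; case: ifPn => b'0 //.
- by rewrite opprK subadd.
- by rewrite -opprD normrN subadd.
- by rewrite -opprB normrN opprK addrC.
Qed.

Let kflux_split x k : kflux f x k = Num.sg (x - k) * (g x - g k) + l * `|x - k|.
Proof.
rewrite /kflux [`|x - k|]normrEsg /g; ring.
Qed.

(** The point is that the bound does not see x. If x is outside the interval of k and k', the signs
    agree and [g x] cancels. If x is inside, each term is at most the variation of [g] from x to k,
    respectively k', and the two variations add up because [flux_var] is monotone. The linear part
    of f contributes l |x - k|, which is Lipschitz in k. *)
Lemma kflux_dist (x k k' : R) : `|kflux f x k - kflux f x k'| <=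
  `|flux_var k - flux_var k'| + `|l| * `|k - k'|.
Proof.
rewrite !kflux_split.
rewrite (_ : _ - _ = (Num.sg (x - k) * (g x - g k) - Num.sg (x - k') * (g x - g k')) +
   l * (`|x - k| - `|x - k'|)); last by ring.
rewrite (le_trans (ler_normD _ _))// lerD//; last first.
  rewrite normrM ler_wpM2l// (le_trans (ler_dist_dist _ _))//.
  by rewrite (_ : _ - _ = k' - k); [rewrite distrC|ring].
have between (a b c : R) : a <= b -> b <= c ->
    `|flux_var b - flux_var a| + `|flux_var b - flux_var c| <= `|flux_var a - flux_var c|.
  move=> /flux_var_nd ab /flux_var_nd bc.
  rewrite ger0_norm ?subr_ge0// ler0_norm ?subr_le0// ler0_norm ?subr_le0 ?(le_trans ab)//.
  lra.
have sgle y z : `|Num.sg y * z| <= `|z| :> R by rewrite normrM normr_sg ler_piMl//; case: eqP.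
have two a b : `|Num.sg (x - a) * (g x - g a) - Num.sg (x - b) * (g x - g b)| <=
    `|flux_var x - flux_var a| + `|flux_var x - flux_var b|.
  rewrite (le_trans (ler_normB _ _))// lerD//.
    by rewrite (le_trans (sgle _ _))// g_dist.
  by rewrite (le_trans (sgle _ _))// g_dist.
have same (c : R) : `|c * (g x - g k) - c * (g x - g k')| <= `|c| * `|flux_var k - flux_var k'|.
  rewrite -mulrBr normrM ler_wpM2l// (_ : _ - _ = g k' - g k); last by ring.
  by rewrite distrC g_dist.
have [xk|xk] := leP k x; have [xk'|xk'] := leP k' x.
- move: xk xk'; rewrite le_eqVlt => /predU1P[kx|xk].
    by move=> _; rewrite (le_trans (two _ _))// -kx subrr normr0 add0r.
  rewrite le_eqVlt => /predU1P[kx|xk'].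
    by rewrite (le_trans (two _ _))// -kx subrr normr0 addr0 distrC.
  by rewrite !gtr0_sg ?subr_gt0// (le_trans (same _))// normr1 mul1r.
- by rewrite (le_trans (two _ _))// between// ltW.
- by rewrite (le_trans (two _ _))// addrC distrC [leRHS]distrC -[X in X + _]distrC between// ltW.
- by rewrite !ltr0_sg ?subr_lt0// (le_trans (same _))// normrN1 mul1r.
Qed.

End convex_flux.

Section interior_tests.
Context {R : realType}.
Variables (a T : R) (f u0 w0 : R -> R) (u w : R * R -> R).
Hypothesis ent : entropy_inequality a T f u0 w0 u w.

Lemma entropy_tensor_ge0 (k : R * R) (al al' be be' : R -> R) (x1 x2 t1 t2 : R) :
  smooth al -> smooth be ->
  (forall x : R, is_derive x 1 al (al' x)) -> (forall t : R, is_derive t 1 be (be' t)) ->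
  vanishes_outside x1 x2 al -> vanishes_outside t1 t2 be ->
  (forall x, 0 <= al x) -> (forall t, 0 <= be t) -> 0 < t1 -> t2 < T ->
  strip_L a k ->
  (0 <= \int[plane]_z (entropy_tensor f u w k al al' be be' z)%:E)%E.
Proof.
move=> sal sbe dal dbe val vbe al0 be0 t10 t2T ka.
have [_] := entropy_tensorP ent sal sbe dal dbe val vbe al0 (fun t _ => be0 t) t2T ka.
rewrite [X in (_ + X)%E]integral0_eq ?adde0; last first.
  by move=> x _; rewrite vbe ?mulr0//; left.
rewrite -(integral_support plane (D := slab `[0, T[)) => // z /negP.
rewrite /slab in_itv/= negb_and -leNgt -ltNge => zT.
have z12 : z.2 < t1 \/ t2 < z.2.
  by case/orP : zT => zT; [left; exact: lt_trans t10|right; exact: lt_le_trans zT].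
by rewrite /entropy_tensor vbe// (vanishes_outside_derive vbe dbe)// !mulr0 addr0.
Qed.

End interior_tests.

Section kernel_plane.
Context {R : realType}.

Definition kern2 h (P : (R * R) * (R * R)) : R :=
  kern h (P.2.1 - P.1.1) * kern h (P.2.2 - P.1.2).

Lemma integral_kern2 (h : R) (p : R * R) : 0 < h ->
  (\int[plane]_q (kern2 h (p, q))%:E = 1)%E.
Proof.
move=> h0; have mk := @measurable_kern R h; rewrite /kern2/= plane_tonelli1; last 2 first.
- by meas.
- by move=> q; rewrite lee_fin kern2_ge0.
under eq_integral => x _.
  under eq_integral do rewrite /= EFinM.
  rewrite ge0_integralZl_EFin ?kern_ge0//; last 2 first.
  - by move=> t _; rewrite lee_fin kern_ge0.
  - by meas.
  rewrite integral_kernl// mule1.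
  over.
by rewrite integral_kernl.
Qed.

(** Rewrites a single integral as a doubled one, so that it can be compared with the doubled entropy
    inequality under one integral sign. *)
Lemma integral_kern2_fst (h : R) (Psi : R * R -> R) : 0 < h -> measurable_fun setT Psi ->
  plane.-integrable setT (EFin \o Psi) ->
  leb4.-integrable setT (fun P => (kern2 h P * Psi P.1)%:E) /\
  (\int[leb4]_P (kern2 h P * Psi P.1)%:E = \int[plane]_p (Psi p)%:E)%E.
Proof.
move=> h0 mPsi iPsi; have mk := @measurable_kern R h.
have mk2 p : measurable_fun setT (fun q => kern2 h (p, q)) by rewrite /kern2/=; meas.
have k20 P : 0 <= kern2 h P by exact: kern2_ge0.
have i4 : leb4.-integrable setT (fun P => (kern2 h P * Psi P.1)%:E).
  apply/(@integrable12ltyP _ _ _ _ _ plane plane); first by rewrite /kern2; meas.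
  under eq_integral => p _.
    under eq_integral do rewrite /= normrM (ger0_norm (k20 _)) mulrC EFinM.
    rewrite ge0_integralZl_EFin//; last 2 first.
    - by move=> q _; rewrite lee_fin.
    - by apply/measurable_EFinP; exact: mk2.
    rewrite integral_kern2// mule1.
    over.
  by move/integrableP : iPsi => [].
split=> //; rewrite -(@integral12_prod_meas1 _ _ _ _ _ plane plane)//.
apply: eq_integral => p _; rewrite /fubini_F/=.
under eq_integral do rewrite mulrC EFinM.
rewrite integralZl//; first by rewrite integral_kern2// mule1.
apply/integrableP; split; first by apply/measurable_EFinP; exact: mk2.
by under eq_integral do rewrite /= (ger0_norm (k20 _)); rewrite integral_kern2// ltry.
Qed.

Lemma kern2_osc_cvg (g : R * R -> R) : measurable_fun setT g ->
  plane.-integrable setT (EFin \o g) ->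
  (\int[leb4]_P (kern2 (harmonic n) P * `|g P.2 - g P.1|)%:E)%E @[n --> \oo] --> 0%E.
Proof. by move=> mg ig; exact: (kern_L1_cvg2 mg ig). Qed.

End kernel_plane.

Lemma mem_box_succ (R : realType) (r s t1 t2 : R) (z : R * R) : - r <= z.1 -> z.1 <= r ->
  0 < t1 -> t1 <= z.2 -> z.2 <= t2 -> t2 < s -> box (r + 1) s z.
Proof. by rewrite /box/= !in_itv/= => *; split; apply/andP; split; lra. Qed.

Lemma mem_box_kern2 (R : realType) (h r s t1 t2 : R) P : 0 < h -> h <= 1 -> h < s - t2 ->
  kern2 h P != 0 -> - r <= P.1.1 <= r -> 0 < t1 -> t1 <= P.1.2 <= t2 -> box (r + 1) s P.2.
Proof.
move=> h0 h1 hs; rewrite /kern2 mulf_eq0 negb_or => /andP[k1 k2] x t10 t.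
have kpos (y : R) : kern h y != 0 -> 0 <= y <= h.
  move=> ky; apply/andP; split; rewrite leNgt; apply/negP => yh; case/eqP : ky;
    apply: (kern_out h0); first [by left|by right].
move: (kpos _ k1) (kpos _ k2) x t; rewrite /box/= !in_itv/= => {k1 k2 kpos}.
by move=> /andP[? ?] /andP[? ?] /andP[? ?] /andP[? ?]; split; apply/andP; split; lra.
Qed.

Section plateau_limit.
Context {R : realType}.

(** The limit is half-open because each step is still 0 at its starting point: y is excluded and z
    is kept. *)
Lemma plateau_cvg_indic (c y z x : R) : 0 < c -> y <= z -> y + c <= z ->
  (step (c * harmonic n) y x - step (c * harmonic n) z x) @[n --> \oo] --> (\1_`]y, z]%classic x : R).
Proof.
move=> c0 yz ycz; have [xy|yx] := leP x y.
  apply: cvg_near_cst; apply: nearW => n; have /andP[h0 hc] := scaled_harmonic_le n c0.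
  rewrite !step_l ?subrr// ?(le_trans xy)// indicE memNset//= in_itv/= => /andP[].
  by rewrite ltNge xy.
have ny : \forall n \near \oo, c * harmonic n < x - y.
  by apply: (scaled_harmonic_at_right c0 (nbhs_right_lt _)); rewrite subr_gt0.
have [xz|zx] := leP x z.
  apply: cvg_near_cst; apply: filterS ny => n hn; have /andP[h0 hc] := scaled_harmonic_le n c0.
  rewrite step_r//; last by rewrite -lerBrDl ltW.
  by rewrite step_l// subr0 indicE mem_set//= in_itv/= yx.
have nz : \forall n \near \oo, c * harmonic n < x - z.
  by apply: (scaled_harmonic_at_right c0 (nbhs_right_lt _)); rewrite subr_gt0.
apply: cvg_near_cst; apply: filterS2 ny nz => n hn hz.
have /andP[h0 hc] := scaled_harmonic_le n c0.
rewrite !step_r//; [|by rewrite -lerBrDl ltW|by rewrite -lerBrDl ltW].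
by rewrite subrr indicE memNset//= in_itv/= yx leNgt zx.
Qed.

Lemma plateau_dominated (c y z x : R) n : 0 < c -> y <= z -> y + c <= z ->
  0 <= step (c * harmonic n) y x - step (c * harmonic n) z x <= \1_`[y, z + c]%classic x.
Proof.
move=> c0 yz ycz; have /andP[h0 hc] := scaled_harmonic_le n c0.
have yhz : y + c * harmonic n <= z by rewrite (le_trans _ ycz)// lerD2l.
apply/andP; split; first exact: step_plateau_ge0.
rewrite indicE; have [xI|xI] := boolP (x \in _).
  by rewrite lerBlDr (le_trans (step_le1 _ _ _))// lerDl step_ge0.
rewrite (@plateau_out _ _ _ y z)// ?lerD2r//.
move: xI; rewrite notin_setE/= in_itv/= => /negP; rewrite negb_and -!ltNge => /orP[|xz]; first by left.
by right; rewrite (le_lt_trans _ xz)// lerD2l.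
Qed.

(** The map [p] is a coordinate: the time on the plane or the identity on the line, so one statement
    serves cut-offs in t and in x. *)
Lemma plateau_integral_cvg d (X : measurableType d) (mu : {measure set X -> \bar R})
    (p : X -> R) (g : X -> R) (c y z : R) : 0 < c -> y <= z -> y + c <= z ->
  measurable_fun setT p -> measurable_fun setT g ->
  mu.-integrable (p @^-1` `[y, z + c]%classic) (EFin \o g) ->
  (\int[mu]_x (g x * (step (c * harmonic n) y (p x) - step (c * harmonic n) z (p x)))%:E)%E
     @[n --> \oo] --> (\int[mu]_(x in p @^-1` `]y, z]%classic) (g x)%:E)%E.
Proof.
move=> c0 yz ycz mp mg ig.
have mI (i : interval R) : measurable (p @^-1` [set` i]).
  by rewrite -[X in measurable X]setTI; apply: mp => //; exact: measurable_itv.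
have mst h b : measurable_fun setT (fun x => step h b (p x)).
  have ms : measurable_fun setT (step h b).
    exact: measurable_smooth (smooth_stepfun h b).
  exact: (measurableT_comp ms).
rewrite (_ : (\int[mu]_(x in _) _)%E = (\int[mu]_x (g x * \1_`]y, z]%classic (p x))%:E)%E); last first.
  rewrite integral_mkcond; apply: eq_integral => x _; rewrite patchE indicE.
  have -> : (p x \in `]y, z]%classic) = (x \in p @^-1` `]y, z]%classic) by [].
  by case: ifP; rewrite (mulr1, mulr0).
have mi : measurable_fun setT (fun x => \1_`]y, z]%classic (p x) : R).
  apply: (measurableT_comp _ mp); apply: measurable_indic; exact: measurable_itv.
have mi' : measurable_fun setT (fun x => \1_`[y, z + c]%classic (p x) : R).
  apply: (measurableT_comp _ mp); apply: measurable_indic; exact: measurable_itv.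
have [|||||_ _] // := @dominated_convergence _ _ _ mu setT measurableT
  (fun n x => (g x * (step (c * harmonic n) y (p x) - step (c * harmonic n) z (p x)))%:E)
  (fun x => (g x * \1_`]y, z]%classic (p x))%:E) (fun x => `|g x * \1_`[y, z + c]%classic (p x)|%:E).
- move=> n; have m1 := mst (c * harmonic n) y; have m2 := mst (c * harmonic n) z.
  apply/measurable_EFinP; apply: measurable_funM => //; exact: measurable_funB.
- by apply/measurable_EFinP; exact: measurable_funM.
- apply: aeW => x _; apply: cvg_EFin; first exact: nearW.
  by apply: cvgMr; exact: plateau_cvg_indic.
- apply: integrable_norm.
  have := (integrable_mkcond _ (mI `[y, z + c])).1 ig; apply: eq_integrable => // x _.
  rewrite /= patchE indicE.
  have -> : (p x \in `[y, z + c]%classic) = (x \in p @^-1` `[y, z + c]%classic) by [].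
  by case: ifP; rewrite (mulr1, mulr0).
- apply: aeW => x n _; rewrite /= lee_fin !normrM ler_wpM2l//.
  have /andP[p0 p1] := plateau_dominated (p x) n c0 yz ycz.
  by rewrite ger0_norm// (le_trans p1)// ler_norm.
Qed.

End plateau_limit.

(** * Fluxes through vertical lines *)

Section time_integral.
Context {R : realType}.
Variables (q : R * R -> R) (tau : R).
Hypothesis mq : measurable_fun setT q.
Hypothesis iq : forall r, 0 < r -> plane.-integrable (box r tau) (EFin \o q).

Let I : set (measurableTypeR R) := `]0, tau]%classic.

Let mI : measurable I. Proof. exact: measurable_itv. Qed.

Let g (z : R * R) : R := q z * \1_I z.2.

Let m1I : measurable_fun setT (fun z : R * R => \1_I z.2 : R).
Proof. by apply: (measurableT_comp _ measurable_snd); exact: measurable_indic. Qed.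

Let mg : measurable_fun setT g.
Proof. exact: measurable_funM. Qed.

(** The flux through the vertical line at x up to time tau. Where the integral is infinite [fine]
    returns 0, which concerns a null set of x by [ae_integrable_slice]. *)
Definition time_integral (x : R) : R := fine (\int[leb]_(t in `]0%R, tau]) (q (x, t))%:E).

Let gE x : (\int[leb]_(t in I) (q (x, t))%:E = \int[leb]_t (g (x, t))%:E)%E.
Proof.
rewrite integral_mkcond; apply: eq_integral => t _; rewrite patchE /g indicE/=.
by case: ifP; rewrite (mulr1, mulr0).
Qed.

Let integrable_g (A : R -> R) r : 0 < r -> measurable_fun setT A -> has_sup_bound A ->
  vanishes_outside (- r) r A -> plane.-integrable setT (fun z => (A z.1 * g z)%:E).
Proof.
move=> r0 mA bA vA; rewrite /g; under eq_fun do rewrite mulrCA mulrC.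
apply: (@integrable_mul_tensor _ A \1_I q (- r) r 0 tau) => //; last exact: iq.
- exact: has_sup_bound_indic.
- by apply: vanishes_outside_indic => x; rewrite /I/= !in_itv/= => /andP[/ltW -> ->].
Qed.

Let cut r : R -> R := \1_(`[- r, r]%classic).

Let cutP r : measurable_fun setT (cut r) /\ has_sup_bound (cut r) /\ vanishes_outside (- r) r (cut r).
Proof.
split; first by apply: measurable_indic; exact: measurable_itv.
by split; [exact: has_sup_bound_indic|exact: vanishes_outside_indic].
Qed.

Let cut1 r x : - r <= x <= r -> cut r x = 1.
Proof. by move=> xr; rewrite /cut indicE mem_set//= in_itv. Qed.

(** Integrability is known on boxes only, so Fubini is applied to countably many cut-offs in x; at a
    given x any cut-off equal to 1 there gives the claim. *)
Lemma ae_integrable_slice : {ae leb, forall x, leb.-integrable setT (fun t => (g (x, t))%:E)}.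
Proof.
have : {ae leb, forall x, forall n, leb.-integrable setT (fun t => (cut n.+1%:R x * g (x, t))%:E)}.
  apply: (ae_foralln (mu := leb)) => n.
  have [mc [bc vc]] := cutP n.+1%:R.
  have i := integrable_g (ltr0Sn _ n) mc bc vc.
  exact: (@ae_integrable1 _ _ _ _ R leb leb _ i).
apply: (aeS (mu := leb)) => x /(_ (Num.truncn `|x|)).
rewrite cut1; first by under eq_fun do rewrite mul1r.
rewrite -ler_norml; apply: ltW; exact: truncnS_gt.
Qed.

Lemma measurable_time_integral : measurable_fun setT time_integral.
Proof.
apply: (measurableT_comp (@fine_measurable _ setT measurableT)).
under eq_fun do rewrite gE integralE.
have mEg : measurable_fun setT (EFin \o g) by apply/measurable_EFinP.
apply: emeasurable_funB.
  have mp : measurable_fun setT (fun x => \int[leb]_t ((EFin \o g)^\+ (x, t)))%E.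
    apply: (@measurable_integral_snd _ _ _ _ _ leb
      (fun x t => ((EFin \o g)^\+ (x, t))%E)) => //.
    rewrite (_ : (fun p => _) = (EFin \o g)^\+%E); first exact: measurable_funepos.
    by apply/funext => -[].
  by apply: eq_measurable_fun mp => x _; apply: eq_integral => t _; rewrite !funeposE.
have mp : measurable_fun setT (fun x => \int[leb]_t ((EFin \o g)^\- (x, t)))%E.
  apply: (@measurable_integral_snd _ _ _ _ _ leb
    (fun x t => ((EFin \o g)^\- (x, t))%E)) => //.
  rewrite (_ : (fun p => _) = (EFin \o g)^\-%E); first exact: measurable_funeneg.
  by apply/funext => -[].
by apply: eq_measurable_fun mp => x _; apply: eq_integral => t _; rewrite !funenegE.
Qed.

Lemma time_integral_tensor (A : R -> R) (r : R) : 0 < r -> measurable_fun setT A ->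
  has_sup_bound A -> vanishes_outside (- r) r A ->
  leb.-integrable setT (fun x => (A x * time_integral x)%:E) /\
  (\int[plane]_(z in snd @^-1` `]0%R, tau]%classic) (A z.1 * q z)%:E =
   \int[leb]_x (A x * time_integral x)%:E)%E.
Proof.
move=> r0 mA bA vA; have iH := integrable_g r0 mA bA vA.
have -> : (\int[plane]_(z in snd @^-1` `]0%R, tau]%classic) (A z.1 * q z)%:E =
    \int[plane]_z (A z.1 * g z)%:E)%E.
  rewrite integral_mkcond; apply: eq_integral => z _; rewrite patchE /g indicE.
  have -> : (z.2 \in I) = (z \in snd @^-1` I) by [].
  by case: ifP; rewrite ?mulr1 ?mulr0.
have mF := @measurable_fubini_F _ _ _ _ R leb leb _ iH.
have iF := @integrable_fubini_F _ _ _ _ R leb leb _ iH.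
have mt := measurable_time_integral.
have mR : measurable_fun setT (fun x => (A x * time_integral x)%:E) by meas.
have E : ae_eq leb setT (fubini_F leb (fun z => (A z.1 * g z)%:E)) (fun x => (A x * time_integral x)%:E).
  apply: (aeS (mu := leb)) ae_integrable_slice => x ix _.
  rewrite /fubini_F/=; under eq_integral do rewrite EFinM.
  rewrite integralZl// EFinM; congr (_ * _)%E.
  by rewrite /time_integral gE fineK//; exact: integrable_fin_num.
split.
  apply/integrableP; split=> //; move/integrableP : iF => [_]; apply: le_lt_trans.
  rewrite le_eqVlt; apply/orP; left; apply/eqP; apply: ae_eq_integral => //.
  - exact: measurableT_comp.
  - exact: measurableT_comp.
  - by apply: (aeS (mu := leb)) E => x Ex _; congr abse; apply: esym; exact: Ex.
rewrite (plane_fubini1 iH); exact: ae_eq_integral.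
Qed.

Lemma locally_integrable_time_integral : locally_integrable setT time_integral.
Proof.
split; [exact: measurable_time_integral|exact: openT|].
move=> K _ cK; have [M [_ KM]] := compact_bounded cK.
pose r := Num.max 1 (M + 1).
have r0 : 0 < r by rewrite lt_max ltr01.
have Kr x : K x -> - r <= x <= r.
  by move=> Kx; rewrite -ler_norml; apply: KM => //; rewrite lt_max ltrDl ltr01 orbT.
have [mc [bc vc]] := cutP r.
have [/integrableP[mct fct] _] := time_integral_tensor r0 mc bc vc.
apply: le_lt_trans fct.
have mt := measurable_time_integral.
have mK : measurable K by exact: compact_measurable.
rewrite integral_mkcond; apply: ge0_integral_le.
- by apply/(measurable_restrictT _ mK); apply: measurable_funTS; meas.
- exact: measurableT_comp.
- by move=> x; rewrite patchE; case: ifP.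
- move=> x; rewrite patchE; case: ifPn => [|_]; last exact: abse_ge0.
  by rewrite inE => /Kr xr; rewrite /= cut1// mul1r.
Qed.

End time_integral.

(** * Kato's inequality and its form on rectangles *)

Section kruzkov.
Context {R : realType}.
Variables (a T : R) (f u01 w01 u02 w02 : R -> R) (u1 w1 u2 w2 : R * R -> R).
Hypothesis cf : continuous f.
Hypothesis convf : strictly_convex f.
Variable l : R.
Hypothesis df0 : is_derive (0 : R) 1 f l.
Hypothesis mu1 : measurable_fun setT u1.
Hypothesis mw1 : measurable_fun setT w1.
Hypothesis mu2 : measurable_fun setT u2.
Hypothesis mw2 : measurable_fun setT w2.
Hypothesis a0 : 0 < a.
Hypothesis ent1 : entropy_inequality a T f u01 w01 u1 w1.
Hypothesis ent2 : entropy_inequality a T f u02 w02 u2 w2.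
Hypothesis strip1 : {ae plane, forall z, `|u1 z - w1 z| <= a}.
Hypothesis strip2 : {ae plane, forall z, `|u2 z - w2 z| <= a}.
Hypothesis cu1 : C0_L1loc T u1.
Hypothesis cw1 : C0_L1loc T w1.
Hypothesis cu2 : C0_L1loc T u2.
Hypothesis cw2 : C0_L1loc T w2.

Let mf : measurable_fun setT f.
Proof. exact: continuous_measurable_fun. Qed.

Definition eta (z : R * R) : R := `|u1 z - u2 z| + `|w1 z - w2 z|.
Definition qflux (z : R * R) : R := kflux f (u1 z) (u2 z).

Lemma integrable_eta_box r s : 0 < r -> 0 <= s -> s < T ->
  plane.-integrable (box r s) (fun z => (eta z)%:E).
Proof.
move=> r0 s0 sT.
have i1 := integrable_uw_box mu1 mw1 a0 ent1 r0 s0 sT.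
have i2 := integrable_uw_box mu2 mw2 a0 ent2 r0 s0 sT.
apply: le_integrable (integrableD (measurable_box r s) i1 i2) => //.
  by apply: measurable_funTS; rewrite /eta; meas.
move=> z _; rewrite /= lee_fin /eta ger0_norm ?addr_ge0// [leRHS]ger0_norm ?addr_ge0 ?addr_ge0//.
by rewrite addrACA lerD// ler_normB.
Qed.

Lemma integrable_qflux_box r s : 0 < r -> 0 <= s -> s < T ->
  plane.-integrable (box r s) (fun z => (qflux z)%:E).
Proof.
move=> r0 s0 sT.
have i1 := integrable_norm (integrable_fu_box cf mu1 a0 ent1 r0 s0 sT).
have i2 := integrable_norm (integrable_fu_box cf mu2 a0 ent2 r0 s0 sT).
apply: le_integrable (integrableD (measurable_box r s) i1 i2) => //.
  by apply: measurable_funTS; apply/measurable_EFinP; exact: measurable_kflux.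
move=> z _; rewrite /= lee_fin [leRHS]ger0_norm ?addr_ge0//.
by rewrite /qflux (le_trans (kflux_le _ _ _))// ler_normB.
Qed.

Let meta : measurable_fun setT eta.
Proof. by rewrite /eta; meas. Qed.

Let mq : measurable_fun setT qflux.
Proof. exact: measurable_kflux. Qed.

Definition uw_dist (P : (R * R) * (R * R)) : R := `|u1 P.1 - u2 P.2| + `|w1 P.1 - w2 P.2|.
Definition uu_flux (P : (R * R) * (R * R)) : R := kflux f (u1 P.1) (u2 P.2).

Let muw : measurable_fun setT uw_dist.
Proof. by rewrite /uw_dist; meas. Qed.

Let muu : measurable_fun setT uu_flux.
Proof. by rewrite /uu_flux; apply: measurable_kflux => //; meas. Qed.

Let doubled_integrable (r' s' : R) (H : (R * R) * (R * R) -> R) : 0 < r' -> 0 <= s' -> s' < T ->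
  measurable_fun setT H -> has_sup_bound H ->
  (forall P, ~ (box r' s' P.1 /\ box r' s' P.2) -> H P = 0) ->
  leb4.-integrable setT (fun P => (H P * uw_dist P)%:E) /\
  leb4.-integrable setT (fun P => (H P * uu_flux P)%:E).
Proof.
move=> r'0 s'0 s'T mH [C HC] H0; split.
  apply: (@integrable_doubled _ _ _ _ _ plane plane (box r' s') (box r' s')
    (fun z => `|u1 z| + `|w1 z|) (fun z => `|u2 z| + `|w2 z|) H uw_dist C) => //.
  - exact: integrable_cst_box.
  - exact: integrable_cst_box.
  - exact: (integrable_uw_box mu1 mw1 a0 ent1 r'0 s'0 s'T).
  - exact: (integrable_uw_box mu2 mw2 a0 ent2 r'0 s'0 s'T).
  - by move=> P; rewrite ger0_norm ?addr_ge0// addrACA lerD// ler_normB.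
apply: (@integrable_doubled _ _ _ _ _ plane plane (box r' s') (box r' s')
    (fun z => `|f (u1 z)|) (fun z => `|f (u2 z)|) H uu_flux C) => //.
- exact: integrable_cst_box.
- exact: integrable_cst_box.
- exact: integrable_norm (integrable_fu_box cf mu1 a0 ent1 r'0 s'0 s'T).
- exact: integrable_norm (integrable_fu_box cf mu2 a0 ent2 r'0 s'0 s'T).
- by move=> P; rewrite (le_trans (kflux_le _ _ _))// ler_normB.
Qed.

Section doubling.
Variables (al al' be be' : R -> R) (r t1 t2 : R).
Hypothesis r0 : 0 < r.
Hypothesis t10 : 0 < t1.
Hypothesis t12 : t1 <= t2.
Hypothesis t2T : t2 < T.
Hypothesis sal : smooth al.
Hypothesis sbe : smooth be.
Hypothesis sal' : smooth al'.
Hypothesis sbe' : smooth be'.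
Hypothesis dal : forall x : R, is_derive x 1 al (al' x).
Hypothesis dbe : forall t : R, is_derive t 1 be (be' t).
Hypothesis val : vanishes_outside (- r) r al.
Hypothesis vbe : vanishes_outside t1 t2 be.
Hypothesis al0 : forall x, 0 <= al x.
Hypothesis be0 : forall t, 0 <= be t.

Let val' : vanishes_outside (- r) r al'.
Proof. exact: vanishes_outside_derive val dal. Qed.

Let vbe' : vanishes_outside t1 t2 be'.
Proof. exact: vanishes_outside_derive vbe dbe. Qed.

(** The test function is al(x) be(t) [kern h (y - x)] [kern h (s - t)], with (x, t) = P.1 and (y, s)
    = P.2. In the sum of the two entropy inequalities the kernel is hit by d/dx + d/dy and d/dt +
    d/ds, both of which annihilate it. *)
Lemma doubled_entropy h : 0 < h -> h <= 1 -> t2 + h < T ->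
  (0 <= \int[leb4]_P (kern2 h P * (al P.1.1 * be' P.1.2 * uw_dist P +
     al' P.1.1 * be P.1.2 * uu_flux P))%:E)%E.
Proof.
move=> h0 h1 t2h.
have [k' sk' dk0'] := smooth_derivative (smooth_kern h (0:R)).
have dk (x : R) : is_derive x 1 (@kern R h) (k' x).
  have -> : kern h = fun x : R => kern h (x - 0) by apply/funext => y; rewrite subr0.
  exact: dk0'.
have ck := smooth_continuous sk'.
have dkl (c x : R) : is_derive x 1 (fun x => kern h (x - c)) (k' (x - c)).
  have d : is_derive x (1 : R) (fun x : R => x - c) 1.
    have h2 := is_deriveB (is_derive_id x (1 : R)) (is_derive_cst c x (1 : R)).
    by apply: (is_derive_eq h2); rewrite subr0.
  by apply: (is_derive_eq (is_derive1_comp (dk _) d)); rewrite mulr1.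
have dkr (c x : R) : is_derive x 1 (fun x => kern h (c - x)) (- k' (c - x)).
  have d : is_derive x (1 : R) (fun x : R => c - x) (-1).
    have h2 := is_deriveB (is_derive_cst c x (1 : R)) (is_derive_id x (1 : R)).
    by apply: (is_derive_eq h2); rewrite sub0r.
  by apply: (is_derive_eq (is_derive1_comp (dk _) d)); rewrite mulrN1.
have skr c : smooth (fun x => kern h (c - x)).
  have -> : (fun x => kern h (c - x)) = (fun x => kern h (((-1) * x + c) - 0)).
    by apply/funext => x; congr kern; ring.
  exact: (smooth_affine (-1) c (smooth_kern h (0 : R))).
have mk := @measurable_kern R h.
have mk' : measurable_fun setT k' by exact: continuous_measurable_fun.
have mal := measurable_smooth sal.
have mbe := measurable_smooth sbe.
have mal' := measurable_smooth sal'.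
have mbe' := measurable_smooth sbe'.
have vk := kern_out h0.
have vk' := vanishes_outside_derive vk dk.
have bk := vanishing_sup_bound (@continuous_kern R h) vk.
have bk' := vanishing_sup_bound ck vk'.
have bal := vanishing_sup_bound (smooth_continuous sal) val.
have bal' := vanishing_sup_bound (smooth_continuous sal') val'.
have bbe := vanishing_sup_bound (smooth_continuous sbe) vbe.
have bbe' := vanishing_sup_bound (smooth_continuous sbe') vbe'.
(* [A1] and [B1] are the space and time factors of the doubled test. The primed versions of index 1
   are derivatives in P.1, those of index 2 in P.2; [k'] enters them with opposite signs. *)
pose A1 (P : (R * R) * (R * R)) := al P.1.1 * kern h (P.2.1 - P.1.1).
pose A1' (P : (R * R) * (R * R)) := al' P.1.1 * kern h (P.2.1 - P.1.1) -
  al P.1.1 * k' (P.2.1 - P.1.1).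
pose B1 (P : (R * R) * (R * R)) := be P.1.2 * kern h (P.2.2 - P.1.2).
pose B1' (P : (R * R) * (R * R)) := be' P.1.2 * kern h (P.2.2 - P.1.2) -
  be P.1.2 * k' (P.2.2 - P.1.2).
pose A2' (P : (R * R) * (R * R)) := al P.1.1 * k' (P.2.1 - P.1.1).
pose B2' (P : (R * R) * (R * R)) := be P.1.2 * k' (P.2.2 - P.1.2).
have inA (g g' : R -> R) (P : (R * R) * (R * R)) : vanishes_outside (- r) r g -> vanishes_outside 0 h g' ->
    ~ (- (r + 1) <= P.1.1 <= r + 1 /\ - (r + 1) <= P.2.1 <= r + 1) ->
    g P.1.1 * g' (P.2.1 - P.1.1) = 0.
  move=> gr gh nP; apply/eqP; rewrite mulf_eq0; apply/orP.
  have [x1|x1] := ltP P.1.1 (- r); first by left; rewrite gr//; left.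
  have [x2|x2] := ltP r P.1.1; first by left; rewrite gr//; right.
  have [x3|x3] := ltP (P.2.1 - P.1.1) 0; first by right; rewrite gh//; left.
  have [x4|x4] := ltP h (P.2.1 - P.1.1); first by right; rewrite gh//; right.
  by exfalso; apply: nP; split; apply/andP; split; lra.
have inB (g g' : R -> R) (P : (R * R) * (R * R)) : vanishes_outside t1 t2 g -> vanishes_outside 0 h g' ->
    ~ (0 <= P.1.2 <= t2 + h /\ 0 <= P.2.2 <= t2 + h) ->
    g P.1.2 * g' (P.2.2 - P.1.2) = 0.
  move=> gr gh nP; apply/eqP; rewrite mulf_eq0; apply/orP.
  have [x1|x1] := ltP P.1.2 t1; first by left; rewrite gr//; left.
  have [x2|x2] := ltP t2 P.1.2; first by left; rewrite gr//; right.
  have [x3|x3] := ltP (P.2.2 - P.1.2) 0; first by right; rewrite gh//; left.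
  have [x4|x4] := ltP h (P.2.2 - P.1.2); first by right; rewrite gh//; right.
  by exfalso; apply: nP; move: t10 => t1p; split; apply/andP; split; lra.
have inAB (A B : (R * R) * (R * R) -> R) :
    (forall P, ~ (- (r + 1) <= P.1.1 <= r + 1 /\ - (r + 1) <= P.2.1 <= r + 1) -> A P = 0) ->
    (forall P, ~ (0 <= P.1.2 <= t2 + h /\ 0 <= P.2.2 <= t2 + h) -> B P = 0) ->
    forall P, ~ (box (r + 1) (t2 + h) P.1 /\ box (r + 1) (t2 + h) P.2) -> A P * B P = 0.
  move=> nA nB P nP.
  have [h2|/nA->] := pselect (- (r + 1) <= P.1.1 <= r + 1 /\ - (r + 1) <= P.2.1 <= r + 1);
    last by rewrite mul0r.
  have [h3|/nB->] := pselect (0 <= P.1.2 <= t2 + h /\ 0 <= P.2.2 <= t2 + h);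
    last by rewrite mulr0.
  by exfalso; apply: nP; rewrite /box/= !in_itv/=; tauto.
have r10 : 0 < r + 1 by rewrite addr_gt0.
have t2h0 : 0 <= t2 + h by move: t10 t12; lra.
have mA1 : measurable_fun setT A1 by rewrite /A1; meas.
have mA1' : measurable_fun setT A1' by rewrite /A1'; meas.
have mA2' : measurable_fun setT A2' by rewrite /A2'; meas.
have mB1 : measurable_fun setT B1 by rewrite /B1; meas.
have mB1' : measurable_fun setT B1' by rewrite /B1'; meas.
have mB2' : measurable_fun setT B2' by rewrite /B2'; meas.
have comp1 (X Y : Type) (g : X -> R) (q : Y -> X) : has_sup_bound g -> has_sup_bound (fun y => g (q y)).
  exact: has_sup_bound_comp.
have bA1 : has_sup_bound A1 by apply: has_sup_boundM; apply: comp1.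
have bB1 : has_sup_bound B1 by apply: has_sup_boundM; apply: comp1.
have bA2' : has_sup_bound A2' by apply: has_sup_boundM; apply: comp1.
have bB2' : has_sup_bound B2' by apply: has_sup_boundM; apply: comp1.
have bA1' : has_sup_bound A1' by apply: has_sup_boundB => //; apply: has_sup_boundM; apply: comp1.
have bB1' : has_sup_bound B1' by apply: has_sup_boundB => //; apply: has_sup_boundM; apply: comp1.
have zA1 P : ~ (- (r + 1) <= P.1.1 <= r + 1 /\ - (r + 1) <= P.2.1 <= r + 1) -> A1 P = 0.
  exact: inA.
have zA2' P : ~ (- (r + 1) <= P.1.1 <= r + 1 /\ - (r + 1) <= P.2.1 <= r + 1) -> A2' P = 0.
  exact: inA.
have zA1' P : ~ (- (r + 1) <= P.1.1 <= r + 1 /\ - (r + 1) <= P.2.1 <= r + 1) -> A1' P = 0.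
  by move=> nP; rewrite /A1' !inA// subrr.
have zB1 P : ~ (0 <= P.1.2 <= t2 + h /\ 0 <= P.2.2 <= t2 + h) -> B1 P = 0.
  exact: inB.
have zB2' P : ~ (0 <= P.1.2 <= t2 + h /\ 0 <= P.2.2 <= t2 + h) -> B2' P = 0.
  exact: inB.
have zB1' P : ~ (0 <= P.1.2 <= t2 + h /\ 0 <= P.2.2 <= t2 + h) -> B1' P = 0.
  by move=> nP; rewrite /B1' !inB// subrr.
have int (A B : (R * R) * (R * R) -> R) : measurable_fun setT A -> measurable_fun setT B ->
    has_sup_bound A -> has_sup_bound B ->
    (forall P, ~ (- (r + 1) <= P.1.1 <= r + 1 /\ - (r + 1) <= P.2.1 <= r + 1) -> A P = 0) ->
    (forall P, ~ (0 <= P.1.2 <= t2 + h /\ 0 <= P.2.2 <= t2 + h) -> B P = 0) ->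
    leb4.-integrable setT (fun P => (A P * B P * uw_dist P)%:E) /\
    leb4.-integrable setT (fun P => (A P * B P * uu_flux P)%:E).
  move=> mA mB bA bB zA zB; apply: (doubled_integrable r10 t2h0 t2h).
  - by meas.
  - exact: has_sup_boundM.
  - exact: inAB.
have [i1 _] := int _ _ mA1 mB1' bA1 bB1' zA1 zB1'.
have [_ i2] := int _ _ mA1' mB1 bA1' bB1 zA1' zB1.
have [i3 _] := int _ _ mA1 mB2' bA1 bB2' zA1 zB2'.
have [_ i4] := int _ _ mA2' mB1 bA2' bB1 zA2' zB1.
have i12 := integrableD measurableT i1 i2.
have i34 := integrableD measurableT i3 i4.
have E1 : (0 <= \int[leb4]_P ((A1 P * B1' P * uw_dist P)%:E + (A1' P * B1 P * uu_flux P)%:E))%E.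
  apply: (prod_integral_ge0_fst (m1 := plane) (m2 := plane)) => //.
  apply: (aeS (mu := plane)) strip2 => q kq.
  have -> : (\int[plane]_x ((A1 (x, q) * B1' (x, q) * uw_dist (x, q))%:E +
      (A1' (x, q) * B1 (x, q) * uu_flux (x, q))%:E) =
    \int[plane]_z (entropy_tensor f u1 w1 (u2 q, w2 q)
      (fun x => al x * kern h (q.1 - x)) (fun x => al' x * kern h (q.1 - x) - al x * k' (q.1 - x))
      (fun t => be t * kern h (q.2 - t)) (fun t => be' t * kern h (q.2 - t) - be t * k' (q.2 - t))
      z)%:E)%E.
    apply: eq_integral => p _; rewrite -EFinD; congr EFin; rewrite /entropy_tensor.
    by congr (_ + _); exact: mulrC.
  apply: (entropy_tensor_ge0 ent1 (x1 := - r) (x2 := r) (t1 := t1) (t2 := t2)) => //.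
  - exact: smoothM.
  - exact: smoothM.
  - move=> x; apply: (is_derive_eq (is_deriveM (dal x) (dkr q.1 x))).
    by rewrite /GRing.scale/= mulrN addrC [_ * al' x]mulrC.
  - move=> x; apply: (is_derive_eq (is_deriveM (dbe x) (dkr q.2 x))).
    by rewrite /GRing.scale/= mulrN addrC [_ * be' x]mulrC.
  - by move=> x xr; rewrite val ?mul0r.
  - by move=> x xr; rewrite vbe ?mul0r.
  - by move=> x; rewrite mulr_ge0 ?kern_ge0.
  - by move=> x; rewrite mulr_ge0 ?kern_ge0.
have E2 : (0 <= \int[leb4]_P ((A1 P * B2' P * uw_dist P)%:E + (A2' P * B1 P * uu_flux P)%:E))%E.
  apply: (prod_integral_ge0_snd (m1 := plane) (m2 := plane)) => //.
  apply: (aeS (mu := plane)) strip1 => p kp.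
  (* Off [t1, t2] the factor [be p.2] is 0. On it, the test in the second point lives in
     [p.2, p.2 + h], hence in [t1, t2 + h], which the hypothesis on h keeps below T. *)
  have [pt|npt] := boolP (t1 <= p.2 <= t2); last first.
    rewrite integral0_eq// => q _; rewrite /B2' /B1 /= vbe ?mul0r ?mulr0 ?mul0r ?adde0//.
    by apply/orP; rewrite !ltNge -negb_and.
  have /andP[pt1 pt2] := pt.
  have -> : (\int[plane]_y ((A1 (p, y) * B2' (p, y) * uw_dist (p, y))%:E +
      (A2' (p, y) * B1 (p, y) * uu_flux (p, y))%:E) =
    \int[plane]_z (entropy_tensor f u2 w2 (u1 p, w1 p)
      (fun y => al p.1 * kern h (y - p.1)) (fun y => al p.1 * k' (y - p.1))
      (fun s => be p.2 * kern h (s - p.2)) (fun s => be p.2 * k' (s - p.2))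
      z)%:E)%E.
    apply: eq_integral => q _; rewrite -EFinD; congr EFin; rewrite /entropy_tensor.
    congr (_ + _); rewrite mulrC; congr (_ * _); last exact: kfluxC.
    by rewrite /uw_dist/= distrC [`|w1 _ - _|]distrC.
  apply: (entropy_tensor_ge0 ent2 (x1 := p.1) (x2 := p.1 + h) (t1 := t1) (t2 := t2 + h)) => //.
  - by apply: smoothM; [exact: smooth_cst|exact: smooth_kern].
  - by apply: smoothM; [exact: smooth_cst|exact: smooth_kern].
  - move=> x xp; rewrite vk ?mulr0// subr_lt0 ltrBrDl.
    by case: xp; [left|right].
  - move=> x xp; rewrite vk ?mulr0// subr_lt0 ltrBrDl.
    case: xp => xp; [left; exact: lt_le_trans pt1|right; apply: le_lt_trans xp].
    by rewrite lerD2r.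
  - by move=> x; rewrite mulr_ge0 ?kern_ge0.
  - by move=> x; rewrite mulr_ge0 ?kern_ge0.
(* In the sums [A1' + A2'] and [B1' + B2'] the terms with [k'] cancel and only derivatives of [al]
   and [be] remain. *)
have := adde_ge0 E1 E2; rewrite -(integralD _ i12 i34)//.
move=> /le_trans; apply; rewrite le_eqVlt; apply/orP; left; apply/eqP.
apply: eq_integral => P _.
rewrite -!EFinD; congr EFin; rewrite /kern2 /A1 /A1' /A2' /B1 /B1' /B2'; ring.
Qed.

End doubling.

(** The doubled integrand is compared with the kernel times the diagonal integrand at P.1. Solution
    1 sits at P.1 in both, so the error involves only the oscillations of [u2], [w2] and
    [flux_var f l u2], which vanish in L^1 as the kernel shrinks. *)
Lemma kato (al al' be be' : R -> R) (r t1 t2 : R) :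
  0 < r -> 0 < t1 -> t1 <= t2 -> t2 < T ->
  smooth al -> smooth be -> smooth al' -> smooth be' ->
  (forall x : R, is_derive x 1 al (al' x)) -> (forall t : R, is_derive t 1 be (be' t)) ->
  vanishes_outside (- r) r al -> vanishes_outside t1 t2 be ->
  (forall x, 0 <= al x) -> (forall t, 0 <= be t) ->
  (0 <= \int[plane]_z (al z.1 * be' z.2 * eta z + al' z.1 * be z.2 * qflux z)%:E)%E.
Proof.
move=> r0 t10 t12 t2T sal sbe sal' sbe' dal dbe val vbe al0 be0.
have val' := vanishes_outside_derive val dal.
have vbe' := vanishes_outside_derive vbe dbe.
have mal := measurable_smooth sal.
have mbe := measurable_smooth sbe.
have mal' := measurable_smooth sal'.
have mbe' := measurable_smooth sbe'.
have bal := vanishing_sup_bound (smooth_continuous sal) val.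
have bal' := vanishing_sup_bound (smooth_continuous sal') val'.
have bbe := vanishing_sup_bound (smooth_continuous sbe) vbe.
have bbe' := vanishing_sup_bound (smooth_continuous sbe') vbe'.
have [C1 C1b] : has_sup_bound (fun z : R * R => al z.1 * be' z.2).
  by apply: has_sup_boundM; exact: has_sup_bound_comp.
have [C2 C2b] : has_sup_bound (fun z : R * R => al' z.1 * be z.2).
  by apply: has_sup_boundM; exact: has_sup_bound_comp.
(* The box with half-width r + 1 and height s' contains both points once h <= 1 and h < s' - t2. *)
pose s' := (t2 + T) / 2.
have [s'0 s't s'T] : [/\ 0 <= s', t2 < s' & s' < T] by rewrite /s'; split; lra.
have r10 : 0 < r + 1 by rewrite addr_gt0.
pose D := box (r + 1) s'.
have mD : measurable D by exact: measurable_box.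
have iuw := integrable_uw_box mu2 mw2 a0 ent2 r10 s'0 s'T.
have ifu := integrable_fu_box cf mu2 a0 ent2 r10 s'0 s'T.
have cut (g : R * R -> R) : measurable_fun setT g -> plane.-integrable D (EFin \o g) ->
    measurable_fun setT (fun z => g z * \1_D z) /\
    plane.-integrable setT (EFin \o (fun z => g z * \1_D z)).
  move=> mg ig; have mI : measurable_fun setT (\1_D : R * R -> R) by exact: measurable_indic.
  split; first by meas.
  have := (integrable_mkcond _ mD).1 ig; apply: eq_integrable => // z _.
  by rewrite /= patchE indicE; case: ifP; rewrite (mulr1, mulr0).
have mF : measurable_fun setT (flux_var f l).
  by apply: nondecreasing_measurable => // x y xy; exact: flux_var_nd.
have C10 : 0 <= C1 by exact: le_trans (C1b (0, 0)).
have C20 : 0 <= C2 by exact: le_trans (C2b (0, 0)).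
have iu : plane.-integrable D (fun z => (`|u2 z|)%:E).
  apply: le_integrable iuw => //; first by apply: measurable_funTS; meas.
  by move=> z _; rewrite /= lee_fin normr_id [leRHS]ger0_norm ?addr_ge0// lerDl.
have iw : plane.-integrable D (fun z => (`|w2 z|)%:E).
  apply: le_integrable iuw => //; first by apply: measurable_funTS; meas.
  by move=> z _; rewrite /= lee_fin normr_id [leRHS]ger0_norm ?addr_ge0// lerDr.
have scale (c : R) (g G : R * R -> R) : measurable_fun setT g -> plane.-integrable D (EFin \o G) ->
    (forall z, `|g z| <= G z) -> plane.-integrable D (fun z => (c * g z)%:E).
  move=> mg iG gG.
  have : plane.-integrable D (EFin \o g).
    apply: le_integrable iG => //; first by apply: measurable_funTS; meas.
    by move=> z _; rewrite /= lee_fin (le_trans (gG z))// ler_norm.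
  by move/(integrableZl mD c); under eq_fun do rewrite -EFinM.
(* [C1] and [C2] bound the two test factors. The oscillation of [u2] is counted through [uw_dist]
   with weight [C1] and through the linear part of the flux with weight [|l| * C2]. The cut to [D]
   makes the three functions integrable on the plane. *)
pose G1 z := (C1 + `|l| * C2) * u2 z * \1_D z.
pose G2 z := C1 * w2 z * \1_D z.
pose G3 z := C2 * flux_var f l (u2 z) * \1_D z.
have [mG1 iG1] : measurable_fun setT G1 /\ plane.-integrable setT (EFin \o G1).
  by apply: (@cut (fun z => (C1 + `|l| * C2) * u2 z)); [meas|exact: (scale _ _ _ _ iu)].
have [mG2 iG2] : measurable_fun setT G2 /\ plane.-integrable setT (EFin \o G2).
  by apply: (@cut (fun z => C1 * w2 z)); [meas|exact: (scale _ _ _ _ iw)].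
have [mG3 iG3] : measurable_fun setT G3 /\ plane.-integrable setT (EFin \o G3).
  apply: (@cut (fun z => C2 * flux_var f l (u2 z))); first by meas.
  apply: (scale _ _ (fun z => `|f (u2 z)| + `|f 0| + `|l| * `|u2 z|)); first by meas.
    have ic := integrable_cst_box (r + 1) s' `|f 0|.
    have := integrableD mD (integrableD mD (integrable_norm ifu) ic) (integrableZl mD `|l| iu).
    by under eq_fun do rewrite /= -EFinM -!EFinD.
  move=> z; rewrite /flux_var normrM normr_sg.
  apply: (@le_trans _ _ `|f (u2 z) - f 0 - l * u2 z|); first by rewrite ler_piMl//; case: eqP.
  by rewrite (le_trans (ler_normB _ _))// normrM lerD2r ler_normB.
pose Psi z := al z.1 * be' z.2 * eta z + al' z.1 * be z.2 * qflux z.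
have mPsi : measurable_fun setT Psi by rewrite /Psi; meas.
have supp z : (al z.1 * be' z.2 = 0 /\ al' z.1 * be z.2 = 0) \/
    (- r <= z.1 <= r /\ t1 <= z.2 <= t2).
  have [x1|x1] := ltP z.1 (- r); first by left; rewrite val ?val' ?mul0r//; left.
  have [x2|x2] := ltP r z.1; first by left; rewrite val ?val' ?mul0r//; right.
  have [x3|x3] := ltP z.2 t1; first by left; rewrite vbe ?vbe' ?mulr0//; left.
  have [x4|x4] := ltP t2 z.2; first by left; rewrite vbe ?vbe' ?mulr0//; right.
  by right.
have suppD z : - r <= z.1 <= r -> t1 <= z.2 <= t2 -> D z.
  by move=> /andP[x1 x2] /andP[x3 x4]; exact: (mem_box_succ x1 x2 t10 x3 x4 s't).
have iPsi : plane.-integrable setT (EFin \o Psi).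
  have ie := integrable_eta_box r10 s'0 s'T.
  have iq := integrable_qflux_box r10 s'0 s'T.
  have vx g : vanishes_outside (- r) r g -> vanishes_outside (- (r + 1)) (r + 1) g.
    by apply: vanishes_outsideW; lra.
  have vt g : vanishes_outside t1 t2 g -> vanishes_outside 0 s' g.
    by apply: vanishes_outsideW; exact: ltW.
  have j1 := integrable_mul_tensor mal mbe' meta bal bbe' (vx _ val) (vt _ vbe') ie.
  have j2 := integrable_mul_tensor mal' mbe mq bal' bbe (vx _ val') (vt _ vbe) iq.
  have := integrableD measurableT j1 j2.
  by under eq_fun do rewrite -EFinD.
pose Z n (P : (R * R) * (R * R)) := kern2 (harmonic n) P * `|G1 P.2 - G1 P.1| +
  kern2 (harmonic n) P * `|G2 P.2 - G2 P.1| + kern2 (harmonic n) P * `|G3 P.2 - G3 P.1|.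
have Z0 : (\int[leb4]_P (Z n P)%:E)%E @[n --> \oo] --> 0%E.
  rewrite (_ : (fun n => _) = (fun n =>
      \int[leb4]_P (kern2 (harmonic n) P * `|G1 P.2 - G1 P.1|)%:E +
      \int[leb4]_P (kern2 (harmonic n) P * `|G2 P.2 - G2 P.1|)%:E +
      \int[leb4]_P (kern2 (harmonic n) P * `|G3 P.2 - G3 P.1|)%:E)%E).
    exact: cvge0D (cvge0D (kern2_osc_cvg mG1 iG1) (kern2_osc_cvg mG2 iG2)) (kern2_osc_cvg mG3 iG3).
  apply/funext => n; rewrite /Z.
  move: (@harmonic R n) (@harmonic_gt0 R n) => h h0; have mk := @measurable_kern R h.
  have k0 P : 0 <= kern2 h P by exact: kern2_ge0.
  have mk2 : measurable_fun setT (kern2 h) by rewrite /kern2; meas.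
  rewrite -ge0_integralD//; last 4 first.
  - by move=> P _; rewrite lee_fin mulr_ge0.
  - by meas.
  - by move=> P _; rewrite lee_fin mulr_ge0.
  - by meas.
  rewrite -ge0_integralD//; last 4 first.
  - by move=> P _; rewrite lee_fin addr_ge0// mulr_ge0.
  - by meas.
  - by move=> P _; rewrite lee_fin mulr_ge0.
  - by meas.
have ccst : (\int[plane]_z (Psi z)%:E + \int[leb4]_P (Z n P)%:E)%E @[n --> \oo] -->
    (\int[plane]_z (Psi z)%:E)%E.
  rewrite -[X in _ --> X]adde0; apply: cvgeD => //; first exact: fin_num_adde_defl.
  exact: cvg_cst.
(* The error integral tends to 0, so it is finite for large n; this finiteness makes the error
   integrable and, by domination, the doubled integrand too. *)
suff key n : harmonic n < s' - t2 -> (\int[leb4]_P (Z n P)%:E)%E \is a fin_num ->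
    (0 <= \int[plane]_z (Psi z)%:E + \int[leb4]_P (Z n P)%:E)%E.
  apply: (le_cvge (cvg_cst 0%E) ccst).
  move/fine_cvgP : (Z0) => [Zf _].
  near=> n; apply: key.
    by near: n; apply: (harmonic_at_right (nbhs_right_lt _)); rewrite subr_gt0.
  by near: n; exact: Zf.
move=> hs; have h1 : @harmonic R n <= 1 by rewrite invf_le1 ?ler1n ?ltr0n.
rewrite {ccst Z0}/Z.
move: (@harmonic R n) (@harmonic_gt0 R n) hs h1 => h h0 hs h1.
move=> Zf0.
pose Zh (P : (R * R) * (R * R)) := kern2 h P * `|G1 P.2 - G1 P.1| +
  kern2 h P * `|G2 P.2 - G2 P.1| + kern2 h P * `|G3 P.2 - G3 P.1|.
have Zf : (\int[leb4]_P (Zh P)%:E)%E \is a fin_num by [].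
suff : (0 <= \int[plane]_z (Psi z)%:E + \int[leb4]_P (Zh P)%:E)%E by [].
have mk := @measurable_kern R h.
have k0 P : 0 <= kern2 h P by exact: kern2_ge0.
have mk2 : measurable_fun setT (kern2 h) by rewrite /kern2; meas.
have Zh0 P : 0 <= Zh P by rewrite /Zh !addr_ge0// mulr_ge0.
have mZ : measurable_fun setT Zh by rewrite /Zh; meas.
have iZ : leb4.-integrable setT (EFin \o Zh).
  apply/integrableP; split; first by apply/measurable_EFinP.
  under eq_integral do rewrite /= ger0_norm//.
  by rewrite -ge0_fin_numE// integral_ge0// => P _; rewrite lee_fin.
have [iY EY] := integral_kern2_fst h0 mPsi iPsi.
rewrite -EY -integralD//.
pose X P := kern2 h P * (al P.1.1 * be' P.1.2 * uw_dist P +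
     al' P.1.1 * be P.1.2 * uu_flux P).
have mX : measurable_fun setT X.
  by rewrite /X /uw_dist; meas.
have XY P : `|X P - kern2 h P * Psi P.1| <= Zh P.
  have -> : X P - kern2 h P * Psi P.1 = kern2 h P *
      (al P.1.1 * be' P.1.2 * (uw_dist P - eta P.1) +
       al' P.1.1 * be P.1.2 * (uu_flux P - qflux P.1)).
    by rewrite /X /Psi; ring.
  have [->|kP] := eqVneq (kern2 h P) 0; first by rewrite mul0r normr0.
  have [[-> ->]|[px pt]] := supp P.1; first by rewrite !mul0r addr0 mulr0 normr0.
  have D1 := suppD _ px pt.
  have D2 := mem_box_kern2 h0 h1 hs kP px t10 pt.
  have e1 : \1_D P.1 = 1 :> R by rewrite indicE mem_set.
  have e2 : \1_D P.2 = 1 :> R by rewrite indicE mem_set.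
  rewrite /Zh -!mulrDr normrM ger0_norm// ler_wpM2l//.
  rewrite /G1 /G2 /G3 e1 e2 !mulr1 -!mulrBr !normrM (ger0_norm C10) (ger0_norm C20).
  rewrite (ger0_norm (_ : 0 <= C1 + `|l| * C2)); last by rewrite addr_ge0// mulr_ge0.
  rewrite (le_trans (ler_normD _ _))// !normrM -!normrM.
  have d1 : `|uw_dist P - eta P.1| <= `|u2 P.2 - u2 P.1| + `|w2 P.2 - w2 P.1|.
    rewrite /uw_dist /eta opprD addrACA (le_trans (ler_normD _ _))// lerD//.
      by rewrite (le_trans (ler_dist_dist _ _))// opprB addrC addrA subrK distrC.
    by rewrite (le_trans (ler_dist_dist _ _))// opprB addrC addrA subrK distrC.
  have d2 : `|uu_flux P - qflux P.1| <=
      `|flux_var f l (u2 P.2) - flux_var f l (u2 P.1)| + `|l| * `|u2 P.2 - u2 P.1|.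
    exact: kflux_dist.
  apply: (@le_trans _ _ (C1 * (`|u2 P.2 - u2 P.1| + `|w2 P.2 - w2 P.1|) +
    C2 * (`|flux_var f l (u2 P.2) - flux_var f l (u2 P.1)| + `|l| * `|u2 P.2 - u2 P.1|))).
    by rewrite lerD// normrM ler_pM// ?C1b ?C2b.
  rewrite le_eqVlt; apply/orP; left; apply/eqP; ring.
have iX : leb4.-integrable setT (EFin \o X).
  apply: le_integrable (integrableD measurableT (integrable_norm iY) iZ) => //.
    by apply/measurable_EFinP.
  move=> P _; rewrite /= lee_fin [leRHS]ger0_norm; last exact: addr_ge0 (normr_ge0 _) (Zh0 P).
  rewrite (_ : X P = kern2 h P * Psi P.1 + (X P - kern2 h P * Psi P.1)); last by ring.
  by apply: le_trans (ler_normD _ _) _; rewrite lerD2l; exact: XY.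
apply: (@le_trans _ _ (\int[leb4]_P (X P)%:E)%E).
  apply: (@doubled_entropy al al' be be' r t1 t2) => //.
  by move: hs; rewrite ltrBrDl => /lt_trans; apply.
apply: le_integral => //; first exact: integrableD.
move=> P _; rewrite /= lee_fin -lerBlDl (le_trans _ (XY P))// ler_norm.
Unshelve. all: by end_near. Qed.

Lemma eta_slice_right_cont s : s \in `[0, T[ -> slice_right_cont (eta) s.
Proof.
move=> sT; have c1 := C0_slice_right_cont cu1 sT; have c2 := C0_slice_right_cont cu2 sT.
have c3 := C0_slice_right_cont cw1 sT; have c4 := C0_slice_right_cont cw2 sT.
have diff (v v' : R * R -> R) : measurable_fun setT v -> measurable_fun setT v' ->
    slice_right_cont v s -> slice_right_cont v' s -> slice_right_cont (fun z => v z - v' z) s.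
  move=> mv mv' cv cv'; apply: (slice_right_cont_le2 _ mv mv') => //; first by meas.
  move=> x t; rewrite (_ : _ - _ = (v (x, t) - v (x, s)) - (v' (x, t) - v' (x, s))) ?ler_normB//.
  by ring.
have cu := diff _ _ mu1 mu2 c1 c2; have cw := diff _ _ mw1 mw2 c3 c4.
apply: (slice_right_cont_le2 meta _ _ _ cu cw); [by meas|by meas|].
by move=> x t; rewrite /eta opprD addrACA (le_trans (ler_normD _ _))// lerD// ler_dist_dist.
Qed.

Lemma eta_locally_integrable s : s \in `[0, T[ ->
  locally_integrable setT (fun x => eta (x, s)).
Proof.
move=> sT; case: cu1 cu2 cw1 cw2 => _ + _ [_ + _] [_ + _] [_ + _].
move=> /(_ s sT) i1 /(_ s sT) i2 /(_ s sT) i3 /(_ s sT) i4.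
apply: (@locally_integrableD R setT (fun x => `|u1 (x, s) - u2 (x, s)|)
  (fun x => `|w1 (x, s) - w2 (x, s)|)); apply: locally_integrable_norm;
  exact: locally_integrableB.
Qed.

Section time_slices.
Variables (al al' : R -> R) (r : R).
Hypothesis r0 : 0 < r.
Hypothesis sal : smooth al.
Hypothesis sal' : smooth al'.
Hypothesis dal : forall x : R, is_derive x 1 al (al' x).
Hypothesis val : vanishes_outside (- r) r al.
Hypothesis al0 : forall x, 0 <= al x.

Let val' : vanishes_outside (- r) r al'.
Proof. exact: vanishes_outside_derive val dal. Qed.

Let mal : measurable_fun setT al.
Proof. exact: measurable_smooth sal. Qed.

Let mal' : measurable_fun setT al'.
Proof. exact: measurable_smooth sal'. Qed.

Let integrable_cut (A : R -> R) (g : R * R -> R) (s' : R) : measurable_fun setT A ->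
  has_sup_bound A -> vanishes_outside (- r) r A -> measurable_fun setT g ->
  plane.-integrable (box r s') (EFin \o g) ->
  plane.-integrable (snd @^-1` `[0, s']%classic) (fun z => (A z.1 * g z)%:E).
Proof.
move=> mA bA vA mg ig.
have mS : measurable (snd @^-1` `[0, s']%classic : set (measurableTypeR R * measurableTypeR R)).
  exact: (measurable_slab `[0, s']).
have i : plane.-integrable setT (fun z => (A z.1 * \1_`[0, s']%classic z.2 * g z)%:E).
  apply: (@integrable_mul_tensor _ A \1_`[0, s']%classic g (- r) r 0 s') => //.
  - exact: has_sup_bound_indic.
  - exact: vanishes_outside_indic.
have := integrableS measurableT mS (@subsetT _ _) i.
apply: eq_integrable => // z; rewrite inE/= => zs; rewrite indicE mem_set ?mulr1//.
Qed.

Let bal : has_sup_bound al.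
Proof. exact: vanishing_sup_bound (smooth_continuous sal) val. Qed.

Let bal' : has_sup_bound al'.
Proof. exact: vanishing_sup_bound (smooth_continuous sal') val'. Qed.

(** Kato's inequality with the time plateau between s and tau: its slope is a kernel at s minus a
    kernel at tau, which select the two slices in the limit, while the plateau becomes the indicator
    of ]s, tau]. *)
Lemma kato_between s tau : 0 < s -> s < tau -> tau < T ->
  (\int[leb]_x (eta (x, tau) * al x)%:E <=
   \int[leb]_x (eta (x, s) * al x)%:E +
   \int[plane]_(z in snd @^-1` `]s, tau]%classic) (al' z.1 * qflux z)%:E)%E.
Proof.
move=> s0 stau tauT.
have [c [c0 c2 s'T]] := time_window stau tauT.
pose s' := tau + c.
have s'0 : 0 <= s' by rewrite addr_ge0 ?(ltW c0)// ltW// (lt_trans s0).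
have ie := integrable_eta_box r0 s'0 s'T.
have iq := integrable_qflux_box r0 s'0 s'T.
have iB := integrable_cut mal' bal' val' mq iq.
have mslab (i : interval R) : measurable (snd @^-1` [set` i] : set (measurableTypeR R * measurableTypeR R)).
  exact: (measurable_slab i).
have iB' : plane.-integrable (snd @^-1` `[s, tau + c]%classic) (fun z => (al' z.1 * qflux z)%:E).
  apply: integrableS iB => // z /=; rewrite !in_itv/= => /andP[h1 ->].
  by rewrite (le_trans (ltW s0) h1).
have mg : measurable_fun setT (fun z => al' z.1 * qflux z) by meas.
have cB := plateau_integral_cvg (mu := plane) c0 (ltW stau) c2 measurable_snd mg iB'.
have taui : tau \in `[0, T[ by rewrite in_itv/= tauT (ltW (lt_trans s0 stau)).
have si : s \in `[0, T[ by rewrite in_itv/= (ltW s0) (lt_trans stau).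
have [C alC] := bal.
have tauc : tau + c <= s' by [].
have sc : s + c <= s' by rewrite (le_trans c2)// lerDl ltW.
have slice t (tT : t \in `[0, T[) (t0 : 0 <= t) (ts' : t + c <= s') :=
  kern_slice_seq_cvg c0 t0 ts' meta mal alC val ie
    (locally_integrable_itv _ _ (eta_locally_integrable tT)) (eta_slice_right_cont tT).
have tau0 := lt_trans s0 stau.
have cs := slice _ si (ltW s0) sc; have ctau := slice _ taui (ltW tau0) tauc.
have fins : (\int[leb]_x (eta (x, s) * al x)%:E)%E \is a fin_num.
  apply: integrable_fin_num => //.
  exact: integrable_slice_mul meta mal alC val (locally_integrable_itv _ _ (eta_locally_integrable si)).
have csB := cvg_seq_eD fins cs cB.
apply: (le_cvge ctau csB); apply: nearW => n.
have /andP[] := scaled_harmonic_le n c0; move: (c * harmonic n) => h h0 hc {cs ctau cB csB}.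
have it t (t0 : 0 <= t) (ts' : t + c <= s') :
    plane.-integrable setT (fun z => (eta z * (al z.1 * kern h (z.2 - t)))%:E).
  apply: (integrable_mul_time_kern h0 t0 _ meta mal alC val ie).
  by rewrite (le_trans _ ts')// lerD2l.
have iS := it _ (ltW s0) sc; have iTau := it _ (ltW tau0) tauc.
have shtau : s + h <= tau by rewrite (le_trans _ c2)// lerD2l.
have ms b := measurable_smooth (smooth_stepfun h b).
have vp : vanishes_outside s (tau + h) (fun t => step h s t - step h tau t).
  by apply: plateau_out => //; rewrite ?lerD2r ltW.
have iBn : plane.-integrable setT (fun z => ((al' z.1 * qflux z) *
    (step h s z.2 - step h tau z.2))%:E).
  under eq_fun do rewrite mulrAC.
  apply: (@integrable_mul_tensor _ al' (fun t => step h s t - step h tau t) _ (- r) r 0 s') => //.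
  - exact: measurable_smooth (smooth_plateau _ _ _ _).
  - exact: vanishing_sup_bound (smooth_continuous (smooth_plateau _ _ _ _)) vp.
  - by apply: vanishes_outsideW (ltW s0) _ vp; rewrite (le_trans _ tauc)// lerD2l.
have smk : smooth (fun t => kern h (t - s) - kern h (t - tau)).
  by apply: smoothB; exact: smooth_kern.
have := @kato al al' (fun t => step h s t - step h tau t)
  (fun t => kern h (t - s) - kern h (t - tau)) r s (tau + h) r0 s0.
have stauh : s <= tau + h by rewrite (le_trans (ltW stau))// lerDl ltW.
have tauhT : tau + h < T by rewrite (le_lt_trans _ s'T)// lerD2l.
move=> /(_ stauh tauhT sal (smooth_plateau _ _ _ _) sal' smk dal (is_derive_plateau _ _ _ _) val).
move=> /(_ vp al0).
have p0 t : 0 <= step h s t - step h tau t by exact: step_plateau_ge0.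
move=> /(_ p0).
set K := (\int[plane]_z _)%E.
have -> : K = (\int[plane]_z (eta z * (al z.1 * kern h (z.2 - s)))%:E -
    \int[plane]_z (eta z * (al z.1 * kern h (z.2 - tau)))%:E +
    \int[plane]_z (al' z.1 * qflux z * (step h s z.2 - step h tau z.2))%:E)%E.
  rewrite -integralB_EFin// -integralD//; last exact: integrableB.
  by apply: eq_integral => z _; rewrite -EFinB -EFinD; congr EFin; ring.
by rewrite addeAC sube_ge0//; apply/orP; left; exact: integrable_fin_num.
Qed.

(** The tests in [kato] live in positive times, so time 0 is reached as a limit of starting times,
    by right continuity of the slices. *)
Lemma kato_from0 tau : 0 < tau -> tau < T ->
  (\int[leb]_x (eta (x, tau) * al x)%:E <=
   \int[leb]_x (eta (x, 0) * al x)%:E +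
   \int[plane]_(z in snd @^-1` `]0%R, tau]%classic) (al' z.1 * qflux z)%:E)%E.
Proof.
move=> tau0 tauT; have [C alC] := bal.
have mg : measurable_fun setT (fun z => al' z.1 * qflux z) by meas.
have iq := integrable_qflux_box r0 (ltW tau0) tauT.
have iB := integrable_cut mal' bal' val' mq iq.
have mslab (i : interval R) : measurable (snd @^-1` [set` i] : set (measurableTypeR R * measurableTypeR R)).
  exact: (measurable_slab i).
pose sn n := (tau / 2) * @harmonic R n.
have t20 : 0 < tau / 2 by rewrite divr_gt0.
have snc : sn @ \oo --> 0^'+ := scaled_harmonic_at_right t20.
have sn0 n : 0 < sn n /\ sn n < tau.
  have /andP[h0 h1] := scaled_harmonic_le n t20; split=> //.
  by rewrite (le_lt_trans h1)// ltr_pdivrMr// ltr_pMr// ltr1n.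
have zT : 0 \in `[0, T[ by rewrite in_itv/= lexx (lt_trans tau0 tauT).
have cA : (\int[leb]_x (eta (x, sn n) * al x)%:E)%E @[n --> \oo] -->
    (\int[leb]_x (eta (x, 0) * al x)%:E)%E.
  apply: (slice_integral_cvg meta mal alC val snc) => [n||].
  - apply: locally_integrable_itv; apply: eta_locally_integrable.
    by have [h0 h1] := sn0 n; rewrite in_itv/= ltW// (lt_trans h1).
  - by apply: locally_integrable_itv; exact: eta_locally_integrable.
  - exact: eta_slice_right_cont.
have cB : (\int[plane]_(z in snd @^-1` `]sn n, tau]%classic) (al' z.1 * qflux z)%:E)%E
   @[n --> \oo] --> (\int[plane]_(z in snd @^-1` `]0%R, tau]%classic) (al' z.1 * qflux z)%:E)%E.
  pose G z := (al' z.1 * qflux z)%:E.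
  rewrite integral_mkcond (_ : (fun n => _) =
    (fun n => \int[plane]_z (G \_ (snd @^-1` `]sn n, tau]%classic)) z)%E); last first.
    by apply/funext => n; rewrite integral_mkcond.
  have mG : measurable_fun setT G by apply/measurable_EFinP.
  have mres (i : interval R) : measurable_fun setT (G \_ (snd @^-1` [set` i])).
    by apply/(measurable_restrictT _ (mslab i)); exact: measurable_funTS.
  have [|||||_ _] // := @dominated_convergence _ _ _ plane setT measurableT
    (fun n => G \_ (snd @^-1` `]sn n, tau]%classic)) (G \_ (snd @^-1` `]0%R, tau]%classic))
    (abse \o (G \_ (snd @^-1` `[0%R, tau]%classic))).
  - by move=> n; exact: mres.
  - exact: mres.
  - apply: aeW => z _; rewrite !patchE; have [z0|z0] := leP z.2 0.
      apply: cvg_near_cst; apply: nearW => n; have [h0 _] := sn0 n.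
      rewrite patchE !memNset//=; rewrite in_itv/= => /andP[].
        by rewrite ltNge z0.
      by rewrite ltNge (le_trans z0 (ltW h0)).
    have nz : \forall n \near \oo, sn n < z.2 := snc _ (nbhs_right_lt z0).
    apply: cvg_near_cst; apply: filterS nz => n hn.
    rewrite patchE; have -> // : (z \in snd @^-1` `]sn n, tau]%classic) = (z \in snd @^-1` `]0, tau]%classic).
    by apply/idP/idP; rewrite !inE/= !in_itv/= => /andP[_ ->]; rewrite ?z0 ?hn.
  - by apply: integrable_abse; apply/(integrable_mkcond _ (mslab _)).
  - apply: aeW => z n _; rewrite /= !patchE; case: ifPn => [zn|_]; last first.
      by rewrite -[point]/(0%E : \bar R) abse0 abse_ge0.
    rewrite ifT//; move: zn; rewrite !inE/= !in_itv/= => /andP[h1 ->].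
    by rewrite (ltW (lt_trans _ h1))//; case: (sn0 n).
have fA : (\int[leb]_x (eta (x, 0) * al x)%:E)%E \is a fin_num.
  apply: integrable_fin_num => //.
  exact: integrable_slice_mul meta mal alC val (locally_integrable_itv _ _ (eta_locally_integrable zT)).
have cAB := cvg_seq_eD fA cA cB.
apply: (le_cvge (cvg_cst _) cAB); apply: nearW => n.
by have [h0 h1] := sn0 n; exact: kato_between.
Qed.

End time_slices.

Section interval_estimate.
Variable tau : R.
Hypothesis tau0 : 0 < tau.
Hypothesis tauT : tau < T.

Let iq r : 0 < r -> plane.-integrable (box r tau) (EFin \o qflux).
Proof.
by move=> r0; exact: (integrable_qflux_box r0 (ltW tau0) tauT).
Qed.

(** The space factor is now a plateau between y and z, with slope a kernel at y minus a kernel at z.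
    Against the time-integrated flux these kernels converge at Lebesgue points, where the flux
    through a single vertical line acquires a meaning. *)
Lemma kato_interval y z : y < z -> lebesgue_pt (time_integral qflux tau) y ->
  lebesgue_pt (time_integral qflux tau) z ->
  (\int[leb]_(x in `]y, z]) (eta (x, tau))%:E <=
   \int[leb]_(x in `]y, z]) (eta (x, 0%R))%:E +
   (time_integral qflux tau y - time_integral qflux tau z)%:E)%E.
Proof.
move=> yz Qy Qz; set Q := time_integral _ _ in Qy Qz *.
(* With this width the step issued from y is completed before the one at z begins, for every n. *)
pose c := z - y; have c0 : 0 < c by rewrite subr_gt0.
have ycz : y + c <= z by rewrite /c addrC subrK.
have [r [r0 yr zr]] : exists r : R, [/\ 0 < r, - r <= y & z + c <= r].
  exists (`|y| + `|z| + c + 1).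
  have := normr_ge0 y; have := normr_ge0 z; have := ler_norm z; have := ler_norm (- y).
  by rewrite normrN; move: c0; split; lra.
pose hn n : R := c * harmonic n.
have hnc : hn @ \oo --> 0^'+ := scaled_harmonic_at_right c0.
have hn0 n : 0 < hn n <= c := scaled_harmonic_le n c0.
have lQ : locally_integrable setT Q := locally_integrable_time_integral mq iq.
have zT : 0 \in `[0, T[ by rewrite in_itv/= lexx (lt_trans tau0 tauT).
have tT : tau \in `[0, T[ by rewrite in_itv/= tauT ltW.
have le := eta_locally_integrable.
have cE t : t \in `[0, T[ ->
    (\int[leb]_x (eta (x, t) * (step (hn n) y x - step (hn n) z x))%:E)%E @[n --> \oo] -->
    (\int[leb]_(x in `]y, z]) (eta (x, t))%:E)%E.
  move=> ti; apply: (plateau_integral_cvg (mu := leb) (p := idfun) c0 (ltW yz) ycz).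
  - exact: measurable_id.
  - exact: measurable_slice1.
  - exact: locally_integrable_itv (le t ti).
have cK b : lebesgue_pt Q b ->
    (\int[leb]_x (kern (hn n) (x - b) * Q x)%:E)%E @[n --> \oo] --> (Q b)%:E.
  by move=> Qb; exact: cvg_comp hnc (kern_lebesgue_cvg lQ Qb).
have fE : (\int[leb]_(x in `]y, z]) (eta (x, 0%R))%:E)%E \is a fin_num.
  apply: integrable_fin_num => //; apply: integrableS (locally_integrable_itv y z (le 0 zT)) => //.
  by move=> x /=; rewrite !in_itv/= => /andP[/ltW -> ->].
have cKK : (\int[leb]_x (kern (hn n) (x - y) * Q x)%:E - \int[leb]_x (kern (hn n) (x - z) * Q x)%:E)%E
    @[n --> \oo] --> (Q y - Q z)%:E.
  rewrite EFinB; apply: cvg_seq_eD => //; first exact: cK.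
  by apply: cvgeN; exact: cK.
apply: (le_cvge (cE tau tT) (cvg_seq_eD fE (cE 0 zT) cKK)); apply: nearW => n.
have /andP[] := hn0 n; move: (hn n) => h h0 hc.
have mk := @measurable_kern R h.
have vk b : - r <= b -> b + c <= r -> vanishes_outside (- r) r (fun x => kern h (x - b)).
  move=> b1 b2; apply: vanishes_outsideW (kern_shift_out h0) => //.
  by apply: le_trans b2; rewrite lerD2l.
have bk b := kern_sup_bound b h0.
have mkb b : measurable_fun setT (fun x : R => kern h (x - b)) by meas.
have vy : vanishes_outside (- r) r (fun x => kern h (x - y)).
  by apply: vk => //; rewrite (le_trans _ zr)// lerD2r ltW.
have vz : vanishes_outside (- r) r (fun x => kern h (x - z)).
  by apply: vk => //; rewrite (le_trans yr)// ltW.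
have [iy _] := time_integral_tensor mq iq r0 (mkb y) (bk y) vy.
have [iz _] := time_integral_tensor mq iq r0 (mkb z) (bk z) vz.
rewrite -integralB_EFin//.
have mkyz : measurable_fun setT (fun x : R => kern h (x - y) - kern h (x - z)) by exact: measurable_funB.
have vyz : vanishes_outside (- r) r (fun x => kern h (x - y) - kern h (x - z)).
  by move=> x xr; rewrite vy// vz// subrr.
have [_ EQ] := time_integral_tensor mq iq r0 mkyz (has_sup_boundB (bk y) (bk z)) vyz.
under [X in (_ <= _ + X)%E]eq_integral do rewrite -EFinB -mulrBl.
rewrite -EQ; apply: (@kato_from0 (fun x => step h y x - step h z x)
  (fun x => kern h (x - y) - kern h (x - z)) r r0) => //.
- exact: smooth_plateau.
- by apply: smoothB; exact: smooth_kern.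
- by move=> x; exact: is_derive_plateau.
- move=> x xr; apply: (@plateau_out _ h h y z) => //; rewrite ?lerD2r ?(ltW yz)//.
  case: xr => xr; [left; exact: lt_le_trans yr|right; apply: le_lt_trans xr].
  by apply: le_trans zr; rewrite lerD2l.
- move=> x; apply: step_plateau_ge0 => //.
  by apply: le_trans ycz; rewrite lerD2l.
Qed.

End interval_estimate.

End kruzkov.

(** * Total variation in time *)

Section variation_bound.
Context {R : realType}.

Lemma cvg_le_limn_einf (u v : nat -> \bar R) (L : \bar R) : u n @[n --> \oo] --> L ->
  (forall n, (u n <= v n)%E) -> (L <= limn_einf v)%E.
Proof.
move=> uL uv; rewrite limn_einf_lim -(cvg_lim (@ereal_hausdorff R) (cvg_einfs uL)).
apply: lee_lim; [exact: is_cvg_einfs|exact: is_cvg_einfs|].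
apply: nearW => n; apply: le_ereal_inf_tmp => _ [k /= nk <-].
by apply: le_trans (uv k); apply: ereal_inf_lbound; exists k.
Qed.

Variables (T : R) (w : R * R -> R).
Hypothesis mw : measurable_fun setT w.
Hypothesis cw : C0_L1loc T w.
Hypothesis iw : forall r s, 0 < r -> 0 <= s -> s < T ->
  plane.-integrable (box r s) (EFin \o w).
Variables (nu : {charge set (measurableTypeR R * measurableTypeR R)%type -> \bar R}).
Variables (P N : set (measurableTypeR R * measurableTypeR R)).
Variable nuPN : hahn_decomposition nu P N.
Hypothesis dw : is_distr_dt T w nuPN.

(** The projection to the x axis of the total variation of nu, mollified at scale h. *)
Definition x_marginal_density (h y : R) : \bar R :=
  (\int[jordan_pos nuPN]_z (kern h (z.1 - y))%:E + \int[jordan_neg nuPN]_z (kern h (z.1 - y))%:E)%E.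

Lemma charge_integral_le h y (phi : R * R -> R) : 0 < h -> measurable_fun setT phi ->
  (forall z, `|phi z| <= kern h (z.1 - y)) ->
  (`|charge_integral nuPN phi| <= x_marginal_density h y)%E.
Proof.
move=> h0 mphi phik; have mk := @measurable_kern R h; rewrite /charge_integral.
apply: (le_trans (lee_abs_sub _ _)); apply: leeD.
  apply: le_trans (le_abse_integral _ _ _) _ => //; first by apply/measurable_EFinP.
  by apply: ge0_integral_le => //; meas.
apply: le_trans (le_abse_integral _ _ _) _ => //; first by apply/measurable_EFinP.
by apply: ge0_integral_le => //; meas.
Qed.

(** Tonelli between Lebesgue measure in y and [mu] in z; at fixed z the kernel has mass one in y. *)
Let mixed (mu : {finite_measure set (measurableTypeR R * measurableTypeR R)%type -> \bar R}) h : 0 < h ->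
  measurable_fun [set: measurableTypeR R] (fun y => \int[mu]_z (kern h (z.1 - y))%:E)%E /\
  (\int[leb]_y \int[mu]_z (kern h (z.1 - y))%:E = mu setT)%E.
Proof.
move=> h0; have mk := @measurable_kern R h.
have mf : measurable_fun setT (fun p : R * (R * R) => (kern h (p.2.1 - p.1))%:E) by meas.
have f0 (p : R * (R * R)) : (0 <= (kern h (p.2.1 - p.1))%:E)%E by rewrite lee_fin kern_ge0.
split; first exact: (@measurable_fun_fubini_tonelli_F _ _ _ _ R mu _ mf f0).
rewrite (@fubini_tonelli _ _ _ _ R leb mu _ mf f0).
under eq_integral do rewrite /= integral_kernr//.
by rewrite integral_cst// mul1e.
Qed.

Lemma x_marginal_density_integral h : 0 < h ->
  measurable_fun setT (x_marginal_density h) /\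
  (\int[leb]_y x_marginal_density h y = charge_variation nuPN setT)%E.
Proof.
move=> h0; have [m1 i1] := mixed (jordan_pos nuPN) h0; have [m2 i2] := mixed (jordan_neg nuPN) h0.
split; first exact: emeasurable_funD.
rewrite ge0_integralD//; first by rewrite i1 i2.
- by move=> y _; apply: integral_ge0 => z _; rewrite lee_fin kern_ge0.
- by move=> y _; apply: integral_ge0 => z _; rewrite lee_fin kern_ge0.
Qed.

Lemma x_marginal_density_ge0 h y : 0 < h -> (0 <= x_marginal_density h y)%E.
Proof. by move=> h0; apply: adde_ge0; apply: integral_ge0 => z _; rewrite lee_fin kern_ge0. Qed.

(** The marginal of the variation measure may be singular in x and is not disintegrated. The lower
    limit of its mollifications is a function, and by Fatou its integral is at most the total
    variation of nu, which is finite. *)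
Definition variation_density (y : R) : \bar R :=
  limn_einf (fun n => x_marginal_density (harmonic n) y).

Lemma measurable_variation_density : measurable_fun setT variation_density.
Proof.
rewrite /variation_density /limn_einf; apply: (measurableT_comp (@oppe_measurable R setT)).
apply: (measurable_fun_limn_esup (f := fun n y => - x_marginal_density (harmonic n) y)%E) => n.
apply: (measurableT_comp (@oppe_measurable R setT)).
by have [] := x_marginal_density_integral (harmonic_gt0 R n).
Qed.

Lemma variation_density_ge0 y : (0 <= variation_density y)%E.
Proof.
apply: (@cvg_le_limn_einf (cst 0%E)); first exact: cvg_cst.
by move=> n; exact: x_marginal_density_ge0 (harmonic_gt0 R n).
Qed.

Lemma variation_density_integral_lty : (\int[leb]_y variation_density y < +oo)%E.
Proof.
have := @fatou _ _ _ leb setT measurableT (fun n => x_marginal_density (harmonic n)).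
move=> /(_ _ _)/le_lt_trans; apply.
- by move=> n; have [] := x_marginal_density_integral (harmonic_gt0 R n).
- by move=> n y _; exact: x_marginal_density_ge0 (harmonic_gt0 R n).
rewrite (_ : (fun n => _) = cst (charge_variation nuPN setT)); last first.
  by apply/funext => n; have [_] := x_marginal_density_integral (harmonic_gt0 R n).
have [-> _] := cvg_limn_einf_sup (@cvg_cst _ (charge_variation nuPN setT) _ \oo _).
by rewrite lte_add_pinfty// -ge0_fin_numE// fin_num_measure.
Qed.

Let lw t : t \in `[0, T[ -> locally_integrable setT (fun x => w (x, t)).
Proof. by case: cw => _ + _; apply. Qed.

(** The derivative of w in time is tested with [kern h (x - y)] times a plateau between s and tau.
    The left side of the distributional identity tends to the difference of the mollified slices; on
    the right the test function is at most the kernel, so the bound is independent of s and tau. *)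
Let kern_time_increment_between h y s tau : 0 < h -> 0 < s -> s < tau -> tau < T ->
  (`|\int[leb]_x (w (x, s) * kern h (x - y))%:E - \int[leb]_x (w (x, tau) * kern h (x - y))%:E|
    <= x_marginal_density h y)%E.
Proof.
move=> h0 s0 stau tauT; have mk := @measurable_kern R h.
have [c [c0 c2 s'T]] := time_window stau tauT.
pose s' := tau + c.
have tau0 := lt_trans s0 stau.
have s'0 : 0 <= s' by rewrite addr_ge0 ?(ltW c0)// ltW.
have [r r0 vk] := kern_support y h0.
have [C kC] := kern_sup_bound y h0.
have mky : measurable_fun setT (fun x : R => kern h (x - y)) by meas.
have ib := iw r0 s'0 s'T.
have taui : tau \in `[0, T[ by rewrite in_itv/= tauT (ltW (lt_trans s0 stau)).
have si : s \in `[0, T[ by rewrite in_itv/= (ltW s0) (lt_trans stau).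
have tauc : tau + c <= s' by [].
have sc : s + c <= s' by rewrite (le_trans c2)// lerDl ltW.
have slice t (tT : t \in `[0, T[) (t0 : 0 <= t) (ts' : t + c <= s') :=
  kern_slice_seq_cvg c0 t0 ts' mw mky kC vk ib
    (locally_integrable_itv _ _ (lw tT)) (C0_slice_right_cont cw tT).
have fins : (\int[leb]_x (w (x, s) * kern h (x - y))%:E)%E \is a fin_num.
  apply: integrable_fin_num => //.
  exact: integrable_slice_mul mw mky kC vk (locally_integrable_itv _ _ (lw si)).
have cdiff := cvg_seq_abse (cvg_seq_eB fins (slice s si (ltW s0) sc) (slice tau taui (ltW tau0) tauc)).
apply: (le_cvge cdiff (cvg_cst _)); apply: nearW => n /=.
have /andP[] := scaled_harmonic_le n c0; move: (c * harmonic n) => d d0 dc {cdiff}.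
have mkd := @measurable_kern R d.
have it t (t0 : 0 <= t) (ts' : t + c <= s') :
    plane.-integrable setT (fun z => (w z * (kern h (z.1 - y) * kern d (z.2 - t)))%:E).
  apply: (integrable_mul_time_kern d0 t0 _ mw mky kC vk ib).
  by rewrite (le_trans _ ts')// lerD2l.
have iS := it _ (ltW s0) sc; have iTau := it _ (ltW tau0) tauc.
have sdtau : s + d <= tau by rewrite (le_trans _ c2)// lerD2l.
have vp : vanishes_outside s (tau + d) (fun t => step d s t - step d tau t).
  by apply: (@plateau_out _ d d s tau) => //; rewrite ?lerD2r ltW.
pose phi z := kern h (z.1 - y) * (step d s z.2 - step d tau z.2).
have phiC : is_Coo phi.
  exact: (tensor_Coo (smooth_kern h y) (smooth_plateau d d s tau)).
have phis : compactly_supported_in (slab `]0, T[) phi.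
  apply: (tensor_compact_support vk vp) => t /andP[t1 t2].
  rewrite in_itv/= (lt_le_trans s0 t1)/= (le_lt_trans t2)//.
  by rewrite (le_lt_trans _ s'T)// lerD2l.
have [k' sk' dk] := smooth_derivative (smooth_kern h y).
have Dphi z : 'D_(0, 1) phi z = kern h (z.1 - y) * (kern d (z.2 - s) - kern d (z.2 - tau)).
  rewrite /phi (derive_tensor z (0, 1) dk (is_derive_plateau d d s tau))/=.
  by rewrite !mul0r add0r mul1r.
have E := dw phiC phis.
rewrite -integralB_EFin//.
have -> : (\int[plane]_z ((w z * (kern h (z.1 - y) * kern d (z.2 - s)))%:E -
    (w z * (kern h (z.1 - y) * kern d (z.2 - tau)))%:E) = - charge_integral nuPN phi)%E.
  rewrite -E (integral_support plane (D := slab `[0, T[)).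
    by apply: eq_integral => z _; rewrite Dphi -EFinB -mulrBr -mulrBr.
  move=> z /negP; rewrite /slab in_itv/= negb_and -leNgt -ltNge => zT.
  rewrite -EFinB -!mulrBr; congr EFin.
  suff [-> ->] : kern d (z.2 - s) = 0 /\ kern d (z.2 - tau) = 0 by rewrite subrr !mulr0.
  split; apply: (kern_shift_out d0); case/orP : zT => zT.
  - by left; exact: lt_trans s0.
  - by right; rewrite (le_lt_trans sdtau)// (lt_le_trans tauT).
  - by left; rewrite (lt_trans zT)// (lt_trans s0).
  - by right; rewrite (le_lt_trans _ (lt_le_trans s'T zT))// lerD2l.
rewrite abseN; apply: charge_integral_le => //.
  have mst b := measurable_smooth (smooth_stepfun d b).
  by have ms := mst s; have mtau := mst tau; rewrite /phi; meas.
move=> z; rewrite /phi normrM ger0_norm ?kern_ge0// ler_piMr ?kern_ge0//.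
rewrite ger0_norm; last exact: step_plateau_ge0.
by rewrite lerBlDr (le_trans (step_le1 _ _ _))// lerDl step_ge0.
Qed.

(** Tests for the time derivative vanish near t = 0, so the starting time is first sent to 0. Then
    the mollification in x is removed at Lebesgue points of the increment; the null set lost there
    depends on tau. *)
Lemma time_increment_le tau : 0 < tau -> tau < T ->
  {ae leb, forall y, (`|w (y, tau) - w (y, 0)|%:E <= variation_density y)%E}.
Proof.
move=> tau0 tauT.
have zT : 0 \in `[0, T[ by rewrite in_itv/= lexx (lt_trans tau0 tauT).
have taui : tau \in `[0, T[ by rewrite in_itv/= tauT ltW.
have main h y : 0 < h ->
    (`|\int[leb]_x (kern h (x - y) * (w (x, 0) - w (x, tau)))%:E| <= x_marginal_density h y)%E.
  move=> h0; have mk := @measurable_kern R h.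
  have [r r0 vk] := kern_support y h0.
  have [C kC] := kern_sup_bound y h0.
  have mky : measurable_fun setT (fun x : R => kern h (x - y)) by meas.
  pose sn n := (tau / 2) * @harmonic R n.
  have t20 : 0 < tau / 2 by rewrite divr_gt0.
  have snc : sn @ \oo --> 0^'+ := scaled_harmonic_at_right t20.
  have sn0 n : 0 < sn n /\ sn n < tau.
    have /andP[s0 s1] := scaled_harmonic_le n t20; split=> //.
    by rewrite (le_lt_trans s1)// ltr_pdivrMr// ltr_pMr// ltr1n.
  have cA : (\int[leb]_x (w (x, sn n) * kern h (x - y))%:E)%E @[n --> \oo] -->
      (\int[leb]_x (w (x, 0) * kern h (x - y))%:E)%E.
    apply: (slice_integral_cvg mw mky kC vk snc) => [n||].
    - apply: locally_integrable_itv; apply: lw.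
      by have [s0 s1] := sn0 n; rewrite in_itv/= ltW// (lt_trans s1).
    - by apply: locally_integrable_itv; exact: lw.
    - exact: C0_slice_right_cont cw zT.
  have lint t (tT : t \in `[0, T[) :=
    integrable_slice_mul mw mky kC vk (locally_integrable_itv (- r) r (lw tT)).
  have -> : (\int[leb]_x (kern h (x - y) * (w (x, 0) - w (x, tau)))%:E =
    \int[leb]_x (w (x, 0) * kern h (x - y))%:E - \int[leb]_x (w (x, tau) * kern h (x - y))%:E)%E.
    rewrite -integralB_EFin//; [|exact: lint..].
    by apply: eq_integral => x _; rewrite -EFinB; congr EFin; ring.
  have f0 : (\int[leb]_x (w (x, 0) * kern h (x - y))%:E)%E \is a fin_num.
    by apply: integrable_fin_num => //; exact: lint.
  apply: (le_cvge (cvg_seq_abse (cvg_seq_eD f0 cA (cvg_cst _))) (cvg_cst _)).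
  by apply: nearW => n; have [s0 s1] := sn0 n; exact: kern_time_increment_between.
have lD := locally_integrableB (lw zT) (lw taui).
apply: (aeS (mu := leb)) (lebesgue_differentiation lD) => y yD.
have cy : (\int[leb]_x (kern (harmonic n) (x - y) * (w (x, 0) - w (x, tau)))%:E)%E @[n --> \oo] -->
    (w (y, 0) - w (y, tau))%:E.
  exact: cvg_comp (@harmonic_at_right R) (kern_lebesgue_cvg lD yD).
rewrite distrC -abse_EFin; apply: (cvg_le_limn_einf (cvg_seq_abse cy)) => n /=.
exact: main (harmonic_gt0 R n).
Qed.

End variation_bound.

(** * Vanishing of the flux at infinity *)

Section finite_measure_exceptions.
Context {R : realType}.

Lemma superlevel_measure_lty d (X : measurableType d) (mu : {measure set X -> \bar R})
    (g : X -> \bar R) (e : R) : measurable_fun setT g -> 0 < e ->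
  (\int[mu]_x `|g x| < +oo)%E -> (mu [set x | (e%:E <= `|g x|)%E] < +oo)%E.
Proof.
move=> mg e0 ig; have := @le_integral_abse _ _ _ mu setT measurableT g e mg e0.
rewrite setTI => /le_lt_trans/(_ ig) fin.
rewrite ltNge; apply/negP; rewrite leye_eq => /eqP muy.
by move: fin; rewrite muy muleC gt0_mulye ?lte_fin// ltxx.
Qed.

Lemma measurable_superlevel d (X : measurableType d) (g : X -> \bar R) (e : R) :
  measurable_fun setT g -> measurable [set x | (e%:E <= `|g x|)%E].
Proof.
move=> mg; have mag : measurable_fun setT (fun x => `|g x|)%E by meas.
by have := emeasurable_fun_c_infty measurableT mag e%:E; rewrite setTI.
Qed.

(** An interval of infinite measure is not covered by a set of finite measure together with a null
    set. On rays, this supplies the abscissae through which the flux is controlled. *)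
Lemma exists_beyond (B : set R) (P : R -> Prop) (I : interval R) : measurable B ->
  (leb B < +oo)%E -> {ae leb, forall x, P x} -> leb [set` I] = +oo%E ->
  exists x, [/\ x \in I, ~ B x & P x].
Proof.
move=> mB fB [Z [mZ Z0 PZ]] Ioo; apply: contrapT => nex.
have sub : [set` I] `<=` B `|` Z.
  move=> x /= xI; have [Bx|nBx] := pselect (B x); [by left|right].
  by apply: PZ => /= Px; apply: nex; exists x.
have mI : measurable [set` I] by exact: measurable_itv.
have : (leb [set` I] <= leb B + leb Z)%E.
  apply: (@le_trans _ _ (leb (B `|` Z))).
    by apply: le_measure => //; rewrite inE//; exact: measurableU.
  exact: measureU2.
by rewrite Z0 adde0 Ioo leNgt fB.
Qed.

Lemma lebesgue_measure_ray_r (x : R) : leb `]x, +oo[%classic = +oo%E.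
Proof. by rewrite lebesgue_measure_itv/= ltry. Qed.

Lemma lebesgue_measure_ray_l (x : R) : leb `]-oo, x[%classic = +oo%E.
Proof. by rewrite lebesgue_measure_itv/= ltNyr. Qed.

(** The endpoints cannot be prescribed, since they have to avoid an exceptional set; the bound is
    asked on some interval reaching beyond n on both sides. *)
Lemma integral_le_exhaustion (g : R -> \bar R) (C : \bar R) : measurable_fun setT g ->
  (forall x, 0 <= g x)%E ->
  (forall n : nat, exists y z, [/\ y < - n%:R, n%:R < z & (\int[leb]_(x in `]y, z]) g x <= C)%E]) ->
  (\int[leb]_x g x <= C)%E.
Proof.
move=> mg g0 exh.
pose D n : set (measurableTypeR R) := `]- n%:R, n%:R]%classic.
have mD n : measurable (D n) by exact: measurable_itv.
have cv : (\int[leb]_x (g \_ (D n)) x)%E @[n --> \oo] --> (\int[leb]_x (limn (fun n => (g \_ (D n)) x)))%E.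
  apply: cvg_monotone_convergence => //.
  - by move=> n; apply/(measurable_restrictT _ (mD n)); exact: measurable_funTS.
  - by move=> n x _; rewrite patchE; case: ifP.
  - move=> x _ m n mn; rewrite !patchE; case: ifPn => [|_]; last by case: ifP.
    rewrite inE /D/= in_itv/= => /andP[x1 x2]; rewrite mem_set//= /D/= in_itv/=.
    by rewrite (le_lt_trans _ x1) ?lerN2 ?ler_nat//= (le_trans x2)// ler_nat.
have <- : (\int[leb]_x (limn (fun n => (g \_ (D n)) x)) = \int[leb]_x g x)%E.
  apply: eq_integral => x _; apply: cvg_lim => //; apply: cvg_near_cst.
  have [n _ xn] : \forall n \near \oo, `|x| < n%:R by exact: nbhs_infty_gtr.
  exists n => // m nm; rewrite patchE mem_set//= /D/= in_itv/=.
  by have := xn m nm; rewrite /= ltr_norml => /andP[-> /ltW ->].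
apply: (le_cvge cv (cvg_cst _)); apply: nearW => n.
have [y [z [yn zn]]] := exh n; apply: le_trans.
rewrite -integral_mkcond; apply: ge0_subset_integral => //; first exact: measurable_funTS.
move=> x; rewrite /D/= !in_itv/= => /andP[x1 x2].
by rewrite (lt_trans yn)//= (le_trans x2)// ltW.
Qed.

(** Followed by [ae_slices_of_plane], this exchanges quantifiers: from every t and almost every x to
    almost every x and almost every t. *)
Lemma plane_null_of_slices (A : set (measurableTypeR R * measurableTypeR R)) : measurable A ->
  (forall t, {ae leb, forall x, ~ A (x, t)}) -> plane A = 0%E.
Proof.
move=> mA A0.
have mI : measurable_fun setT (\1_A : R * R -> R) by exact: measurable_indic.
rewrite -[A in LHS]setIT -integral_indic// plane_tonelli2; last 2 first.
- by apply/measurable_EFinP.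
- by move=> z; rewrite lee_fin.
rewrite integral0_eq// => t _.
rewrite -(integral0 leb setT).
apply: ae_eq_integral => //.
  by apply/measurable_EFinP; exact: (measurableT_comp mI (@pair2_measurable _ _ _ _ t)).
by apply: (aeS (mu := leb)) (A0 t) => x nA _; rewrite indicE memNset.
Qed.

Lemma ae_slices_of_plane (P : R * R -> Prop) : {ae plane, forall z, P z} ->
  {ae leb, forall x, {ae leb, forall t, P (x, t)}}.
Proof.
move=> [A [mA A0 PA]].
have mI : measurable_fun setT (\1_A : R * R -> R) by exact: measurable_indic.
have mf : measurable_fun setT (fun z : R * R => (\1_A z)%:E : \bar R) by apply/measurable_EFinP.
have f0 (z : R * R) : (0 <= (\1_A z)%:E :> \bar R)%E by rewrite lee_fin.
have mS : measurable_fun setT (fun x => \int[leb]_t (\1_A (x, t))%:E)%E.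
  exact: (@measurable_fun_fubini_tonelli_F _ _ _ _ R leb _ mf f0).
have : (\int[leb]_x `|\int[leb]_t (\1_A (x, t))%:E| = 0)%E.
  under eq_integral do rewrite gee0_abs ?integral_ge0//.
  by rewrite -(plane_tonelli1 mf f0) integral_indic// setIT.
move/(ae_eq_integral_abs leb measurableT mS).
apply: (aeS (mu := leb)) => x /(_ I)/= x0.
have mAx : measurable_fun setT (fun t => (\1_A (x, t))%:E : \bar R).
  by apply/measurable_EFinP; exact: (measurableT_comp mI (@pair1_measurable _ _ _ _ x)).
have : (\int[leb]_t `|(\1_A (x, t))%:E| = 0)%E by under eq_integral do rewrite gee0_abs//.
move/(ae_eq_integral_abs leb measurableT mAx).
apply: (aeS (mu := leb)) => t /(_ I) [] At.
apply: contrapT => nP; have : A (x, t) by apply: PA.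
by move=> /mem_set Axt; move: At; rewrite indicE Axt => /eqP; rewrite oner_eq0.
Qed.

End finite_measure_exceptions.

(** * Bootstrap on the tails *)

Section tails.
Context {R : realType}.
Variables (T L K : R) (eta q : R * R -> R) (B : set R) (C : \bar R).
Hypothesis meta : measurable_fun setT eta.
Hypothesis mq : measurable_fun setT q.
Hypothesis eta0 : forall z, 0 <= eta z.
Hypothesis L0 : 0 <= L.
Hypothesis K0 : 0 <= K.
Hypothesis mB : measurable B.
Hypothesis fB : (leb B < +oo)%E.
Hypothesis Cfin : C \is a fin_num.
Hypothesis good : {ae leb, forall x, ~ B x -> {ae leb, forall t, 0 < t < T ->
  `|q (x, t)| <= L * eta (x, t) /\ eta (x, t) <= K}}.
Hypothesis lq : forall tau, 0 < tau < T -> locally_integrable setT (time_integral q tau).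
Hypothesis est : forall tau y z, 0 < tau < T -> y < z ->
  lebesgue_pt (time_integral q tau) y -> lebesgue_pt (time_integral q tau) z ->
  (\int[leb]_(x in `]y, z]) (eta (x, tau))%:E <=
   C + (time_integral q tau y - time_integral q tau z)%:E)%E.

Let E tau x : \bar R := (\int[leb]_(t in `]0%R, tau]) (eta (x, t))%:E)%E.

Let E0 tau x : (0 <= E tau x)%E.
Proof. by apply: integral_ge0 => t _; rewrite lee_fin. Qed.

Let cut tau (z : R * R) : \bar R := (eta z * \1_(`]0, tau]%classic) z.2)%:E.

Let mcut tau : measurable_fun setT (cut tau).
Proof.
have mI : measurable_fun setT (fun z : R * R => \1_(`]0, tau]%classic) z.2 : R).
  by apply: (measurableT_comp _ measurable_snd); apply: measurable_indic; exact: measurable_itv.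
by apply/measurable_EFinP; exact: measurable_funM.
Qed.

Let cut0 tau z : (0 <= cut tau z)%E.
Proof. by rewrite lee_fin mulr_ge0. Qed.

Let EE tau x : E tau x = (\int[leb]_t cut tau (x, t))%E.
Proof.
rewrite /E integral_mkcond; apply: eq_integral => t _.
by rewrite patchE /cut indicE/=; case: ifP; rewrite (mulr1, mulr0).
Qed.

Let mE tau : measurable_fun setT (E tau).
Proof.
rewrite (_ : E tau = fun x => \int[leb]_t cut tau (x, t))%E; last by apply/funext => x; exact: EE.
exact: (@measurable_fun_fubini_tonelli_F _ _ _ _ R leb _ (mcut tau) (cut0 tau)).
Qed.

Let E_integral tau : (\int[leb]_x E tau x = \int[leb]_(t in `]0%R, tau]) \int[leb]_x (eta (x, t))%:E)%E.
Proof.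
under eq_integral do rewrite EE.
rewrite -(plane_tonelli1 (mcut tau) (cut0 tau)) (plane_tonelli2 (mcut tau) (cut0 tau)).
rewrite [RHS]integral_mkcond; apply: eq_integral => t _.
transitivity (\int[leb]_x (eta (x, t) * \1_(`]0, tau]%classic) t)%:E)%E; first by [].
rewrite patchE indicE; case: ifP => _; first by under eq_integral do rewrite mulr1.
by rewrite integral0_eq// => x _; rewrite mulr0.
Qed.

Let measure_I tau : 0 < tau -> leb (`]0, tau]%classic : set R) = tau%:E.
Proof. by move=> tau0; rewrite lebesgue_measure_itv/= lte_fin tau0 oppr0 adde0. Qed.

Let good_bound tau : 0 < tau < T -> {ae leb, forall x, ~ B x ->
  (`|time_integral q tau x|%:E <= L%:E * E tau x /\ E tau x <= (tau * K)%:E)%E}.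
Proof.
move=> /andP[tau0 tauT]; apply: (aeS (mu := leb)) good => x gx nB.
have {}gx := gx nB.
have mI : measurable (`]0, tau]%classic : set (measurableTypeR R)) by exact: measurable_itv.
have mex := measurable_slice2 x meta; have mqx := measurable_slice2 x mq.
have inT t : `]0, tau]%classic t -> 0 < t < T.
  by rewrite /= in_itv/= => /andP[-> /le_lt_trans->].
split.
  apply: (@le_trans _ _ `|\int[leb]_(t in `]0%R, tau]) (q (x, t))%:E|%E).
    (* Infinite values are sent to 0 by [fine], which only lowers the absolute value. *)
    rewrite /time_integral; case: (\int[leb]_(t in _) _)%E => [r||] //=; by rewrite ?normr0 ?leey.
  apply: (le_trans (le_abse_integral _ mI _)); first by apply: measurable_funTS; meas.
  rewrite -ge0_integralZl_EFin//; last 2 first.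
  - by move=> t _; rewrite lee_fin.
  - by apply: measurable_funTS; meas.
  apply: ae_ge0_le_integral => //.
  - by apply: measurable_funTS; meas.
  - by move=> t _; rewrite -EFinM lee_fin mulr_ge0.
  - by apply: measurable_funTS; meas.
  - apply: (aeS (mu := leb)) gx => t gt /inT/gt[+ _].
    by rewrite -EFinM abse_EFin lee_fin.
have -> : (tau * K)%:E = (\int[leb]_(t in `]0%R, tau]) (cst K%:E) t)%E.
  rewrite integral_cst// [X in (_ * X)%E](_ : _ = tau%:E); last exact: measure_I.
  by rewrite muleC -EFinM.
apply: ae_ge0_le_integral => //; try by [move=> t _; rewrite lee_fin|apply: measurable_funTS; meas].
by apply: (aeS (mu := leb)) gx => t gt /inT/gt[_]; rewrite lee_fin.
Qed.

(* Points of the good set near which the flux through the vertical lines is at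
   most [L * e] exist arbitrarily far on both sides. *)
Let slab_bound tau (e : R) (B' : set R) : 0 < tau < T -> 0 <= e -> measurable B' ->
  (leb B' < +oo)%E -> (forall x, ~ B' x -> ~ B x) ->
  {ae leb, forall x, ~ B' x -> (E tau x <= e%:E)%E} ->
  (\int[leb]_x (eta (x, tau))%:E <= C + (2 * (L * e))%:E)%E.
Proof.
move=> tauT e0 mB' fB' B'B Ee.
have met := measurable_slice1 tau meta.
apply: integral_le_exhaustion; [by meas|by move=> x; rewrite lee_fin|move=> n].
have ae1 : {ae leb, forall x, lebesgue_pt (time_integral q tau) x /\
    (~ B' x -> `|time_integral q tau x| <= L * e)}.
  apply: (aeI (mu := leb)); first exact: lebesgue_differentiation (lq tauT).
  have := aeI (mu := leb) (good_bound tauT) Ee.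
  apply: (aeS (mu := leb)) => x [gx ex] nB'.
  have [g1 _] := gx (B'B _ nB'); rewrite -lee_fin (le_trans g1)// EFinM.
  by apply: lee_wpmul2l; [rewrite lee_fin|exact: ex].
have [y [yn nBy [ly By]]] := exists_beyond (I := `]-oo, - n%:R[) mB' fB' ae1 (lebesgue_measure_ray_l _).
have [z [zn nBz [lz Bz]]] := exists_beyond (I := `]n%:R, +oo[) mB' fB' ae1 (lebesgue_measure_ray_r _).
have {}yn : y < - n%:R by move: yn; rewrite in_itv.
have {}zn : n%:R < z by move: zn; rewrite in_itv/= andbT.
exists y, z; split=> //.
have yz : y < z by rewrite (lt_trans yn)// (le_lt_trans _ zn)// (@le_trans _ _ 0)// oppr_le0.
apply: (le_trans (est tauT yz ly lz)); apply: leeD => //; rewrite lee_fin.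
apply: (le_trans (ler_norm _)); apply: (le_trans (ler_normB _ _)).
by rewrite mulr_natl mulr2n lerD// ?By ?Bz.
Qed.

Lemma tail_estimate tau : 0 < tau < T -> (\int[leb]_x (eta (x, tau))%:E <= C)%E.
Proof.
move=> tauT; have /andP[tau0 tauT'] := tauT.
(* First round, with [B] itself as exceptional set and the level T K for [E], which does not depend
   on t. *)
have M t : 0 < t < T -> (\int[leb]_x (eta (x, t))%:E <= C + (2 * (L * (T * K)))%:E)%E.
  move=> tT; have /andP[t0 tT'] := tT.
  apply: (slab_bound (B' := B) tT) => //; first by rewrite mulr_ge0// (le_trans (ltW t0) (ltW tT')).
  apply: (aeS (mu := leb)) (good_bound tT) => x gx nB.
  by have [_ /le_trans] := gx nB; apply; rewrite lee_fin ler_wpM2r// ltW.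
pose M' := fine C + 2 * (L * (T * K)).
have EM : (\int[leb]_x E tau x <= (M' * tau)%:E)%E.
  rewrite E_integral.
  have -> : (M' * tau)%:E = (\int[leb]_(t in `]0%R, tau]) (cst M'%:E) t)%E.
    rewrite integral_cst; last exact: measurable_itv.
    rewrite [X in (_ * X)%E](_ : _ = tau%:E); last exact: measure_I.
    by rewrite -EFinM.
  apply: ge0_le_integral => //.
  - by move=> t _; apply: integral_ge0 => x _; rewrite lee_fin.
  - apply: measurable_funTS.
    apply: (@measurable_integral_snd _ _ _ _ _ leb (fun t x => (eta (x, t))%:E)).
      by meas.
    by move=> t x; rewrite lee_fin.
  - move=> t /=; rewrite in_itv/= => /andP[t0 tt]; rewrite /M' EFinD fineK//.
    by apply: M; rewrite t0 (le_lt_trans tt).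
have Efin : (\int[leb]_x `|E tau x| < +oo)%E.
  under eq_integral do rewrite gee0_abs//.
  by rewrite (le_lt_trans EM)// ltry.
apply/lee_addgt0Pr => e e0.
(* Second round, at a level for which the two vertical sides together contribute 2 L d <= e; using L
   + 1 covers the case L = 0. *)
pose d := e / (2 * (L + 1)).
have d0 : 0 < d by rewrite divr_gt0// mulr_gt0// ltr_wpDl.
pose B' := B `|` [set x | (d%:E <= `|E tau x|)%E].
have mS := measurable_superlevel d (mE tau).
have fS := superlevel_measure_lty (mu := leb) (mE tau) d0 Efin.
have mB' : measurable B' by exact: measurableU.
have fB' : (leb B' < +oo)%E.
  have le2 : (leb B' <= leb B + leb [set x | (d%:E <= `|E tau x|)%E])%E by exact: measureU2.
  by apply: (le_lt_trans le2); exact: lte_add_pinfty.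
apply: (le_trans (slab_bound tauT (ltW d0) mB' fB' _ _)).
- by move=> x nB' Bx; apply: nB'; left.
- apply: aeW => x nB'; apply/ltW; rewrite ltNge; apply/negP => dx; apply: nB'; right.
  by rewrite /= gee0_abs.
- apply: leeD => //; rewrite lee_fin /d.
  have L1 : 0 < L + 1 by rewrite ltr_wpDl.
  have -> : 2 * (L * (e / (2 * (L + 1)))) = e * (L / (L + 1)) by field; rewrite gt_eqF.
  by rewrite ler_piMr ?(ltW e0)// ler_pdivrMr// mul1r lerDl.
Qed.

End tails.

(** * Extension by zero outside the time interval *)

Section truncation.
Context {R : realType}.
Variable T : R.

(** A solution is measurable on the slab only. Extending by 0 makes it measurable on the plane, as
    Fubini requires there, and keeps the strip condition because 0 and 0 are at distance at most
    a. *)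
Definition slab_ext (v : R * R -> R) (z : R * R) : R := if z.2 \in `[0, T[ then v z else 0.

Lemma slab_extE v z : slab `[0, T[ z -> slab_ext v z = v z.
Proof. by rewrite /slab/= /slab_ext => ->. Qed.

Lemma slab_ext_slice v x t : t \in `[0, T[ -> slab_ext v (x, t) = v (x, t).
Proof. by move=> tT; rewrite /slab_ext/= tT. Qed.

Lemma C0_L1loc_slab_ext v : C0_L1loc T v ->
  measurable_fun setT (slab_ext v) /\ C0_L1loc T (slab_ext v).
Proof.
move=> [mv lv cv]; have mS := measurable_slab `[0, T[.
have mext : measurable_fun setT (slab_ext v).
  rewrite (_ : slab_ext v = v \_ (slab `[0, T[)); first exact/(measurable_restrictT v mS).
  apply/funext => z; rewrite patchE /slab_ext.
  have -> // : (z \in slab `[0, T[) = (z.2 \in `[0, T[).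
  by apply/idP/idP; rewrite inE.
have ext t : t \in `[0, T[ -> (fun x => slab_ext v (x, t)) = (fun x => v (x, t)).
  by move=> tT; apply/funext => x; exact: slab_ext_slice.
split=> //; split.
- exact: measurable_funTS.
- by move=> t tT; rewrite ext//; exact: lv.
- move=> t K tT cK; have := cv t K tT cK; apply: cvg_trans; apply: near_eq_cvg.
  near=> s; apply: eq_integral => x _; rewrite !slab_ext_slice//.
  by near: s; apply: withinT.
Unshelve. all: by end_near. Qed.

Lemma entropy_inequality_slab_ext a f u0 w0 u w : entropy_inequality a T f u0 w0 u w ->
  entropy_inequality a T f u0 w0 (slab_ext u) (slab_ext w).
Proof.
move=> ent phi k tphi ka; have [i e] := ent phi k tphi ka.
have E z : slab `[0, T[ z -> entropy_integrand f (slab_ext u) (slab_ext w) k phi z =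
    entropy_integrand f u w k phi z.
  by move=> zS; rewrite /entropy_integrand !slab_extE.
split.
  apply: eq_integrable i; first exact: measurable_slab.
  by move=> z; rewrite inE => zS; rewrite /= E.
rewrite (_ : (\int[_]_(z in _) _)%E =
  (\int[leb2]_(z in slab `[0, T[%R) (entropy_integrand f u w k phi z)%:E)%E)//.
by apply: eq_integral => z; rewrite inE => zS; rewrite E.
Qed.

Lemma is_distr_dt_slab_ext w
    (nu : {charge set (measurableTypeR R * measurableTypeR R)%type -> \bar R})
    P N (nuPN : hahn_decomposition nu P N) :
  is_distr_dt T w nuPN -> is_distr_dt T (slab_ext w) nuPN.
Proof.
move=> dw phi phiC phis; rewrite -(dw phi phiC phis).
by apply: eq_integral => z; rewrite inE => zS; rewrite slab_extE.
Qed.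

Lemma strip_slab_ext a u w : 0 <= a ->
  {ae leb2, forall z, slab `[0, T[ z -> `|u z - w z| <= a} ->
  {ae plane, forall z, `|slab_ext u z - slab_ext w z| <= a}.
Proof.
move=> a0; apply: (aeS (mu := plane)) => z; rewrite /slab/= /slab_ext.
by case: ifP => [_|_ _]; [apply|rewrite subrr normr0].
Qed.

End truncation.

Lemma is_Ck_continuous (R : realType) (f : R -> R) k : is_Ck k f -> continuous f.
Proof. by move=> /(_ [::])[_]; apply. Qed.

Lemma is_C2_derivable (R : realType) (f : R -> R) : is_Ck 2 f ->
  (forall x : R, is_derive x 1 f ('D_1 f x)) /\ continuous ('D_1 f).
Proof.
move=> f2; split; last by have [_] := f2 [:: 1]; apply.
move=> x; apply: DeriveDef => //; apply: diff_derivable.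
by have [+ _] := f2 [::]; apply.
Qed.

Lemma is_C2_lipschitz (R : realType) (f : R -> R) (M : R) : is_Ck 2 f -> 0 <= M ->
  exists2 L, 0 <= L & forall x y, `|x| <= M -> `|y| <= M -> `|f x - f y| <= L * `|x - y|.
Proof.
move=> f2 M0; have [df cdf] := is_C2_derivable f2.
have [||c cM cmax] := @EVT_max R (fun x => `|'D_1 f x|) (- M) M; first by rewrite ge0_cp.
  by apply: continuous_subspaceT => x; apply: continuous_comp (cdf x) _; exact: norm_continuous.
exists `|'D_1 f c| => // x y.
wlog xy : x y / x <= y.
  move=> h xM yM; have [xy|/ltW yx] := leP x y; first exact: h.
  by rewrite distrC [`|x - y|]distrC; exact: h.
have bM z : `|z| <= M -> - M <= z <= M by rewrite ler_norml.
move=> /bM/andP[x1 x2] /bM/andP[y1 y2].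
have [|d dxy fd] := @MVT_segment R f ('D_1 f) x y xy (fun z _ => df z).
  by apply: continuous_subspaceT; exact: is_Ck_continuous f2.
rewrite distrC fd normrM [`|x - y|]distrC ler_wpM2r//; apply: cmax.
by move: dxy; rewrite !in_itv/= => /andP[d1 d2]; rewrite (le_trans x1 d1) (le_trans d2 y2).
Qed.

(** * The contraction estimate *)

Section contraction.
Context {R : realType}.
Variables (a T : R) (f u01 w01 u02 w02 : R -> R) (u1 w1 u2 w2 : R * R -> R).
Hypothesis a0 : 0 < a.
Hypothesis T0 : 0 < T.
Hypothesis f2 : is_Ck 2 f.
Hypothesis convf : strictly_convex f.
Hypothesis iu01 : leb.-integrable setT (EFin \o u01).
Hypothesis iw01 : leb.-integrable setT (EFin \o w01).
Hypothesis iu02 : leb.-integrable setT (EFin \o u02).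
Hypothesis iw02 : leb.-integrable setT (EFin \o w02).
Hypothesis lu01 : locally_integrable setT u01.
Hypothesis lw01 : locally_integrable setT w01.
Hypothesis lu02 : locally_integrable setT u02.
Hypothesis lw02 : locally_integrable setT w02.
Hypothesis strip01 : {ae leb, forall x, `|u01 x - w01 x| <= a}.
Hypothesis strip02 : {ae leb, forall x, `|u02 x - w02 x| <= a}.
Hypothesis mu1 : measurable_fun setT u1.
Hypothesis mw1 : measurable_fun setT w1.
Hypothesis mu2 : measurable_fun setT u2.
Hypothesis mw2 : measurable_fun setT w2.
Hypothesis ent1 : entropy_inequality a T f u01 w01 u1 w1.
Hypothesis ent2 : entropy_inequality a T f u02 w02 u2 w2.
Hypothesis strip1 : {ae plane, forall z, `|u1 z - w1 z| <= a}.
Hypothesis strip2 : {ae plane, forall z, `|u2 z - w2 z| <= a}.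
Hypothesis cu1 : C0_L1loc T u1.
Hypothesis cw1 : C0_L1loc T w1.
Hypothesis cu2 : C0_L1loc T u2.
Hypothesis cw2 : C0_L1loc T w2.
Variables (nu1 nu2 : {charge set (measurableTypeR R * measurableTypeR R)%type -> \bar R}).
Variables (P1 N1 P2 N2 : set (measurableTypeR R * measurableTypeR R)).
Variables (PN1 : hahn_decomposition nu1 P1 N1) (PN2 : hahn_decomposition nu2 P2 N2).
Hypothesis dw1 : is_distr_dt T w1 PN1.
Hypothesis dw2 : is_distr_dt T w2 PN2.

Let cf : continuous f.
Proof. exact: is_Ck_continuous f2. Qed.

Let trace1 := initial_trace T0 cf mu1 mw1 a0 ent1 cu1 cw1 lu01 lw01 strip01.
Let trace2 := initial_trace T0 cf mu2 mw2 a0 ent2 cu2 cw2 lu02 lw02 strip02.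

Let eta0 x : R := `|u01 x - u02 x| + `|w01 x - w02 x|.

Let meta : measurable_fun setT (eta u1 w1 u2 w2).
Proof. by rewrite /eta; meas. Qed.

Let eta_init : (\int[leb]_x (eta u1 w1 u2 w2 (x, 0%R))%:E = \int[leb]_x (eta0 x)%:E)%E.
Proof.
apply: ae_eq_integral => //.
- by have := measurable_slice1 0 meta; move=> m; meas.
- have [m1 _ _] := lu01; have [m2 _ _] := lu02; have [m3 _ _] := lw01; have [m4 _ _] := lw02.
  by rewrite /eta0; meas.
- have := aeI (mu := leb) trace1 trace2.
  apply: (aeS (mu := leb)) => x [[e1 e2] [e3 e4]] _.
  by rewrite /eta/= e1 e2 e3 e4.
Qed.

Let eta0_fin : (\int[leb]_x (eta0 x)%:E)%E \is a fin_num.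
Proof.
apply: integrable_fin_num => //.
have i1 := integrable_norm (integrableB measurableT iu01 iu02).
have i2 := integrable_norm (integrableB measurableT iw01 iw02).
exact: integrableD i1 i2.
Qed.

Let iwbox1 r s : 0 < r -> 0 <= s -> s < T -> plane.-integrable (box r s) (EFin \o w1).
Proof.
move=> r0 s0 sT; apply: le_integrable (integrable_uw_box mu1 mw1 a0 ent1 r0 s0 sT) => //.
  by apply: measurable_funTS; meas.
by move=> z _; rewrite /= lee_fin [leRHS]ger0_norm ?addr_ge0// lerDr.
Qed.

Let iwbox2 r s : 0 < r -> 0 <= s -> s < T -> plane.-integrable (box r s) (EFin \o w2).
Proof.
move=> r0 s0 sT; apply: le_integrable (integrable_uw_box mu2 mw2 a0 ent2 r0 s0 sT) => //.
  by apply: measurable_funTS; meas.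
by move=> z _; rewrite /= lee_fin [leRHS]ger0_norm ?addr_ge0// lerDr.
Qed.

(** The exceptional null sets vary with t, but their union over t is a measurable subset of the
    plane with null slices, hence null. *)
Let increment (w : R * R -> R) (V : R -> \bar R) : measurable_fun setT w -> measurable_fun setT V ->
  (forall t, 0 < t -> t < T -> {ae leb, forall y, (`|w (y, t) - w (y, 0)|%:E <= V y)%E}) ->
  {ae plane, forall z, 0 < z.2 < T -> (`|w z - w (z.1, 0%R)|%:E <= V z.1)%E}.
Proof.
move=> mw mV wV.
pose A := [set z : R * R | (V z.1 < `|w z - w (z.1, 0%R)|%:E)%E] `&` slab `]0, T[.
have mw0 : measurable_fun setT (fun z : R * R => w (z.1, 0)).
  have m0 := measurable_slice1 0 mw; exact: (measurableT_comp m0 measurable_fst).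
have mA : measurable A.
  apply: measurableI; last exact: measurable_slab.
  rewrite -[X in measurable X]setTI; apply: measurable_lte => //; last by meas.
  exact: (measurableT_comp mV measurable_fst).
exists A; split => //.
- apply: plane_null_of_slices => // t.
  have [/andP[t0 tT]|/negP nt] := boolP (0 < t < T).
    apply: (aeS (mu := leb)) (wV t t0 tT) => x le [/= + _].
    by rewrite ltNge le.
  by apply: aeW => x [_]; rewrite /slab/= in_itv.
- move=> z /= /not_implyP[zT /negP]; rewrite -ltNge => lt; split=> //.
Qed.

Let V1 := variation_density PN1.
Let V2 := variation_density PN2.

Lemma contraction tau : 0 <= tau -> tau < T ->
  (\int[leb]_x (eta u1 w1 u2 w2 (x, tau))%:E <= \int[leb]_x (eta0 x)%:E)%E.
Proof.
(* At tau = 0 both sides are equal by the initial trace. *)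
rewrite le_eqVlt => /predU1P[<- _|tau0 tauT]; first by rewrite eta_init.
have mV1 : measurable_fun setT V1 := measurable_variation_density PN1.
have mV2 : measurable_fun setT V2 := measurable_variation_density PN2.
pose W1 x := (w1 (x, 0))%:E; pose W2 x := (w2 (x, 0))%:E.
have mW1 : measurable_fun setT W1 by apply/measurable_EFinP; exact: measurable_slice1.
have mW2 : measurable_fun setT W2 by apply/measurable_EFinP; exact: measurable_slice1.
pose S (g : R -> \bar R) := [set x | (1%:E <= `|g x|)%E].
(* Off [B] the initial values of [w1], [w2] and their increments in time are below 1, so both
   functions are at most 2 in absolute value. The four pieces have finite measure as superlevel sets
   of integrable functions. *)
pose B := S W1 `|` S W2 `|` (S V1 `|` S V2).
have mS g : measurable_fun setT g -> measurable (S g) by exact: measurable_superlevel.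
have mB : measurable B by do !apply: measurableU; exact: mS.
have fS g : measurable_fun setT g -> (\int[leb]_x `|g x| < +oo)%E -> (leb (S g) < +oo)%E.
  by move=> mg ig; exact: (superlevel_measure_lty (mu := leb) mg ltr01 ig).
have fV1 : (\int[leb]_x `|V1 x| < +oo)%E.
  by under eq_integral do rewrite gee0_abs ?variation_density_ge0//; exact: variation_density_integral_lty.
have fV2 : (\int[leb]_x `|V2 x| < +oo)%E.
  by under eq_integral do rewrite gee0_abs ?variation_density_ge0//; exact: variation_density_integral_lty.
have fW (w : R * R -> R) (w0 : R -> R) : measurable_fun setT w ->
    {ae leb, forall x, w (x, 0) = w0 x} -> leb.-integrable setT (EFin \o w0) ->
    (\int[leb]_x `|(w (x, 0%R))%:E| < +oo)%E.
  move=> mw ww0 /integrableP[m0]; apply: le_lt_trans.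
  rewrite le_eqVlt; apply/orP; left; apply/eqP; apply: ae_eq_integral => //.
  - by have m := measurable_slice1 0 mw; meas.
  - exact: measurableT_comp.
  - by apply: (aeS (mu := leb)) ww0 => x -> _.
have fW1 : (\int[leb]_x `|W1 x| < +oo)%E.
  by apply: (fW _ _ mw1 _ iw01); apply: (aeS (mu := leb)) trace1 => x [].
have fW2 : (\int[leb]_x `|W2 x| < +oo)%E.
  by apply: (fW _ _ mw2 _ iw02); apply: (aeS (mu := leb)) trace2 => x [].
have fU (A D : set R) : measurable A -> measurable D -> (leb A < +oo)%E -> (leb D < +oo)%E ->
    (leb (A `|` D) < +oo)%E.
  move=> mA mD fA fD; have le2 : (leb (A `|` D) <= leb A + leb D)%E by exact: measureU2.
  by apply: (le_lt_trans le2); exact: lte_add_pinfty.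
have fB : (leb B < +oo)%E.
  have [s1 s2] := (mS _ mW1, mS _ mW2); have [s3 s4] := (mS _ mV1, mS _ mV2).
  exact: (fU _ _ (measurableU _ _ s1 s2) (measurableU _ _ s3 s4)
    (fU _ _ s1 s2 (fS _ mW1 fW1) (fS _ mW2 fW2)) (fU _ _ s3 s4 (fS _ mV1 fV1) (fS _ mV2 fV2))).
(* The strip condition turns the bound 2 on [w1] and [w2] into 2 + a on [u1] and [u2]; [L] is a
   Lipschitz constant of f on [- M, M]. The bound 2 M + 4 on [eta] used below adds 2 M for the
   difference of the u and 4 for that of the w. *)
pose M := 2 + a.
have M0 : 0 <= M by rewrite addr_ge0// ltW.
have [L L0 Lf] := is_C2_lipschitz f2 M0.
have inc1 := increment mw1 mV1 (time_increment_le mw1 cw1 iwbox1 dw1).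
have inc2 := increment mw2 mV2 (time_increment_le mw2 cw2 iwbox2 dw2).
have good : {ae leb, forall x, ~ B x -> {ae leb, forall t, 0 < t < T ->
    `|qflux f u1 u2 (x, t)| <= L * eta u1 w1 u2 w2 (x, t) /\ eta u1 w1 u2 w2 (x, t) <= 2 * M + 4}}.
  have := ae_slices_of_plane (aeI (mu := plane) (aeI (mu := plane) strip1 strip2) (aeI (mu := plane) inc1 inc2)).
  apply: (aeS (mu := leb)) => x aet nB.
  have small (g : R -> \bar R) : ~ S g x -> (`|g x| < 1%:E)%E by rewrite /S/= => /negP; rewrite -ltNge.
  have sW1 : `|w1 (x, 0)| < 1 by have := small W1; rewrite lte_fin; apply => h; apply: nB; left; left.
  have sW2 : `|w2 (x, 0)| < 1 by have := small W2; rewrite lte_fin; apply => h; apply: nB; left; right.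
  have sV1 : (V1 x < 1%:E)%E.
    by rewrite -[V1 x]gee0_abs ?variation_density_ge0//; apply: small => h; apply: nB; right; left.
  have sV2 : (V2 x < 1%:E)%E.
    by rewrite -[V2 x]gee0_abs ?variation_density_ge0//; apply: small => h; apply: nB; right; right.
  apply: (aeS (mu := leb)) aet => t [[s1 s2] [i1 i2]] tT.
  have {}i1 : `|w1 (x, t) - w1 (x, 0)| < 1 by have := le_lt_trans (i1 tT) sV1; rewrite lte_fin.
  have {}i2 : `|w2 (x, t) - w2 (x, 0)| < 1 by have := le_lt_trans (i2 tT) sV2; rewrite lte_fin.
  have bw (p q : R) : `|q| < 1 -> `|p - q| < 1 -> `|p| <= 2.
    move=> q1 pq; rewrite -[p](subrK q) (le_trans (ler_normD _ _))// ltW//.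
    by rewrite (_ : 2 = 1 + 1) ?ltrD.
  have b1 := bw _ _ sW1 i1; have b2 := bw _ _ sW2 i2.
  have bu (p q : R) : `|q| <= 2 -> `|p - q| <= a -> `|p| <= M.
    by move=> q2 pq; rewrite -[p](subrK q) (le_trans (ler_normD _ _))// addrC lerD.
  have c1 := bu _ _ b1 s1; have c2 := bu _ _ b2 s2.
  split.
    rewrite /qflux (le_trans (kflux_le _ _ _))// (le_trans (Lf _ _ c1 c2))// ler_wpM2l//.
    by rewrite /eta lerDl.
  rewrite /eta (_ : 2 * M + 4 = (M + M) + (2 + 2)); last by ring.
  by rewrite lerD// (le_trans (ler_normB _ _))// lerD.
have K0 : 0 <= 2 * M + 4 by rewrite addr_ge0// mulr_ge0.
have [df _] := is_C2_derivable f2.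
apply: (@tail_estimate R T L (2 * M + 4) (eta u1 w1 u2 w2) (qflux f u1 u2) B) => //.
- exact: measurable_kflux.
- by move=> z; rewrite addr_ge0.
- move=> t /andP[t0 tT]; apply: locally_integrable_time_integral; first exact: measurable_kflux.
  by move=> r r0; exact: (integrable_qflux_box cf mu1 mu2 a0 ent1 ent2 r0 (ltW t0) tT).
- move=> t y z /andP[t0 tT] yz Qy Qz.
  apply: le_trans (kato_interval cf convf (df 0) mu1 mw1 mu2 mw2 a0 ent1 ent2 strip1 strip2
    cu1 cw1 cu2 cw2 t0 tT yz Qy Qz) _.
  apply: leeD => //; rewrite -eta_init; apply: ge0_subset_integral => //.
    by have m := measurable_slice1 0 meta; meas.
  by move=> x _; rewrite lee_fin addr_ge0.
- by rewrite tau0.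
Qed.

End contraction.

Theorem theorem4p3 (R : realType) (a T : R) (f : R -> R)
    (u01 w01 u02 w02 : R -> R) (u1 w1 u2 w2 : R * R -> R) :
  0 < a -> 0 < T ->
  is_Ck 2 f -> strictly_convex f ->
  u01 \in Lfun leb 1 -> is_BV u01 -> w01 \in Lfun leb 1 -> is_BV w01 ->
  u02 \in Lfun leb 1 -> is_BV u02 -> w02 \in Lfun leb 1 -> is_BV w02 ->
  {ae leb, forall x, `|u01 x - w01 x| <= a} ->
  {ae leb, forall x, `|u02 x - w02 x| <= a} ->
  entropy_weak_solution a T f u01 w01 u1 w1 ->
  entropy_weak_solution a T f u02 w02 u2 w2 ->
  {ae leb, forall t, t \in `[0, T[ ->
    (\int[leb]_x (`|u1 (x, t) - u2 (x, t)| + `|w1 (x, t) - w2 (x, t)|)%:E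
     <= \int[leb]_x (`|u01 x - u02 x| + `|w01 x - w02 x|)%:E)%E}.
Proof.
move=> a0 T0 f2 convf /Lfun1_integrable iu01 [lu01 _] /Lfun1_integrable iw01 [lw01 _].
move=> /Lfun1_integrable iu02 [lu02 _] /Lfun1_integrable iw02 [lw02 _] s01 s02.
move=> [[cu1 cw1] ent1 s1 [_ [nu1 [P1 [N1 [PN1 [dw1 _]]]]]]].
move=> [[cu2 cw2] ent2 s2 [_ [nu2 [P2 [N2 [PN2 [dw2 _]]]]]]].
have [mu1 {}cu1] := C0_L1loc_slab_ext cu1; have [mw1 {}cw1] := C0_L1loc_slab_ext cw1.
have [mu2 {}cu2] := C0_L1loc_slab_ext cu2; have [mw2 {}cw2] := C0_L1loc_slab_ext cw2.
(* The estimate is obtained at every time, thanks to the continuity of the slices. *)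
apply: aeW => t tT; have /andP[t0 tT'] : 0 <= t < T by rewrite in_itv in tT.
have := contraction a0 T0 f2 convf iu01 iw01 iu02 iw02 lu01 lw01 lu02 lw02 s01 s02 mu1 mw1 mu2 mw2
  (entropy_inequality_slab_ext ent1) (entropy_inequality_slab_ext ent2)
  (strip_slab_ext (ltW a0) s1) (strip_slab_ext (ltW a0) s2) cu1 cw1 cu2 cw2
  (is_distr_dt_slab_ext dw1) (is_distr_dt_slab_ext dw2) t0 tT'.
by rewrite /eta; under eq_integral do rewrite !slab_ext_slice//.
Qed.
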